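(* Let $(n_k)_{k \in \mathbb{N}}$ be an enumeration of $\mathbb{Z}^d$, and let $(t_k)_{k \in \mathbb{N}} \subset \mathbb{R}^d$, $t_k=(t_{k,1},\ldots,t_{k,d})$, be such that $\lim_{k \rightarrow \infty} \| n_k - t_k \|_\infty = 0$. Define $e_k,f_k:\mathbb{R}^d\to\mathbb{C}$ by $e_k(x) = \frac{1}{(2\pi)^{d/2}} e^{i \langle n_k , x \rangle}$ and $f_k(x) = \frac{1}{(2\pi)^{d/2}} e^{i \langle t_k , x \rangle}$. Let $(h_k)_k$ be the standard basis of $\ell_2(\mathbb{N})$ and let $P_l:\ell_2(\mathbb{N}) \rightarrow \ell_2(\mathbb{N})$ be the orthogonal projection onto $\mathrm{span}\{h_1,\ldots,h_l\}$. Let $\lambda_0>1$, let $g$ be such that $\mathcal{F}^{-1}(g):\mathbb{R}^d\to\mathbb{R}$ is $C^\infty$, equal to $1$ on $[-\pi,\pi]^d$ and equal to $0$ off $\lambda_0[-\pi,\pi]^d$, and let $\lambda\ge\lambda_0$. If $(f_k)_{k \in \mathbb{N}}$ is a Riesz basis for $L_2([-\pi,\pi]^d)$, with frame operator $S$, and $B$ is the operator on $\ell_2(\mathbb{N})$ with matrix entries $B_{kn} = \langle S^{-1}f_n , S^{-1}f_k \rangle_{L_2([-\pi,\pi]^d)}$, then for all $f \in PW_{[-\pi,\pi]^d}$, $$f(t) = \lim_{l \rightarrow \infty} \frac{1}{\lambda^d}\sum_{k=1}^l \big[(P_l B^{-1} P_l)^{-1} f_{S/\lambda}\big]_k\, g\big(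 t-\tfrac{t_k}{\lambda} \big), \qquad t \in \mathbb{R}^d,$$ where $f_{S/\lambda} = \big(f(t_k/\lambda)\big)_{k\in\mathbb{N}}$ and the convergence is in $L_2$ and uniform. Furthermore, $$(P_l B^{-1} P_l)_{nm} = \begin{cases} \mathrm{sinc}\,\pi(t_{n,1}-t_{m,1}) \cdots \mathrm{sinc}\,\pi(t_{n,d}-t_{m,d}), & 1 \leq n,m \leq l,\\ 0, & \text{otherwise.}\end{cases}$$
   Context: Convention: $(P_l B^{-1} P_l)^{-1}$ denotes the inverse of $P_lB^{-1}P_l$ regarded as an $l\times l$ matrix (its first $l$ rows and columns), acting on the first $l$ coordinates of $f_{S/\lambda}$. In the notation $f_{S/\lambda}$, the letter $S$ refers to the sequence $(t_k)_{k\in\mathbb{N}}$, not to the frame operator. Fourier transform on $L_2(\mathbb{R}^d)$: $\mathcal{F}(f)(\cdot) = \int_{\mathbb{R}^d} f(\xi)e^{-i \langle \cdot , \xi \rangle}\, d\xi$, with inverse $\mathcal{F}^{-1}(f)(\cdot) = \frac{1}{(2\pi)^d}\int_{\mathbb{R}^d} f(\xi)e^{i \langle \cdot , \xi \rangle}\, d\xi$ (integrals understood as principal values, with limits in the $L_2$ sense). For a bounded measurable set $E$ of positive measure, $PW_E = \{f \in L_2(\mathbb{R}^d) : \mathrm{supp}(\mathcal{F}^{-1}(f)) \subset E\}$; its elements are regarded as continuous functions on $\mathbb{R}^d$. $\mathrm{sinc}(x) = \frac{\sin x}{x}$, with $\mathrm{sinc}(0)=1$. Given an orthonormal basis $(u_n)_n$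 of a Hilbert space $H$, a sequence $(f_n)_n\subset H$ is a Riesz basis for $H$ if the map $Lu_n = f_n$ is (extends to) an onto isomorphism $H\to H$. The frame operator of $(f_n)_n$ is $Sf = \sum_n \langle f, f_n\rangle f_n$; it is a positive self-adjoint onto isomorphism of $H$. For a Riesz basis, $B$ is a bounded invertible operator on $\ell_2(\mathbb{N})$. Inner products are linear in the first variable.
   Formalization: The reconstruction series carries an extra factor (2π)^{-d}: with the stated normalization of F and F^{-1}(g)=1 on [-π,π]^d, the printed formula is off by (2π)^d for every f≠0; g is taken to be its continuous representative. *)

(* Defs.v *)
From HB Require Import structures.
From mathcomp Require Import all_boot all_order all_algebra.
From mathcomp Require Import complex.
From mathcomp Require Import all_classical all_reals all_analysis.

Set Implicit Arguments.
Unset Strict Implicit.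
Unset Printing Implicit Defensive.

Import Order.TTheory GRing.Theory Num.Theory.
Import numFieldNormedType.Exports.

Local Open Scope classical_set_scope.
Local Open Scope ring_scope.
Local Open Scope complex_scope.

(* numFieldNormedType only covers variables of a numeric field type, not the
   concrete type R[i].                                                        *)
HB.instance Definition _ (R : realType) := NormedModule.copy R[i] R[i]^o.

Section row_measurable.
Context {d : measure_display} {T : measurableType d}.
Variable n : nat.

Let coord : 'I_n -> 'rV[T]_n -> T := fun i x => x 0 i.

Let row_set0 : g_sigma_preimage coord set0.
Proof. exact: sigma_algebra0. Qed.

Let row_setC A : g_sigma_preimage coord A -> g_sigma_preimage coord (~` A).
Proof. exact: sigma_algebraC. Qed.

Let row_bigcup (F : _^nat) : (forall i, g_sigma_preimage coord (F i)) ->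
  g_sigma_preimage coord (\bigcup_i (F i)).
Proof. exact: sigma_algebra_bigcup. Qed.

HB.instance Definition _ := @isMeasurable.Build (measure_tuple_display d)
  'rV[T]_n (g_sigma_preimage coord) row_set0 row_setC row_bigcup.

End row_measurable.

Lemma measurable_coord d (T : measurableType d) n (i : 'I_n) :
  measurable_fun [set: 'rV[T]_n] (fun x : 'rV[T]_n => x 0 i).
Proof.
move=> _ Y mY; rewrite setTI; apply: sub_sigma_algebra => /=.
rewrite -bigcup_seq/=; exists i => /=; first by rewrite mem_index_enum.
by exists Y => //; rewrite setTI.
Qed.

Lemma measurable_fun_coordP d1 d2 (T1 : measurableType d1)
    (T2 : measurableType d2) n (f : T1 -> 'rV[T2]_n) :
  (forall i, measurable_fun [set: T1] (fun x => f x 0 i)) ->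
  measurable_fun [set: T1] f.
Proof.
move=> mf; apply: (@measurability _ _ _ _ _ _
  (\big[setU/set0]_(i < n) preimage_set_system setT (fun x : 'rV[T2]_n => x 0 i)
    measurable)) => //.
move=> _ [A + <-]; rewrite -bigcup_seq /= => -[i _ [B mB <-]].
by rewrite setTI; exact: mf.
Qed.

Section lebesgue_row.
Context (R : realType).

Definition row_cons n (p : R * 'rV[R]_n) : 'rV[R]_n.+1 :=
  row_mx (p.1)%:M p.2.

Lemma measurable_row_cons n : measurable_fun setT (@row_cons n).
Proof.
apply: measurable_fun_coordP => i; rewrite /row_cons.
case: (@split_ordP 1 n i) => j ->.
  rewrite (_ : (fun _ => _) = fst)//; apply/funext => x.
  by rewrite (row_mxEl (x.1)%:M x.2 0 j) mxE !ord1 eqxx.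
rewrite (_ : (fun _ => _) = (fun x : 'rV[R]_n => x 0 j) \o snd).
  by apply: measurableT_comp => //; exact: measurable_coord.
by apply/funext => x; rewrite (row_mxEr (x.1)%:M x.2 0 j).
Qed.

Definition row_product n (mu : {measure set 'rV[R]_n -> \bar R}) :=
  pushforward (lebesgue_measure \x^ mu)%E (@row_cons n).

HB.instance Definition _ n (mu : {measure set 'rV[R]_n -> \bar R}) :=
  Measure.copy (row_product mu)
    (measure_function_pushforward__canonical__measure_function_Measure
      (lebesgue_measure \x^ mu)%E (@measurable_row_cons n)).

Fixpoint lebesgue_row_rec n : {measure set 'rV[R]_n -> \bar R} :=
  match n with
  | 0 => \d_(0 : 'rV[R]_0)
  | m.+1 => row_product (lebesgue_row_rec m)
  end.

Definition lebesgue_row n : set 'rV[R]_n -> \bar R := lebesgue_row_rec n.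

HB.instance Definition _ n :=
  Measure.copy (@lebesgue_row n) (lebesgue_row_rec n).

Lemma measurable_box n (A : 'I_n -> set R) : (forall i, measurable (A i)) ->
  measurable [set x : 'rV[R]_n | forall i, A i (x 0 i)].
Proof.
move=> mA; rewrite (_ : [set _ | _] = \bigcap_(i in setT)
    ((fun x : 'rV[R]_n => x 0 i) @^-1` A i)); last first.
  by apply/seteqP; split => [x Ax i _|x Ax i]; exact: Ax.
apply: fin_bigcap_measurable => // i _; rewrite -[X in measurable X]setTI.
exact: measurable_coord.
Qed.

Lemma lebesgue_rowE n (A : 'I_n -> set R) : (forall i, measurable (A i)) ->
  @lebesgue_row n [set x | forall i, A i (x 0 i)] =
  (\prod_(i < n) lebesgue_measure (A i))%E.
Proof.
elim: n A => [|n IHn] A mA.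
  have A0 : [set x : 'rV[R]_0 | forall i, A i (x 0 i)] 0 by move=> -[].
  by rewrite big_ord0 /lebesgue_row /= diracE mem_set.
rewrite big_ord_recl -IHn//= /lebesgue_row /= /row_product /pushforward.
set B := [set x : 'rV[R]_n | forall i, A (lift ord0 i) (x 0 i)].
have mB : measurable B by exact: (@measurable_box n _ (fun i => mA (lift ord0 i))).
rewrite -[RHS](product_measure2E lebesgue_measure (lebesgue_row_rec n)
  (mA ord0) mB).
congr ((lebesgue_measure \x^ lebesgue_row_rec n)%E _).
apply/seteqP; split => -[x v] /=.
  move=> xvA; split=> [|i].
    have := xvA ord0; rewrite /row_cons /=.
    rewrite (_ : ord0 = lshift n (0 : 'I_1)); last exact/val_inj.
    by rewrite (row_mxEl x%:M v 0 0) mxE eqxx.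
  have := xvA (lift ord0 i); rewrite {1}/row_cons /=.
  rewrite {2}(_ : lift ord0 i = rshift 1 i); last exact/val_inj.
  by rewrite (row_mxEr x%:M v 0 i).
move=> [xA vA] i; rewrite /row_cons /=.
case: (@split_ordP 1 n i) => j ->.
  rewrite (row_mxEl x%:M v 0 j) mxE ord1 eqxx.
  by rewrite (_ : lshift n 0 = ord0)//; exact/val_inj.
rewrite (row_mxEr x%:M v 0 j) (_ : rshift 1 j = lift ord0 j)//.
exact/val_inj.
Qed.

Lemma sigma_finite_lebesgue_row n : sigma_finite setT (@lebesgue_row n).
Proof.
exists (fun k => [set x : 'rV[R]_n | forall i, `[- k%:R : R, k%:R]%classic (x 0 i)]).
  apply/esym/seteqP; split => // x _; exists (Num.bound `|x|) => //= i.
  rewrite in_itv /= -ler_norml ltW// (le_lt_trans _ (archi_boundP _))//.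
  rewrite /Num.norm/= mx_normrE.
  exact: (le_bigmax _ (fun ij => `|x ij.1 ij.2|) (0, i)).
move=> k; split.
  by apply: (@measurable_box n (fun=> `[- k%:R : R, k%:R]%classic)) => i.
rewrite (@lebesgue_rowE n (fun=> `[- k%:R : R, k%:R]%classic))//.
rewrite ltey_eq; apply/orP; left.
elim/big_ind : _ => // [x y xoo yoo|i _]; first exact: fin_numM.
by rewrite lebesgue_measure_itv; case: ifP.
Qed.

HB.instance Definition _ n := Measure_isSigmaFinite.Build _ _ _ (@lebesgue_row n)
  (@sigma_finite_lebesgue_row n).
End lebesgue_row.

Section L2.
Context {d : measure_display} {T : measurableType d} {R : realType}.
Variables (mu : {measure set T -> \bar R}) (D : set T).
Implicit Types f g h : T -> R[i].

Definition cintegral f : R[i] :=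
  (\int[mu]_(x in D) complex.Re (f x)) +i* (\int[mu]_(x in D) complex.Im (f x)).

Definition L2norm f : \bar R :=
  ('N[mu]_2%:E[(fun x => (Normc.normc (f x))%:E) \_ D])%E.

(* Elements of L_2(D) are represented by functions on T, identified when they
   agree almost everywhere on D; their values off D are irrelevant.           *)
Definition L2 f : Prop :=
  [/\ measurable_fun D (fun x => complex.Re (f x)),
      measurable_fun D (fun x => complex.Im (f x))
    & (L2norm f < +oo)%E].

Definition L2eq f g : Prop := {ae mu, forall x, D x -> f x = g x}.

Definition L2dot f g : R[i] := cintegral (fun x => f x * (g x)^*).

Definition L2cvg (u : nat -> T -> R[i]) f : Prop :=
  L2norm (fun x => u k x - f x) @[k --> \oo] --> 0%E.

Definition bounded_operator (L : (T -> R[i]) -> (T -> R[i])) : Prop :=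
  [/\ forall f, L2 f -> L2 (L f),
      forall a f g, L2 f -> L2 g ->
        L2eq (L (fun x => a * f x + g x)) (fun x => a * L f x + L g x)
    & exists c : R, forall f, L2 f -> (L2norm (L f) <= c%:E * L2norm f)%E].

Definition isomorphism (L : (T -> R[i]) -> (T -> R[i])) : Prop :=
  bounded_operator L /\
  exists2 L' : (T -> R[i]) -> (T -> R[i]), bounded_operator L' &
    forall f, L2 f -> L2eq (L' (L f)) f /\ L2eq (L (L' f)) f.

Definition orthonormal_basis (u : nat -> T -> R[i]) : Prop :=
  [/\ forall k, L2 (u k),
      forall k m, L2dot (u k) (u m) = (k == m)%:R
    & forall f, L2 f ->
        L2cvg (fun N x => \sum_(k < N) L2dot f (u k) * u k x) f].

Definition riesz_basis (f : nat -> T -> R[i]) : Prop :=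
  exists u, orthonormal_basis u /\
    exists2 L, isomorphism L & forall k, L2eq (L (u k)) (f k).

(* For a Riesz basis f the two choices below are made among functions that
   agree almost everywhere on D.                                              *)
Definition frame_operator (f : nat -> T -> R[i]) (h : T -> R[i]) : T -> R[i] :=
  xget (fun=> 0) [set g | L2 g /\
    L2cvg (fun N x => \sum_(k < N) L2dot h (f k) * f k x) g].

Definition L2inv (L : (T -> R[i]) -> (T -> R[i])) (h : T -> R[i]) : T -> R[i] :=
  xget (fun=> 0) [set g | L2 g /\ L2eq (L g) h].

End L2.

Section l2.
Context {R : realType}.
Implicit Types (x y : nat -> R[i]) (A : (nat -> R[i]) -> (nat -> R[i])).

Definition l2 x : Prop :=
  (\sum_(0 <= k <oo) (Normc.normc (x k) ^+ 2)%:E < +oo)%E.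

(* the preimage of y when A is injective on l2 and y is in its range          *)
Definition l2inv A y : nat -> R[i] :=
  xget (fun=> 0) [set x | l2 x /\ A x = y].

Definition matrix_operator (M : nat -> nat -> R[i]) x : nat -> R[i] :=
  fun k => limn (series (fun n => M k n * x n)).

Definition std_basis (k : nat) : nat -> R[i] := fun j => (j == k)%:R.

(* Basis vectors are numbered from 0: the range is the span of h_0 .. h_{l-1} *)
Definition proj (l : nat) x : nat -> R[i] :=
  fun j => \sum_(k < l) x k * std_basis k j.

Definition compression (l : nat) A x : nat -> R[i] := proj l (A (proj l x)).

Definition entry A (k m : nat) : R[i] := A (std_basis m) k.

Definition corner (l : nat) A : 'M[R[i]]_l := \matrix_(k, m) entry A k m.

End l2.

Section euclidean.
Context {R : realType} {n : nat}.
Implicit Types (f g h : 'rV[R]_n -> R[i]) (x y : 'rV[R]_n).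

Definition dotr x y : R := \sum_(i < n) x 0 i * y 0 i.

Definition expi (a : R) : R[i] := cos a +i* sin a.

Definition exponential (s x : 'rV[R]_n) : R[i] :=
  (((2 * pi) `^ (n%:R / 2))^-1)%:C * expi (dotr s x).

Definition cube (a : R) : set 'rV[R]_n :=
  [set x | forall i, - a <= x 0 i <= a].

Definition partials (s : seq 'I_n) (phi : 'rV[R]_n -> R) : 'rV[R]_n -> R :=
  foldr (fun i psi x => 'D_(delta_mx 0 i) psi x) phi s.

Definition smooth (phi : 'rV[R]_n -> R) : Prop :=
  forall s, continuous (partials s phi) /\
    forall i x, derivable (partials s phi) x (delta_mx 0 i).

(* With this normalization the inverse transform of a convolution product is
   (2 pi)^n times the product of the inverse transforms, so that a kernel g whose
   inverse transform is 1 on E satisfies f * g = (2 pi)^n f when f is in PW_E. *)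
Definition truncated_ifourier f (a : R) : 'rV[R]_n -> R[i] :=
  fun x => (((2 * pi) ^+ n)^-1)%:C *
    cintegral (@lebesgue_row R n) (cube a) (fun xi => f xi * expi (dotr x xi)).

(* The principal value is the L_2 limit over growing cubes; h is determined
   up to almost everywhere equality.                                          *)
Definition is_ifourier f h : Prop :=
  [/\ L2 (@lebesgue_row R n) setT f, L2 (@lebesgue_row R n) setT h
    & L2norm (@lebesgue_row R n) setT (fun x => truncated_ifourier f a x - h x)
        @[a --> +oo] --> 0%E].

(* the support of the a.e. class of h: the complement of the largest open set
   on which h vanishes almost everywhere                                      *)
Definition essential_support h : set 'rV[R]_n :=
  [set x | forall U, open U -> U x -> ~ L2eq (@lebesgue_row R n) U h (fun=> 0)].

Definition paley_wiener (E : set 'rV[R]_n) f : Prop :=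
  continuous f /\ exists2 h, is_ifourier f h & essential_support h `<=` E.

End euclidean.

Definition sinc {R : realType} (x : R) : R := if x == 0 then 1 else sin x / x.

(* Main.v *)
Require Import Defs.
From HB Require Import structures.
From mathcomp Require Import all_boot all_order all_algebra.
From mathcomp Require Import complex.
From mathcomp Require Import all_classical all_reals all_analysis.
From mathcomp Require Import measurable_realfun.
From mathcomp Require Import ring lra zify.

Set Implicit Arguments.
Unset Strict Implicit.
Unset Printing Implicit Defensive.

Import Order.TTheory GRing.Theory Num.Theory.
Import numFieldNormedType.Exports.

Local Open Scope classical_set_scope.
Local Open Scope ring_scope.
Local Open Scope complex_scope.

(** The identity [\sum_(m in Z) sinc^2 (pi (y + m)) = 1] puts every exponential, in
particular every [F_k], in the closed span of the lattice exponentials in [L_2 (Q)],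
[Q = [-pi, pi]^d]. As the [F_k] span [L_2 (Q)], this gives Parseval's identity for the
lattice exponentials, hence, integrated over the unit cube, Plancherel's formula for
functions supported in a cube. A duality argument then shows that a function of the
Paley-Wiener space is the Fourier integral of its spectrum [h].

For a Riesz basis with dual basis [G_k = S^-1 F_k] the matrix [B] is the Gram matrix of
the [G_k], and the section [P_l B^-1 P_l] is the Gram matrix of [F_0, ..., F_(l-1)].
With [H = h (lambda .)], the samples are [f (t_k / lambda) = const * <H, F_k>], so
the coefficients are those of the orthogonal projection [A_l] of [H] onto the span of
[F_0, ..., F_(l-1)]; hence [A_l --> H] in [L_2 (Q)]. As [phi = 1] on the support of
[h], the error of the [l]-th partial sum is the Fourier integral of
[phi * (A_l - H) (. / lambda)], which is controlled in [L_2] by Plancherel and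
uniformly by Cauchy-Schwarz.                                                      *)

(** The Riesz basis hypothesis does double duty: it governs the Gram sections, and it makes the span
    of the [F k] dense, so that completeness of the lattice exponentials only has to be tested on
    single exponentials. There the defect in Bessel's inequality is one minus a product of sinc
    series, and a doubling argument on [sinc_sup] shows that each of these series is 1.

    [frame_operator], [L2inv] and [l2inv] are choices with default value 0. Each use has to exhibit
    a witness and then show that whatever was chosen agrees with it. This is why the dual basis is
    built from adjoints, independently of [S], and only afterwards identified with [S^-1 F]. The
    adjoints come from prescribed coefficients (Riesz-Fischer), hence from completeness of [L_2].

    Estimates are made on the real number [sqL2], the square of the norm; the 2 in [CauchySchwarz]
    is not sharp, as only limits and finiteness depend on it. The factors [(2 pi)^-d] and
    [lambda^-d] of the series are accounted for by the normalization of [exponential] and by the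
    substitution [xi = lambda y]. *)

(** * Real and imaginary parts, squared modulus *)

Section complex_algebra.
Context {R : realType}.
Implicit Types x y : R[i].

Lemma Re_mul x y :
  complex.Re (x * y) = complex.Re x * complex.Re y - complex.Im x * complex.Im y.
Proof. by case: x => a b; case: y => c e. Qed.

Lemma Im_mul x y :
  complex.Im (x * y) = complex.Re x * complex.Im y + complex.Im x * complex.Re y.
Proof. by case: x => a b; case: y => c e. Qed.

Lemma Re_add x y : complex.Re (x + y) = complex.Re x + complex.Re y.
Proof. by case: x => a b; case: y => c e. Qed.

Lemma Im_add x y : complex.Im (x + y) = complex.Im x + complex.Im y.
Proof. by case: x => a b; case: y => c e. Qed.

Lemma Re_opp x : complex.Re (- x) = - complex.Re x.
Proof. by case: x. Qed.

Lemma Im_opp x : complex.Im (- x) = - complex.Im x.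
Proof. by case: x. Qed.

Lemma Re_conj x : complex.Re x^* = complex.Re x.
Proof. by case: x. Qed.

Lemma Im_conj x : complex.Im x^* = - complex.Im x.
Proof. by case: x. Qed.

Definition reim_simpl :=
  (Re_mul, Im_mul, Re_add, Im_add, Re_opp, Im_opp, Re_conj, Im_conj).

Lemma Re_sum (I : Type) (r : seq I) (P : pred I) (F : I -> R[i]) :
  complex.Re (\sum_(i <- r | P i) F i) = \sum_(i <- r | P i) complex.Re (F i).
Proof. by apply: (big_morph _ Re_add). Qed.

Lemma complex_ext x y :
  complex.Re x = complex.Re y -> complex.Im x = complex.Im y -> x = y.
Proof. by case: x => a b; case: y => c e /= -> ->. Qed.

(** The squared modulus, kept as a real polynomial in the two parts so that estimates stay within
    reach of [ring], [lra] and [nra]. *)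
Definition sqrc x : R := complex.Re x ^+ 2 + complex.Im x ^+ 2.

Lemma sqrc_ge0 x : 0 <= sqrc x.
Proof. by rewrite addr_ge0 ?sqr_ge0. Qed.

Lemma normc_sqrt x : Normc.normc x = Num.sqrt (sqrc x).
Proof. by case: x. Qed.

Lemma normc_sqr x : Normc.normc x ^+ 2 = sqrc x.
Proof. by rewrite normc_sqrt sqr_sqrtr ?sqrc_ge0. Qed.

Lemma normc_nneg x : 0 <= Normc.normc x.
Proof. by rewrite normc_sqrt sqrtr_ge0. Qed.

Lemma norm_normc x : `|x| = (Normc.normc x)%:C.
Proof. by case: x. Qed.

Lemma sqrcM x y : sqrc (x * y) = sqrc x * sqrc y.
Proof. by rewrite /sqrc !reim_simpl; ring. Qed.

Lemma sqrcJ x : sqrc x^* = sqrc x.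
Proof. by rewrite /sqrc !reim_simpl; ring. Qed.

Lemma sqrcB x y : sqrc (x - y) = sqrc (y - x).
Proof. by rewrite /sqrc !reim_simpl; ring. Qed.

Lemma sqrc0 : sqrc 0 = 0.
Proof. by rewrite /sqrc /=; ring. Qed.

Lemma sqrcC (a : R) : sqrc a%:C = a ^+ 2.
Proof. by rewrite /sqrc /=; ring. Qed.

Lemma sqrc_eq0 x : sqrc x = 0 -> x = 0.
Proof.
rewrite /sqrc => x0; apply: complex_ext => /=; apply/eqP; rewrite -sqrf_eq0.
  by apply/eqP; have := sqr_ge0 (complex.Re x); have := sqr_ge0 (complex.Im x); lra.
by apply/eqP; have := sqr_ge0 (complex.Re x); have := sqr_ge0 (complex.Im x); lra.
Qed.

Lemma sqrcD_le x y : sqrc (x + y) <= 2 * sqrc x + 2 * sqrc y.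
Proof.
rewrite /sqrc !reim_simpl.
have := sqr_ge0 (complex.Re x - complex.Re y).
have := sqr_ge0 (complex.Im x - complex.Im y).
by nra.
Qed.

Lemma mulJ_sqrc x : x * x^* = (sqrc x)%:C.
Proof. by apply: complex_ext; rewrite !reim_simpl /sqrc /=; ring. Qed.

Lemma Re_le_normc x : `|complex.Re x| <= Normc.normc x.
Proof.
by rewrite normc_sqrt -sqrtr_sqr ler_wsqrtr // /sqrc lerDl sqr_ge0.
Qed.

Lemma Im_le_normc x : `|complex.Im x| <= Normc.normc x.
Proof.
by rewrite normc_sqrt -sqrtr_sqr ler_wsqrtr // /sqrc lerDr sqr_ge0.
Qed.

Lemma Re_mulC (a : R) x : complex.Re (a%:C * x) = a * complex.Re x.
Proof. by rewrite !reim_simpl /=; ring. Qed.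

Lemma Im_mulC (a : R) x : complex.Im (a%:C * x) = a * complex.Im x.
Proof. by rewrite !reim_simpl /=; ring. Qed.

End complex_algebra.

(** * Measurability and integration of complex-valued functions *)

Section complex_measurable.
Context {d : measure_display} {T : measurableType d} {R : realType}.
Implicit Types (D : set T) (f g : T -> R[i]).

Definition cmeasurable D f : Prop :=
  measurable_fun D (fun x => complex.Re (f x)) /\
  measurable_fun D (fun x => complex.Im (f x)).

Lemma cmeasurable_cst D (a : R[i]) : cmeasurable D (fun=> a).
Proof. by split; exact: measurable_cst. Qed.

Lemma cmeasurableD D f g : cmeasurable D f -> cmeasurable D g ->
  cmeasurable D (fun x => f x + g x).
Proof.
move=> [fr fi] [gr gi]; split.
  by under eq_fun do rewrite Re_add; exact: measurable_funD.
by under eq_fun do rewrite Im_add; exact: measurable_funD.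
Qed.

Lemma cmeasurableM D f g : cmeasurable D f -> cmeasurable D g ->
  cmeasurable D (fun x => f x * g x).
Proof.
move=> [fr fi] [gr gi]; split.
  by under eq_fun do rewrite Re_mul; apply: measurable_funB; exact: measurable_funM.
by under eq_fun do rewrite Im_mul; apply: measurable_funD; exact: measurable_funM.
Qed.

Lemma cmeasurableJ D f : cmeasurable D f -> cmeasurable D (fun x => (f x)^*).
Proof.
move=> [fr fi]; split; first by under eq_fun do rewrite Re_conj.
by under eq_fun do rewrite Im_conj; exact: measurableT_comp.
Qed.

Lemma cmeasurableN D f : cmeasurable D f -> cmeasurable D (fun x => - f x).
Proof.
move=> [fr fi]; split.
  by under eq_fun do rewrite Re_opp; exact: measurableT_comp.
by under eq_fun do rewrite Im_opp; exact: measurableT_comp.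
Qed.

Lemma cmeasurableB D f g : cmeasurable D f -> cmeasurable D g ->
  cmeasurable D (fun x => f x - g x).
Proof. by move=> mf mg; apply: cmeasurableD => //; exact: cmeasurableN. Qed.

Lemma cmeasurableS D E f : measurable E -> D `<=` E ->
  cmeasurable E f -> cmeasurable D f.
Proof. by move=> mE DE [? ?]; split; exact: measurable_funS DE _. Qed.

Lemma measurable_sqrc D f : cmeasurable D f -> measurable_fun D (fun x => sqrc (f x)).
Proof. by move=> [fr fi]; apply: measurable_funD; exact: measurable_funX. Qed.

Lemma measurable_normc D f :
  cmeasurable D f -> measurable_fun D (fun x => Normc.normc (f x)).
Proof.
move=> mf; rewrite (_ : (fun _ => _) = (fun x : R => x `^ (2^-1)) \o (fun x => sqrc (f x))).
  by apply: measurableT_comp (measurable_sqrc mf); exact: measurable_powR.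
by apply/funext => x /=; rewrite normc_sqrt powR12_sqrt ?sqrc_ge0.
Qed.

Lemma eq_cmeasurable D f g : {in D, f =1 g} -> cmeasurable D f -> cmeasurable D g.
Proof.
move=> fg [fr fi]; split.
  by apply: eq_measurable_fun fr => x xD /=; rewrite fg.
by apply: eq_measurable_fun fi => x xD /=; rewrite fg.
Qed.

End complex_measurable.

Section complex_integral.
Context {d : measure_display} {T : measurableType d} {R : realType}.
Variables (mu : {measure set T -> \bar R}) (D : set T).
Hypothesis mD : measurable D.
Implicit Types (f g : T -> R[i]).

Definition cintegrable f : Prop :=
  cmeasurable D f /\ mu.-integrable D (fun x => (Normc.normc (f x))%:E).

Lemma cintegrable_le f (G : T -> R) : cmeasurable D f ->
  mu.-integrable D (fun x => (G x)%:E) ->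
  (forall x, D x -> Normc.normc (f x) <= G x) -> cintegrable f.
Proof.
move=> mf iG fG; split => //; apply: le_integrable iG => //.
  by apply/measurable_EFinP; exact: measurable_normc.
move=> x Dx /=; rewrite lee_fin ger0_norm ?normc_nneg//.
by rewrite (le_trans (fG x Dx))// ler_norm.
Qed.

Lemma cintegrable_Re f :
  cintegrable f -> mu.-integrable D (fun x => (complex.Re (f x))%:E).
Proof.
move=> [[fr fi] nf]; apply: le_integrable nf => //.
  exact/measurable_EFinP.
by move=> x Dx /=; rewrite lee_fin (ger0_norm (normc_nneg _)) Re_le_normc.
Qed.

Lemma cintegrable_Im f :
  cintegrable f -> mu.-integrable D (fun x => (complex.Im (f x))%:E).
Proof.
move=> [[fr fi] nf]; apply: le_integrable nf => //.
  exact/measurable_EFinP.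
by move=> x Dx /=; rewrite lee_fin (ger0_norm (normc_nneg _)) Im_le_normc.
Qed.

Lemma eq_cintegrable f g : {in D, f =1 g} -> cintegrable f -> cintegrable g.
Proof.
move=> fg [mf nf]; split; first exact: eq_cmeasurable fg mf.
by apply: eq_integrable nf => // x xD /=; rewrite fg.
Qed.

Lemma cintegrableD f g :
  cintegrable f -> cintegrable g -> cintegrable (fun x => f x + g x).
Proof.
move=> [mf nf] [mg ng].
apply: (@cintegrable_le _ (fun x => Normc.normc (f x) + Normc.normc (g x))).
- exact: cmeasurableD.
- by have := integrableD mD nf ng.
- by move=> x _; exact: le_normcD.
Qed.

Lemma cintegrableZl (a : R[i]) f : cintegrable f -> cintegrable (fun x => a * f x).
Proof.
move=> [mf nf].
apply: (@cintegrable_le _ (fun x => Normc.normc a * Normc.normc (f x))).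
- by apply: cmeasurableM => //; exact: cmeasurable_cst.
- by have := @integrableZl _ _ _ _ _ mD (Normc.normc a) _ nf.
- by move=> x _; rewrite Normc.normcM.
Qed.

Lemma cintegrableN f : cintegrable f -> cintegrable (fun x => - f x).
Proof. by move=> /(cintegrableZl (-1)); apply: eq_cintegrable => x _ /=; rewrite mulN1r. Qed.

Lemma cintegrableJ f : cintegrable f -> cintegrable (fun x => (f x)^*).
Proof.
move=> [mf nf]; split; first exact: cmeasurableJ.
by apply: eq_integrable nf => // x _ /=; rewrite !normc_sqrt sqrcJ.
Qed.

Lemma cintegrable0 : cintegrable (fun=> 0).
Proof.
split; first exact: cmeasurable_cst.
apply: eq_integrable (integrable0 mu D) => // x _ /=.
by rewrite expr0n /= addr0 sqrtr0.
Qed.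

Lemma cintegrable_sum (I : Type) (s : seq I) (F : I -> T -> R[i]) :
  (forall i, cintegrable (F i)) -> cintegrable (fun x => \sum_(i <- s) F i x).
Proof.
move=> mF; elim: s => [|i s IH].
  by under eq_fun do rewrite big_nil; exact: cintegrable0.
by under eq_fun do rewrite big_cons; exact: cintegrableD.
Qed.

Lemma eq_cintegral f g : {in D, f =1 g} -> cintegral mu D f = cintegral mu D g.
Proof.
move=> fg; rewrite /cintegral; congr (_ +i* _).
  by apply: eq_Rintegral => x xD /=; rewrite fg.
by apply: eq_Rintegral => x xD /=; rewrite fg.
Qed.

Lemma cintegralD f g : cintegrable f -> cintegrable g ->
  cintegral mu D (fun x => f x + g x) = cintegral mu D f + cintegral mu D g.
Proof.
move=> mf mg; apply: complex_ext; rewrite /cintegral ?reim_simpl /=.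
  under eq_Rintegral do rewrite Re_add.
  by rewrite RintegralD//; exact: cintegrable_Re.
under eq_Rintegral do rewrite Im_add.
by rewrite RintegralD//; exact: cintegrable_Im.
Qed.

Lemma cintegralZl (a : R[i]) f : cintegrable f ->
  cintegral mu D (fun x => a * f x) = a * cintegral mu D f.
Proof.
move=> mf.
have iR (r : R) : mu.-integrable D (EFin \o (fun x => r * complex.Re (f x))).
  by have := @integrableZl _ _ _ _ _ mD r _ (cintegrable_Re mf).
have iI (r : R) : mu.-integrable D (EFin \o (fun x => r * complex.Im (f x))).
  by have := @integrableZl _ _ _ _ _ mD r _ (cintegrable_Im mf).
apply: complex_ext; rewrite /cintegral ?reim_simpl /=.
  under eq_Rintegral do rewrite Re_mul.
  rewrite RintegralB// RintegralZl ?RintegralZl//.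
    exact: cintegrable_Im.
  exact: cintegrable_Re.
under eq_Rintegral do rewrite Im_mul.
rewrite RintegralD// RintegralZl ?RintegralZl//.
  exact: cintegrable_Re.
exact: cintegrable_Im.
Qed.

Lemma cintegralN f : cintegrable f ->
  cintegral mu D (fun x => - f x) = - cintegral mu D f.
Proof.
move=> mf; rewrite -[RHS]mulN1r -cintegralZl//.
by apply: eq_cintegral => x _; rewrite mulN1r.
Qed.

Lemma cintegralB f g : cintegrable f -> cintegrable g ->
  cintegral mu D (fun x => f x - g x) = cintegral mu D f - cintegral mu D g.
Proof. by move=> mf mg; rewrite cintegralD ?cintegralN//; exact: cintegrableN. Qed.

Lemma cintegralJ f : cintegrable f ->
  cintegral mu D (fun x => (f x)^*) = (cintegral mu D f)^*.
Proof.
move=> mf; apply: complex_ext; rewrite /cintegral ?reim_simpl /=.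
  by apply: eq_Rintegral => x _; rewrite Re_conj.
rewrite -mulN1r -RintegralZl//; last exact: cintegrable_Im.
by apply: eq_Rintegral => x _; rewrite Im_conj mulN1r.
Qed.

Lemma cintegral0 : cintegral mu D (fun=> 0) = 0.
Proof.
rewrite -[RHS](mul0r (cintegral mu D (fun=> 0))) -cintegralZl; last exact: cintegrable0.
by apply: eq_cintegral => x _; rewrite mul0r.
Qed.

Lemma cintegral_sum (I : Type) (s : seq I) (F : I -> T -> R[i]) :
  (forall i, cintegrable (F i)) ->
  cintegral mu D (fun x => \sum_(i <- s) F i x) = \sum_(i <- s) cintegral mu D (F i).
Proof.
move=> mF; elim: s => [|i s IH].
  by rewrite big_nil -[RHS]cintegral0; apply: eq_cintegral => x _; rewrite big_nil.
rewrite big_cons -IH -cintegralD//; last exact: cintegrable_sum.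
by apply: eq_cintegral => x _; rewrite big_cons.
Qed.

Lemma ae_eq_cintegral f g : cmeasurable D f -> cmeasurable D g ->
  L2eq mu D f g -> cintegral mu D f = cintegral mu D g.
Proof.
move=> [fr fi] [gr gi] fg; rewrite /cintegral /Rintegral; congr (fine _ +i* fine _).
  apply: ae_eq_integral => //; try exact/measurable_EFinP.
  by apply: filterS fg => x /= fg Dx; rewrite fg.
apply: ae_eq_integral => //; try exact/measurable_EFinP.
by apply: filterS fg => x /= fg Dx; rewrite fg.
Qed.

End complex_integral.

(** * Inner product and norm of [L_2(D)] *)

Section L2_theory.
Context {d : measure_display} {T : measurableType d} {R : realType}.
Variables (mu : {measure set T -> \bar R}) (D : set T).
Hypothesis mD : measurable D.
Implicit Types (f g h : T -> R[i]).

Local Notation L2 := (L2 mu D).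
Local Notation dot := (L2dot mu D).

(** A real-valued stand-in for the extended [L2norm]. It is [fine] of an integral, so it carries
    information only for [f] in [L2]; [EFin_sqL2] makes the link. *)
Definition sqL2 f : R := \int[mu]_(x in D) sqrc (f x).

Lemma L2normE f :
  L2norm mu D f = ((\int[mu]_(x in D) (sqrc (f x))%:E) `^ (2^-1))%E.
Proof.
rewrite /L2norm unlock; congr (_ `^ _)%E.
rewrite [RHS]integral_mkcond; apply: eq_integral => x _ /=.
rewrite !patchE; case: ifP => _ /=; last by rewrite normr0 powR0.
by rewrite ger0_norm ?normc_nneg// -normc_sqr powR_mulrn ?normc_nneg.
Qed.

Lemma L2P f : L2 f <->
  cmeasurable D f /\ mu.-integrable D (fun x => (sqrc (f x))%:E).
Proof.
have i0 : (0 <= \int[mu]_(x in D) (sqrc (f x))%:E)%E.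
  by apply: integral_ge0 => x _; rewrite lee_fin sqrc_ge0.
split=> [[fr fi fn]|[[fr fi] fn]].
  split=> //; apply/integrableP; split.
    by apply/measurable_EFinP; exact: (@measurable_sqrc _ _ _ _ f).
  under eq_integral do rewrite gee0_abs ?lee_fin ?sqrc_ge0//.
  move: fn; rewrite L2normE.
  by case: (integral _ _ _) i0 => [r|//|//] _; rewrite ?ltry// poweRyr.
split => //; rewrite L2normE; apply: poweR_lty.
move/integrableP : fn => [_].
by under eq_integral do rewrite gee0_abs ?lee_fin ?sqrc_ge0//.
Qed.

Lemma L2_cmeas f : L2 f -> cmeasurable D f.
Proof. by move/L2P => []. Qed.

Lemma L2_sqrc f : L2 f -> mu.-integrable D (fun x => (sqrc (f x))%:E).
Proof. by move/L2P => []. Qed.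

Hint Resolve L2_cmeas L2_sqrc : core.

Lemma sqL2_ge0 f : 0 <= sqL2 f.
Proof. by apply: Rintegral_ge0 => x _; exact: sqrc_ge0. Qed.

Lemma EFin_sqL2 f : L2 f ->
  (sqL2 f)%:E = (\int[mu]_(x in D) (sqrc (f x))%:E)%E.
Proof. by move=> Lf; rewrite /sqL2 /Rintegral fineK// integrable_fin_num// L2_sqrc. Qed.

Lemma L2norm_sqrt f : L2 f -> L2norm mu D f = (Num.sqrt (sqL2 f))%:E.
Proof. by move=> Lf; rewrite L2normE -EFin_sqL2// poweR_EFin powR12_sqrt// sqL2_ge0. Qed.

Lemma L2_le f (G : T -> R) : cmeasurable D f ->
  mu.-integrable D (fun x => (G x)%:E) ->
  (forall x, D x -> sqrc (f x) <= G x) -> L2 f.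
Proof.
move=> mf iG fG; apply/L2P; split => //; apply: le_integrable iG => //.
  by apply/measurable_EFinP; exact: measurable_sqrc.
move=> x Dx /=; rewrite lee_fin ger0_norm ?sqrc_ge0//.
by rewrite (le_trans (fG x Dx))// ler_norm.
Qed.

Lemma sqL2_le f (G : T -> R) : L2 f ->
  mu.-integrable D (fun x => (G x)%:E) ->
  (forall x, D x -> sqrc (f x) <= G x) -> sqL2 f <= \int[mu]_(x in D) G x.
Proof. by move=> Lf iG fG; apply: le_Rintegral => //; exact: L2_sqrc. Qed.

Lemma eq_L2 f g : {in D, f =1 g} -> L2 f -> L2 g.
Proof.
move=> fg /L2P[mf nf]; apply/L2P; split; first exact: eq_cmeasurable fg mf.
by apply: eq_integrable nf => // x xD /=; rewrite fg.
Qed.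

Lemma eq_sqL2 f g : {in D, f =1 g} -> sqL2 f = sqL2 g.
Proof. by move=> fg; apply: eq_Rintegral => x xD; rewrite fg. Qed.

(** One majorant serves for sums, through [sqrcD_le], and for products, through
    [|f g| <= 2 |f|^2 + 2 |g|^2]. *)
Let iD2 f g : L2 f -> L2 g ->
  mu.-integrable D (fun x => (2 * sqrc (f x) + 2 * sqrc (g x))%:E).
Proof.
move=> Lf Lg; have := integrableD mD
  (@integrableZl _ _ _ _ _ mD 2 _ (L2_sqrc Lf))
  (@integrableZl _ _ _ _ _ mD 2 _ (L2_sqrc Lg)).
by apply: eq_integrable.
Qed.

Lemma L2D f g : L2 f -> L2 g -> L2 (fun x => f x + g x).
Proof.
move=> Lf Lg; apply: L2_le (iD2 Lf Lg) _.
  by apply: cmeasurableD; exact: L2_cmeas.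
by move=> x _; exact: sqrcD_le.
Qed.

Lemma L2Z (a : R[i]) f : L2 f -> L2 (fun x => a * f x).
Proof.
move=> Lf; apply: L2_le (@integrableZl _ _ _ _ _ mD (sqrc a) _ (L2_sqrc Lf)) _.
  by apply: cmeasurableM; [exact: cmeasurable_cst|exact: L2_cmeas].
by move=> x _; rewrite sqrcM.
Qed.

Lemma L2B f g : L2 f -> L2 g -> L2 (fun x => f x - g x).
Proof.
move=> Lf Lg; apply: (@eq_L2 (fun x => f x + -1 * g x)).
  by move=> x _; rewrite mulN1r.
by apply: L2D => //; exact: L2Z.
Qed.

Lemma L2_cst0 : L2 (fun=> 0).
Proof.
apply/L2P; split; first exact: cmeasurable_cst.
by apply: eq_integrable (integrable0 mu D) => // x _ /=; rewrite sqrc0.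
Qed.

Lemma L2_sum (I : Type) (s : seq I) (a : I -> R[i]) (F : I -> T -> R[i]) :
  (forall i, L2 (F i)) -> L2 (fun x => \sum_(i <- s) a i * F i x).
Proof.
move=> mF; elim: s => [|i s IH].
  by under eq_fun do rewrite big_nil; exact: L2_cst0.
by under eq_fun do rewrite big_cons; apply: L2D => //; exact: L2Z.
Qed.

Lemma sqL2D_le f g : L2 f -> L2 g ->
  sqL2 (fun x => f x + g x) <= 2 * sqL2 f + 2 * sqL2 g.
Proof.
move=> Lf Lg.
have i1 f' : L2 f' -> mu.-integrable D (EFin \o (fun x => 2 * sqrc (f' x))).
  by move=> Lf'; exact: (@integrableZl _ _ _ _ _ mD 2 _ (L2_sqrc Lf')).
rewrite -!RintegralZl//; [|exact: L2_sqrc..].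
rewrite -RintegralD//; [|exact: i1..].
by apply: (sqL2_le (L2D Lf Lg) (iD2 Lf Lg)) => x _; exact: sqrcD_le.
Qed.

Lemma sqL2Z (a : R[i]) f : L2 f -> sqL2 (fun x => a * f x) = sqrc a * sqL2 f.
Proof.
move=> Lf; rewrite -RintegralZl//; last exact: L2_sqrc.
by apply: eq_Rintegral => x _; rewrite sqrcM.
Qed.

Lemma sqL2BC f g : sqL2 (fun x => f x - g x) = sqL2 (fun x => g x - f x).
Proof. by apply: eq_Rintegral => x _; rewrite sqrcB. Qed.

Lemma L2_cintegrableM f g : L2 f -> L2 g -> cintegrable mu D (fun x => f x * g x).
Proof.
move=> Lf Lg; apply: (@cintegrable_le _ _ _ _ _ mD _ _ _ (iD2 Lf Lg)).
  by apply: cmeasurableM; exact: L2_cmeas.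
move=> x _; rewrite Normc.normcM -!normc_sqr.
have := normc_nneg (f x); have := normc_nneg (g x).
by nra.
Qed.

Lemma L2J f : L2 f -> L2 (fun x => (f x)^*).
Proof.
move=> /L2P[mf nf]; apply/L2P; split; first exact: cmeasurableJ.
by apply: eq_integrable nf => // x _ /=; rewrite sqrcJ.
Qed.

Lemma L2dot_integrable f g : L2 f -> L2 g ->
  cintegrable mu D (fun x => f x * (g x)^*).
Proof. by move=> Lf Lg; apply: L2_cintegrableM => //; exact: L2J. Qed.

Lemma L2dotDl f g h : L2 f -> L2 g -> L2 h ->
  dot (fun x => f x + g x) h = dot f h + dot g h.
Proof.
move=> Lf Lg Lh; rewrite -cintegralD//; [|exact: L2dot_integrable..].
by apply: eq_cintegral => // x _; rewrite mulrDl.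
Qed.

Lemma L2dotZl a f h : L2 f -> L2 h -> dot (fun x => a * f x) h = a * dot f h.
Proof.
move=> Lf Lh; rewrite -cintegralZl//; last exact: L2dot_integrable.
by apply: eq_cintegral => // x _; rewrite mulrA.
Qed.

Lemma L2dotC f g : L2 f -> L2 g -> dot g f = (dot f g)^*.
Proof.
move=> Lf Lg; rewrite -cintegralJ//; last exact: L2dot_integrable.
by apply: eq_cintegral => // x _; apply: complex_ext; rewrite !reim_simpl; ring.
Qed.

Lemma L2dotBl f g h : L2 f -> L2 g -> L2 h ->
  dot (fun x => f x - g x) h = dot f h - dot g h.
Proof.
move=> Lf Lg Lh; rewrite -cintegralB//; [|exact: L2dot_integrable..].
by apply: eq_cintegral => // x _; rewrite mulrBl.
Qed.

Lemma L2dotBr f g h : L2 f -> L2 g -> L2 h ->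
  dot h (fun x => f x - g x) = dot h f - dot h g.
Proof.
move=> Lf Lg Lh; have LB := L2B Lf Lg.
by rewrite (L2dotC LB Lh) L2dotBl// (L2dotC Lf Lh) (L2dotC Lg Lh) rmorphB.
Qed.

Lemma L2dot_suml (I : Type) (s : seq I) (a : I -> R[i]) (F : I -> T -> R[i]) h :
  (forall i, L2 (F i)) -> L2 h ->
  dot (fun x => \sum_(i <- s) a i * F i x) h = \sum_(i <- s) a i * dot (F i) h.
Proof.
move=> mF Lh; elim: s => [|i s IH].
  rewrite big_nil -[RHS](@cintegral0 _ _ _ mu D mD).
  by apply: eq_cintegral => x _; rewrite big_nil mul0r.
rewrite big_cons -IH -L2dotZl// -L2dotDl//; [|exact: L2Z|exact: L2_sum].
by apply: eq_cintegral => x _; rewrite big_cons.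
Qed.

Lemma L2dot_sumr (I : Type) (s : seq I) (a : I -> R[i]) (F : I -> T -> R[i]) h :
  (forall i, L2 (F i)) -> L2 h ->
  dot h (fun x => \sum_(i <- s) a i * F i x) = \sum_(i <- s) (a i)^* * dot h (F i).
Proof.
move=> mF Lh; rewrite (L2dotC (L2_sum s a mF) Lh) L2dot_suml// rmorph_sum.
by apply: eq_bigr => i _; rewrite (L2dotC (mF i) Lh) -[LHS]/((a i * _)^*) rmorphM.
Qed.

Lemma L2dot0l h : dot (fun=> 0) h = 0.
Proof.
rewrite -[RHS](@cintegral0 _ _ _ mu D mD).
by apply: eq_cintegral => x _; rewrite mul0r.
Qed.

Lemma L2dot_self f : L2 f -> dot f f = (sqL2 f)%:C.
Proof.
move=> Lf; apply: complex_ext; rewrite /L2dot /cintegral /=.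
  by apply: eq_Rintegral => x _; rewrite mulJ_sqrc.
by under eq_Rintegral do rewrite mulJ_sqrc /=; rewrite Rintegral_cst// mul0r.
Qed.

Lemma sqL2_sub f g : L2 f -> L2 g ->
  sqL2 (fun x => f x - g x) = sqL2 f - 2 * complex.Re (dot f g) + sqL2 g.
Proof.
move=> Lf Lg; have LB := L2B Lf Lg; apply: complexI; rewrite -L2dot_self//.
rewrite (L2dotBl Lf Lg LB) !L2dotBr// !L2dot_self// (L2dotC Lf Lg).
by apply: complex_ext; rewrite !reim_simpl /=; ring.
Qed.

(** The quadratic polynomial [s |-> |f - s g|^2] is nonnegative for real [s]; its value at the
    minimizer [r / |g|^2] gives the bound. *)
Lemma CauchySchwarz_Re f g : L2 f -> L2 g ->
  (complex.Re (dot f g)) ^+ 2 <= sqL2 f * sqL2 g.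
Proof.
move=> Lf Lg; set r := complex.Re _.
have key (s : R) : 0 <= sqL2 f - 2 * s * r + s ^+ 2 * sqL2 g.
  have Ls := L2Z s%:C Lg.
  have := sqL2_ge0 (fun x => f x - s%:C * g x); rewrite sqL2_sub//.
  rewrite sqL2Z// sqrcC (L2dotC Ls Lf) L2dotZl// Re_conj Re_mulC.
  by rewrite (L2dotC Lf Lg) Re_conj -/r mulrA.
have f0 := sqL2_ge0 f; have g0 := sqL2_ge0 g.
have [g00|gN0] := eqVneq (sqL2 g) 0.
  have [r0|rN0] := eqVneq r 0; first by rewrite r0 g00; nra.
  (* If [|g| = 0] the polynomial is affine, and at this [s] it equals [- |f|^2 - 2 < 0]. *)
  have := key ((sqL2 f + 1) / r); rewrite g00 -[X in _ <= X + _]/(sqL2 f - _).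
  by rewrite -[2 * _ * r]mulrA divfK//; nra.
have g_gt0 : 0 < sqL2 g by rewrite lt_neqAle eq_sym gN0.
have := key (r / sqL2 g).
have -> : sqL2 f - 2 * (r / sqL2 g) * r + (r / sqL2 g) ^+ 2 * sqL2 g =
  sqL2 f - r ^+ 2 / sqL2 g by field.
by rewrite subr_ge0 ler_pdivrMr.
Qed.

(** The real parts of [<f, g>] and of [<i f, g>] are bounded separately, which costs the factor
    2. *)
Lemma CauchySchwarz f g : L2 f -> L2 g ->
  sqrc (dot f g) <= 2 * (sqL2 f * sqL2 g).
Proof.
move=> Lf Lg; have H := CauchySchwarz_Re Lf Lg.
have := CauchySchwarz_Re (L2Z 'i Lf) Lg.
rewrite L2dotZl// sqL2Z//; move: H; case: (dot f g) => a b.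
rewrite Re_mul /sqrc /= => H.
by rewrite mul0r mul1r sub0r sqrrN expr0n expr1n add0r mul1r; lra.
Qed.

Lemma sqL2_0 : sqL2 (fun=> 0) = 0.
Proof. by rewrite /sqL2 sqrc0 Rintegral_cst// mul0r. Qed.

Lemma sqL2_eq0 f : L2 f -> sqL2 f = 0 -> L2eq mu D f (fun=> 0).
Proof.
move=> Lf f0; have := EFin_sqL2 Lf; rewrite f0 => /esym f0'.
have ab : (\int[mu]_(x in D) `|(sqrc (f x))%:E| = 0)%E.
  by rewrite -[RHS]f0'; apply: eq_integral => x _; rewrite gee0_abs// lee_fin sqrc_ge0.
have mf : measurable_fun D (EFin \o (fun x => sqrc (f x))).
  by apply/measurable_EFinP; apply: measurable_sqrc; exact: L2_cmeas.
have /(_ ab) := (ae_eq_integral_abs mu mD mf).1.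
by apply: filterS => x /= H Dx; apply: sqrc_eq0; have [] := H Dx.
Qed.

Lemma L2eq_sym f g : L2eq mu D f g -> L2eq mu D g f.
Proof. by apply: filterS => x /= fg Dx; rewrite fg. Qed.

Lemma L2eq_trans f g h : L2eq mu D f g -> L2eq mu D g h -> L2eq mu D f h.
Proof. by apply: filterS2 => x /= fg gh Dx; rewrite fg// gh. Qed.

Lemma sqL2_sub_eq0 f g : L2 f -> L2 g ->
  sqL2 (fun x => f x - g x) = 0 -> L2eq mu D f g.
Proof.
move=> Lf Lg /(sqL2_eq0 (L2B Lf Lg)).
by apply: filterS => x /= fg Dx; apply/eqP; rewrite -subr_eq0 fg.
Qed.

Lemma L2eq_sqL2_sub f g : L2 f -> L2 g -> L2eq mu D f g ->
  sqL2 (fun x => f x - g x) = 0.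
Proof.
move=> Lf Lg fg; rewrite -sqL2_0 /sqL2 /Rintegral; congr fine; apply: ae_eq_integral => //.
- by apply/measurable_EFinP; apply: measurable_sqrc; apply: L2_cmeas; exact: L2B.
- by apply: filterS fg => x /= fg Dx; rewrite fg// subrr.
Qed.

Lemma L2eq_dotl f g h : L2 f -> L2 g -> L2 h -> L2eq mu D f g -> dot f h = dot g h.
Proof.
move=> Lf Lg Lh fg; apply: ae_eq_cintegral => //.
- by apply: cmeasurableM; [exact: L2_cmeas|apply: cmeasurableJ; exact: L2_cmeas].
- by apply: cmeasurableM; [exact: L2_cmeas|apply: cmeasurableJ; exact: L2_cmeas].
- by apply: filterS fg => x /= fg Dx; rewrite fg.
Qed.

Lemma L2eq_dotr f g h : L2 f -> L2 g -> L2 h -> L2eq mu D f g -> dot h f = dot h g.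
Proof. by move=> Lf Lg Lh fg; rewrite (L2dotC Lf Lh) (L2eq_dotl Lf Lg Lh fg) -L2dotC. Qed.

Lemma L2eq_sqL2 f g : L2 f -> L2 g -> L2eq mu D f g -> sqL2 f = sqL2 g.
Proof.
move=> Lf Lg fg; apply: complexI; rewrite -!L2dot_self//.
by rewrite (L2eq_dotl Lf Lg Lf fg) (L2eq_dotr Lf Lg Lg fg).
Qed.

Lemma L2cvgP (u : nat -> T -> R[i]) f : (forall k, L2 (u k)) -> L2 f ->
  L2cvg mu D u f <-> (sqL2 (fun x => u k x - f x) @[k --> \oo] --> 0).
Proof.
move=> Lu Lf; rewrite /L2cvg.
have E : (fun k => L2norm mu D (fun x => u k x - f x)) =
    (fun k => (Num.sqrt (sqL2 (fun x => u k x - f x)))%:E).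
  by apply/funext => k; rewrite L2norm_sqrt//; exact: L2B.
rewrite E; split.
  move/fine_cvgP => [_ H].
  rewrite (_ : (fun k => _) = (fun k => Num.sqrt (sqL2 (fun x => u k x - f x)) *
      Num.sqrt (sqL2 (fun x => u k x - f x)))).
    by rewrite -[X in _ --> X](mulr0 0); apply: (cvgM H H).
  by apply/funext => k; rewrite -expr2 sqr_sqrtr// sqL2_ge0.
move=> H; apply/fine_cvgP; split; first exact: nearW.
rewrite -[X in _ --> X](sqrtr0 R).
by apply: cvg_comp H _; exact: sqrt_continuous.
Qed.

Lemma sqL2_dot_cvg (u : nat -> T -> R[i]) f h : (forall k, L2 (u k)) -> L2 f -> L2 h ->
  (sqL2 (fun x => u k x - f x) @[k --> \oo] --> 0) ->
  dot (u k) h @[k --> \oo] --> dot f h.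
Proof.
move=> Lu Lf Lh uf; apply/cvgrPdist_lt => e e0.
(* A positive element of [R[i]] is a positive real, so the tolerance can be moved to [R]. *)
have e2 : 0 < complex.Re e by move: e0; rewrite ltcE => /andP[].
have eE : e = (complex.Re e)%:C.
  by move: e0; rewrite ltcE => /andP[/eqP/esym i0 _]; apply: complex_ext.
(* The 2 comes from [CauchySchwarz]; adding 1 keeps the divisor positive when [h] vanishes. *)
have C0 : 0 < 2 * sqL2 h + 1 by have := sqL2_ge0 h; lra.
have d0 : 0 < (complex.Re e) ^+ 2 / (2 * sqL2 h + 1) by rewrite divr_gt0// exprn_gt0.
move/cvgrPdist_lt : uf => /(_ _ d0).
apply: filterS => k; rewrite sub0r normrN ger0_norm ?sqL2_ge0// => Hk.
rewrite -L2dotBl// norm_normc [X in _ < X]eE ltcR.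
have L1 : L2 (fun x => f x - u k x) by exact: L2B.
rewrite -(@ltr_pXn2r _ 2) ?nnegrE ?normc_nneg ?(ltW e2)// normc_sqr.
apply: le_lt_trans (CauchySchwarz L1 Lh) _; rewrite sqL2BC.
move: Hk; rewrite ltr_pdivlMr//.
by have := sqL2_ge0 h; have := sqL2_ge0 (fun x => u k x - f x); nra.
Qed.

End L2_theory.

(** * Completeness of [L_2(D)] *)

Lemma geometric_increments_cvg (R : realType) (a : nat -> R) (C : R) :
  (forall j, `|a j.+1 - a j| <= C * 2^-1 ^+ j) -> cvgn a.
Proof.
move=> Ha; pose b := telescope a.
have aE : a = (fun n => a 0%N + series b n).
  by apply/funext => n; rewrite /series /= telescope_sumr// addrC subrK.
rewrite aE; apply: is_cvgD; first exact: is_cvg_cst.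
apply: normed_cvg; apply: (@series_le_cvg _ _ (geometric C 2^-1)) => //.
    by move=> n; rewrite /=.
  by move=> n; rewrite /= (le_trans (normr_ge0 _) (Ha n)).
by apply: is_cvg_geometric_series; rewrite ger0_norm ?invr_ge0// invf_lt1// ltr1n.
Qed.

Lemma cvg_sub_cst (R : realType) (a l : R) (u : nat -> R) :
  u j @[j --> \oo] --> l -> a - u j @[j --> \oo] --> a - l.
Proof. by move=> ul; apply: cvgB ul; exact: cvg_cst. Qed.

Section L2_complete.
Context {d : measure_display} {T : measurableType d} {R : realType}.
Variables (mu : {measure set T -> \bar R}) (D : set T).
Hypothesis mD : measurable D.
Local Notation L2 := (L2 mu D).
Local Notation sqL2 := (sqL2 mu D).

Definition L2cauchy (u : nat -> T -> R[i]) := forall e : R, 0 < e ->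
  exists N, forall m k, (N <= m)%N -> (N <= k)%N -> sqL2 (fun x => u m x - u k x) < e.

Section fast_sequence.
Variable v : nat -> T -> R[i].
Hypothesis Lv : forall j, L2 (v j).
Hypothesis vS : forall j,
  sqL2 (fun x => v j.+1 x - v j x) <= (4 ^+ j)^-1 * (2 ^+ j.+1)^-1.

(* Summability of [4 ^ j |v_(j+1) - v_j|^2] gives geometric decay of the
   increments at almost every point.                                          *)
Let W x := (\sum_(0 <= j <oo) ((4 ^+ j) * sqrc (v j.+1 x - v j x))%:E)%E.

Let mW j : measurable_fun D (fun x => ((4 ^+ j) * sqrc (v j.+1 x - v j x))%:E).
Proof.
apply/measurable_EFinP; apply: measurable_funM; first exact: measurable_cst.
by apply: measurable_sqrc; apply: L2_cmeas; exact: L2B.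
Qed.

Let W0 j x : (0 <= ((4 ^+ j) * sqrc (v j.+1 x - v j x))%:E)%E.
Proof. by rewrite lee_fin mulr_ge0 ?sqrc_ge0. Qed.

Let integrable_W : mu.-integrable D W.
Proof.
apply/integrableP; split; first exact: ge0_emeasurable_sum.
rewrite (eq_integral W); last first.
  by move=> x _; rewrite gee0_abs// nneseries_ge0.
rewrite integral_nneseries//; apply: (@le_lt_trans _ _ 1%:E); last exact: ltry.
(* The weight [4 ^ j] cancels the factor [(4 ^ j)^-1] of [vS]; the remaining factors [(2 ^ j.+1)^-1]
   sum to 1. *)
apply: le_trans (epsilon_trick0 xpredT (@ler01 R)).
apply: lee_nneseries => [j _ _|j _]; first by apply: integral_ge0.
rewrite div1r; under eq_integral do rewrite EFinM.
rewrite ge0_integralZl_EFin//; last 2 first.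
- by move=> x _; rewrite lee_fin sqrc_ge0.
- apply/measurable_EFinP; apply: measurable_sqrc; apply: L2_cmeas; exact: L2B.
rewrite -EFin_sqL2//; last exact: L2B.
rewrite -EFinM lee_fin natrX.
apply: le_trans (ler_wpM2l _ (vS j)) _; first by rewrite exprn_ge0.
by rewrite mulrA mulfV ?mul1r// expf_neq0// pnatr_eq0.
Qed.

Let A := D `&` [set x | (W x < +oo)%E].

Let mA : measurable A.
Proof. by apply: emeasurable_fun_infty_o => //; case/integrableP : integrable_W. Qed.

(** Setting [v] to 0 where [W] is infinite makes the sequence converge at every point, so that the
    pointwise limit is measurable; almost everywhere on [D] nothing changes. *)
Let w j x := if x \in A then v j x else 0.

Let vw : {ae mu, forall x, D x -> forall j, w j x = v j x}.
Proof.
apply: filterS (integrable_ae mD integrable_W) => x /= Wx Dx j.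
rewrite /w ifT//; apply/mem_set; split => //=.
by have /fin_numPlt/andP[] := Wx Dx.
Qed.

Let w_incr x : exists C : R, forall j,
  Normc.normc (w j.+1 x - w j x) <= C * 2^-1 ^+ j.
Proof.
have [/set_mem[Dx /= Wx]|xA] := boolP (x \in A); last first.
  exists 0 => j; rewrite /w (negbTE xA) subrr mul0r.
  by rewrite normc_sqrt sqrc0 sqrtr0.
have W00 : (0 <= W x)%E by exact: nneseries_ge0.
have Wfin : W x \is a fin_num by rewrite ge0_fin_numE.
(* [W + 1] dominates the square root of [W], which is the natural constant. *)
exists (fine (W x) + 1) => j; rewrite /w mem_set//.
have Wj : 4 ^+ j * sqrc (v j.+1 x - v j x) <= fine (W x).
  rewrite -lee_fin fineK//; apply: le_trans (nneseries_lim_ge j.+1 _).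
    by rewrite big_nat_recr//= leeDr// sume_ge0.
  by move=> k _ _; exact: W0.
have F0 : 0 <= fine (W x) by rewrite fine_ge0.
have j2 : 0 <= (2^-1 : R) ^+ j by rewrite exprn_ge0.
rewrite -(@ler_pXn2r _ 2) ?nnegrE ?normc_nneg ?mulr_ge0 ?addr_ge0//.
rewrite normc_sqr exprMn exprAC (_ : 2^-1 ^+ 2 = 4^-1 :> R); last by field.
rewrite exprVn.
rewrite ler_pdivlMr ?exprn_gt0// mulrC (le_trans Wj)//.
by nra.
Qed.

Let f x : R[i] := limn (fun j => complex.Re (w j x)) +i* limn (fun j => complex.Im (w j x)).

Let w_Re x : complex.Re (w j x) @[j --> \oo] --> complex.Re (f x).
Proof.
have [C HC] := w_incr x; apply: (@geometric_increments_cvg _ _ C) => j.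
by rewrite -Re_opp -Re_add (le_trans (Re_le_normc _)).
Qed.

Let w_Im x : complex.Im (w j x) @[j --> \oo] --> complex.Im (f x).
Proof.
have [C HC] := w_incr x; apply: (@geometric_increments_cvg _ _ C) => j.
by rewrite -Im_opp -Im_add (le_trans (Im_le_normc _)).
Qed.

Let w_meas j : cmeasurable D (w j).
Proof.
have [fr fi] := L2_cmeas (Lv j).
rewrite (_ : w j = (fun x => (\1_A x)%:C * v j x)); last first.
  apply/funext => x; rewrite /w indicE; case: (x \in A) => /=.
    by rewrite mul1r.
  by rewrite mul0r.
apply: cmeasurableM => //; split; last exact: measurable_cst.
exact: measurable_indic.
Qed.

Let f_meas : cmeasurable D f.
Proof.
split; first by apply: (measurable_fun_cvg (fun j => (w_meas j).1)) => x _; exact: w_Re.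
by apply: (measurable_fun_cvg (fun j => (w_meas j).2)) => x _; exact: w_Im.
Qed.

(** Fatou's lemma. The distance is measured from an arbitrary [h] so that the bound applies to every
    term of a Cauchy sequence, and it is stated with the extended integral because the limit is not
    yet known to lie in [L2]. *)
Lemma L2_fast_limit : exists f', cmeasurable D f' /\
  forall (h : T -> R[i]) (e : R), L2 h ->
    (\forall j \near \oo, sqL2 (fun x => h x - v j x) <= e) ->
    (\int[mu]_(x in D) (sqrc (h x - f' x))%:E <= e%:E)%E.
Proof.
exists f; split => // h e Lh he.
have hc := L2_cmeas Lh.
have := @fatou _ _ _ mu _ mD (fun j x => (sqrc (h x - w j x))%:E).
rewrite (eq_integral (fun x => (sqrc (h x - f x))%:E)); last first.
  move=> x _; apply: (cvg_limn_einf_sup _).1; apply: cvg_EFin; first exact: nearW.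
  have hRe : complex.Re (h x - w j x) @[j --> \oo] --> complex.Re (h x - f x).
    rewrite Re_add Re_opp; under eq_fun do rewrite Re_add Re_opp.
    exact: cvg_sub_cst.
  have hIm : complex.Im (h x - w j x) @[j --> \oo] --> complex.Im (h x - f x).
    rewrite Im_add Im_opp; under eq_fun do rewrite Im_add Im_opp.
    exact: cvg_sub_cst.
  exact: cvgD (cvgM hRe hRe) (cvgM hIm hIm).
move=> H; apply: (le_trans (H _ _)).
- by move=> j; apply/measurable_EFinP; apply: measurable_sqrc; exact: cmeasurableB.
- by move=> j x _; rewrite lee_fin sqrc_ge0.
have -> : (fun j => \int[mu]_(x in D) (sqrc (h x - w j x))%:E)%E =
    (fun j => (sqL2 (fun x => h x - v j x))%:E).
  apply/funext => j; rewrite EFin_sqL2//; last exact: L2B.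
  apply: ae_eq_integral => //.
  - by apply/measurable_EFinP; apply: measurable_sqrc; exact: cmeasurableB.
  - apply/measurable_EFinP; apply: measurable_sqrc; apply: cmeasurableB => //.
    exact: L2_cmeas (Lv j).
  - by apply: filterS vw => x /= vwx Dx; rewrite vwx.
rewrite limn_einf_lim; apply: lime_le; first exact: is_cvg_einfs.
case: he => N _ he; exists N => // j /= Nj.
apply: (@le_trans _ _ (sqL2 (fun x => h x - v j x))%:E); last by rewrite lee_fin he.
by apply: ereal_inf_lbound; exists j => /=.
Qed.

End fast_sequence.

Lemma L2_complete (u : nat -> T -> R[i]) : (forall k, L2 (u k)) -> L2cauchy u ->
  exists f, L2 f /\ (sqL2 (fun x => u k x - f x) @[k --> \oo] --> 0).
Proof.
move=> Lu Cu.
have e_gt0 j : 0 < (4 ^+ j)^-1 * (2 ^+ j.+1)^-1 :> R.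
  by rewrite mulr_gt0// invr_gt0 exprn_gt0.
have [N HN] := choice (fun j => Cu _ (e_gt0 j)).
(* A sum instead of [N j]: [p j] exceeds [j] and all thresholds [N k] with [k <= j], so consecutive
   indices both pass the [j]-th one. *)
pose p j := (j + \sum_(i < j.+1) N i)%N.
have pN j k : (j <= k)%N -> (N j <= p k)%N.
  move=> jk; rewrite /p (bigD1 (Ordinal (jk : (j < k.+1)%N)))//=.
  by rewrite addnCA leq_addr.
have [f [mf Hf]] := @L2_fast_limit (fun j => u (p j)) (fun j => Lu (p j))
  (fun j => ltW (HN j _ _ (pN _ _ (leqnSn j)) (pN _ _ (leqnn j)))).
have Hk (e : R) : 0 < e -> exists M, forall k, (M <= k)%N ->
    (\int[mu]_(x in D) (sqrc (u k x - f x))%:E <= e%:E)%E.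
  move=> e0; have [M HM] := Cu e e0.
  exists M => k Mk; apply: Hf => //.
  exists M => // j /= Mj; apply/ltW/HM => //.
  by rewrite (leq_trans Mj)// leq_addr.
have [M1 HM1] := Hk 1 ltr01.
(* Membership of [f] in [L2] is obtained from that of [u M1] and of the difference [u M1 - f]. *)
have LM1 : L2 (fun x => u M1 x - f x).
  have mM1 : cmeasurable D (fun x => u M1 x - f x).
    by apply: cmeasurableB => //; exact: L2_cmeas (Lu _).
  apply/L2P => //; split => //; apply/integrableP; split.
    by apply/measurable_EFinP; exact: measurable_sqrc mM1.
  under eq_integral do rewrite gee0_abs ?lee_fin ?sqrc_ge0//.
  by apply: le_lt_trans (HM1 _ (leqnn _)) _; exact: ltry.
have Lf : L2 f.
  apply: (@eq_L2 _ _ _ _ _ mD (fun x => u M1 x - (u M1 x - f x))).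
    by move=> x _; rewrite opprB addrC subrK.
  exact: L2B.
exists f; split => //; apply/cvgrPdist_le => e e0.
have [M HM] := Hk e e0; exists M => // k /= Mk.
rewrite sub0r normrN ger0_norm ?sqL2_ge0// -lee_fin EFin_sqL2 ?HM//.
exact: L2B.
Qed.

End L2_complete.

(** * Orthonormal systems, Riesz-Fischer theorem, adjoints *)

Section orthonormal.
Context {d : measure_display} {T : measurableType d} {R : realType}.
Variables (mu : {measure set T -> \bar R}) (D : set T).
Hypothesis mD : measurable D.
Local Notation L2 := (L2 mu D).
Local Notation sqL2 := (sqL2 mu D).
Local Notation dot := (L2dot mu D).

Section orthonormal_system.
Variables (I : eqType) (u : I -> T -> R[i]).
Hypothesis Lu : forall k, L2 (u k).
Hypothesis uu : forall k m, dot (u k) (u m) = (k == m)%:R.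

Lemma dot_orthonormal_sum (s : seq I) (a : I -> R[i]) k : uniq s ->
  dot (fun x => \sum_(i <- s) a i * u i x) (u k) = if k \in s then a k else 0.
Proof.
move=> us; rewrite L2dot_suml//.
under eq_bigr do rewrite uu mulr_natr mulrb.
rewrite -big_mkcond /=; case: ifPn => ks.
  by rewrite -big_filter filter_pred1_uniq// big_seq1.
by rewrite big_seq_cond big_pred0// => i; apply: contraNF ks => /andP[? /eqP<-].
Qed.

Lemma sqL2_orthonormal_sum (s : seq I) (a : I -> R[i]) : uniq s ->
  sqL2 (fun x => \sum_(i <- s) a i * u i x) = \sum_(i <- s) sqrc (a i).
Proof.
move=> us; apply: complexI; rewrite -L2dot_self//; last exact: L2_sum.
rewrite L2dot_sumr//; last exact: L2_sum.
rewrite rmorph_sum /= !big_seq; apply: eq_bigr => i si.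
by rewrite dot_orthonormal_sum// si mulrC mulJ_sqrc.
Qed.

Lemma sqL2_sub_orthonormal_proj (s : seq I) h : uniq s -> L2 h ->
  sqL2 (fun x => h x - \sum_(i <- s) dot h (u i) * u i x) =
  sqL2 h - \sum_(i <- s) sqrc (dot h (u i)).
Proof.
move=> us Lh; rewrite sqL2_sub//; last exact: L2_sum.
rewrite sqL2_orthonormal_sum// L2dot_sumr//.
rewrite Re_sum (eq_bigr (fun i => sqrc (dot h (u i)))); first by ring.
by move=> i _; rewrite mulrC mulJ_sqrc.
Qed.

(** The difference of the two sides is the squared distance to the projection. The index type is any
    [eqType], since families over [int] occur as well as families over [nat]. *)
Lemma Bessel (s : seq I) h : uniq s -> L2 h ->
  \sum_(i <- s) sqrc (dot h (u i)) <= sqL2 h.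
Proof.
by move=> us Lh; rewrite -subr_ge0 -sqL2_sub_orthonormal_proj// sqL2_ge0.
Qed.

End orthonormal_system.

(** The squared distance of two partial sums is a difference of two values of the monotone bounded
    sequence [S]. The lemma supplies vectors with prescribed coefficients: adjoints are built from
    it, and so is the interpolation property of a Riesz basis. *)
Lemma Riesz_Fischer (u : nat -> T -> R[i]) (x : nat -> R[i]) (C : R) :
  (forall k, L2 (u k)) -> (forall k m, dot (u k) (u m) = (k == m)%:R) ->
  (forall N, \sum_(k < N) sqrc (x k) <= C) ->
  exists y, L2 y /\ forall k, dot y (u k) = x k.
Proof.
move=> Lu uu xC; pose S N : R := \sum_(0 <= k < N) sqrc (x k).
pose s N t := \sum_(0 <= k < N) x k * u k t.
have Ls N : L2 (s N) by exact: L2_sum.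
have sS m n : (m <= n)%N -> sqL2 (fun t => s n t - s m t) = S n - S m.
  move=> mn; rewrite (@eq_sqL2 _ _ _ _ _ _ (fun t => \sum_(m <= k < n) x k * u k t)); last first.
    by move=> t _; rewrite /s (@big_cat_nat _ _ _ m)//= addrC addrK.
  rewrite sqL2_orthonormal_sum ?iota_uniq// /S [X in _ = X - _](@big_cat_nat _ _ _ m)//=.
  by rewrite addrC addrK.
have Snd : nondecreasing_seq S.
  apply/nondecreasing_seqP => n; rewrite /S big_nat_recr//= lerDl.
  exact: sqrc_ge0.
have Scvg : cvgn S.
  apply: nondecreasing_is_cvgn => //; exists C => _ [N _ <-].
  by rewrite /S big_mkord.
have [y [Ly sy]] : exists f, L2 f /\ (sqL2 (fun x => s k x - f x) @[k --> \oo] --> 0).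
  apply: L2_complete => // e e0.
  have e2 : 0 < e / 2 by rewrite divr_gt0.
  have /cvgrPdist_lt/(_ _ e2)[N _ HN] := Scvg.
  exists N => m k Nm Nk; wlog mk : m k Nm Nk / (k <= m)%N.
    by move=> H; case: (leqP k m) => [/H|/ltnW/H]; [|rewrite sqL2BC]; exact.
  rewrite sS//; have := HN m Nm; have := HN k Nk; rewrite !ltr_norml => /andP[? ?] /andP[? ?].
  by lra.
exists y; split => // k.
have H1 := sqL2_dot_cvg mD Ls Ly (Lu k) sy.
have H2 : dot (s N) (u k) @[N --> \oo] --> x k.
  apply: cvg_near_cst; exists k.+1 => // N /= kN.
  by rewrite dot_orthonormal_sum ?iota_uniq// mem_index_iota kN.
exact: (cvg_unique _ H1 H2).
Qed.

Section bounded_operator.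
Variable L : (T -> R[i]) -> (T -> R[i]).
Hypothesis BL : bounded_operator mu D L.

Lemma bop_L2 f : L2 f -> L2 (L f).
Proof. by case: BL => + _ _; exact. Qed.

Lemma bop_bound : exists2 K : R, 0 <= K & forall f, L2 f -> sqL2 (L f) <= K * sqL2 f.
Proof.
case: BL => BL2 _ [c Hc]; exists (c ^+ 2); first exact: sqr_ge0.
move=> f Lf; have := Hc f Lf; rewrite !L2norm_sqrt//; last exact: BL2.
rewrite -EFinM lee_fin => H.
rewrite -[leLHS]sqr_sqrtr ?sqL2_ge0// -[X in _ * X]sqr_sqrtr ?sqL2_ge0//.
by rewrite -exprMn ler_pXn2r ?nnegrE ?sqrtr_ge0// (le_trans _ H) ?sqrtr_ge0.
Qed.

Lemma bop_linear a f g : L2 f -> L2 g ->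
  L2eq mu D (L (fun x => a * f x + g x)) (fun x => a * L f x + L g x).
Proof. by case: BL => _ + _; exact. Qed.

Lemma bop0 : L2eq mu D (L (fun=> 0)) (fun=> 0).
Proof.
have L0 := L2_cst0 mu mD.
have := bop_linear (-1) L0 L0.
rewrite (_ : (fun _ : T => -1 * 0 + 0) = (fun=> 0)); last first.
  by apply/funext => x; rewrite mulr0 addr0.
by apply: filterS => x /= H Dx; rewrite H// mulN1r addNr.
Qed.

Lemma bop_sub f g : L2 f -> L2 g ->
  L2eq mu D (L (fun x => f x - g x)) (fun x => L f x - L g x).
Proof.
move=> Lf Lg; have := bop_linear (-1) Lg Lf.
rewrite (_ : (fun _ : T => -1 * _ + _) = (fun x => f x - g x)); last first.
  by apply/funext => x; rewrite mulN1r addrC.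
by apply: filterS => x /= H Dx; rewrite H// mulN1r addrC.
Qed.

Lemma bop_sum (I : Type) (s : seq I) (a : I -> R[i]) (F : I -> T -> R[i]) :
  (forall i, L2 (F i)) ->
  L2eq mu D (L (fun x => \sum_(i <- s) a i * F i x))
            (fun x => \sum_(i <- s) a i * L (F i) x).
Proof.
move=> LF; elim: s => [|i s IH].
  under eq_fun do rewrite big_nil.
  by under [X in L2eq _ _ _ X]eq_fun do rewrite big_nil; exact: bop0.
under eq_fun do rewrite big_cons.
under [X in L2eq _ _ _ X]eq_fun do rewrite big_cons.
have := bop_linear (a i) (LF i) (L2_sum mD s a LF).
by apply: filterS2 IH => x /= H1 H2 Dx; rewrite H2// H1.
Qed.

Lemma bop_cvg (u : nat -> T -> R[i]) f : (forall k, L2 (u k)) -> L2 f ->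
  (sqL2 (fun x => u k x - f x) @[k --> \oo] --> 0) ->
  (sqL2 (fun x => L (u k) x - L f x) @[k --> \oo] --> 0).
Proof.
move=> Lu Lf uf; have [K K0 HK] := bop_bound.
apply: (@squeeze_cvgr _ _ _ _ (fun=> 0) (fun k => K * sqL2 (fun x => u k x - f x))).
- apply: nearW => k; rewrite sqL2_ge0/=.
  rewrite -(L2eq_sqL2 mD _ _ (bop_sub (Lu k) Lf)); last 2 first.
  + by apply: bop_L2; exact: L2B.
  + by apply: L2B => //; exact: bop_L2.
  by apply: HK; exact: L2B.
- exact: cvg_cst.
- by rewrite -[X in _ --> X](mulr0 K); apply: cvgM uf; exact: cvg_cst.
Qed.

Lemma bop_L2eq f g : L2 f -> L2 g -> L2eq mu D f g -> L2eq mu D (L f) (L g).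
Proof.
move=> Lf Lg fg; have [K K0 HK] := bop_bound.
apply: (sqL2_sub_eq0 mD); [exact: bop_L2..|].
rewrite -(L2eq_sqL2 mD _ _ (bop_sub Lf Lg)); last 2 first.
+ by apply: bop_L2; exact: L2B.
+ by apply: L2B => //; exact: bop_L2.
apply/eqP; rewrite eq_le sqL2_ge0 andbT.
by have := HK _ (L2B mD Lf Lg); rewrite (L2eq_sqL2_sub mD Lf Lg fg) mulr0.
Qed.

(** The vector [w] is the adjoint applied to [y], determined by its coefficients [b k]. They are
    square summable: with [S] the sum of the first [N] of the [|b k|^2], one has
    [S = <y, L (sum b_k u_k)>], and Cauchy-Schwarz gives [S^2 <= 2 |y|^2 K S]. *)
Lemma bop_adjoint (u : nat -> T -> R[i]) y : orthonormal_basis mu D u -> L2 y ->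
  exists w, L2 w /\ forall h, L2 h -> dot w h = dot y (L h).
Proof.
move=> [Lu uu ux] Ly; pose b k := dot y (L (u k)).
have LLu k : L2 (L (u k)) by exact: bop_L2.
have dot_sum N (a : nat -> R[i]) : dot y (L (fun x => \sum_(k < N) a k * u k x)) =
    \sum_(k < N) (a k)^* * b k.
  rewrite (L2eq_dotr mD _ _ Ly (bop_sum _ _ (fun k : 'I_N => Lu k))).
  - by rewrite (L2dot_sumr mD _ _ (fun k : 'I_N => LLu k) Ly).
  - by apply: bop_L2; exact: L2_sum.
  - exact: L2_sum.
have [K K0 HK] := bop_bound.
have [w [Lw wu]] : exists w, L2 w /\ forall k, dot w (u k) = b k.
  apply: (Riesz_Fischer (C := 2 * sqL2 y * K)) => // N.
  set S := \sum_(k < N) _.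
  have S0 : 0 <= S by apply: sumr_ge0 => i _; exact: sqrc_ge0.
  have LbN : L2 (fun x => \sum_(k < N) b k * u k x) by exact: (L2_sum mD).
  have := CauchySchwarz mD Ly (bop_L2 LbN).
  rewrite dot_sum (_ : \sum_(k < N) _ = S%:C); last first.
    by rewrite /S rmorph_sum; apply: eq_bigr => i _; rewrite mulrC mulJ_sqrc.
  rewrite sqrcC => H.
  have := HK _ LbN.
  have -> : sqL2 (fun x => \sum_(k < N) b k * u k x) = S.
    rewrite /S -(big_mkord xpredT (fun k => sqrc (b k))).
    rewrite -(sqL2_orthonormal_sum Lu uu)// ?iota_uniq//.
    by apply: eq_sqL2 => x _; rewrite big_mkord.
  have [->|SN0] := eqVneq S 0; first by rewrite !mulr_ge0 ?sqL2_ge0.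
  have S_gt0 : 0 < S by rewrite lt_neqAle eq_sym SN0.
  move=> H2; rewrite -(ler_pM2r S_gt0).
  have := sqL2_ge0 mu D y; nra.
exists w; split => // h Lh.
have hc := (L2cvgP mD (fun N => L2_sum mD (index_enum _) (fun k : 'I_N => dot h (u k))
  (fun k : 'I_N => Lu k)) Lh).1 (ux h Lh).
have Ls N : L2 (fun x => \sum_(k < N) dot h (u k) * u k x) by exact: L2_sum.
have H1 := sqL2_dot_cvg mD Ls Lh Lw hc.
have H2 := sqL2_dot_cvg mD (fun N => bop_L2 (Ls N)) (bop_L2 Lh) Ly (bop_cvg Ls Lh hc).
have E : (fun N => dot (fun x => \sum_(k < N) dot h (u k) * u k x) w) =
   (fun N => dot (L (fun x => \sum_(k < N) dot h (u k) * u k x)) y).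
  apply/funext => N; rewrite (L2dotC mD Ly (bop_L2 (Ls N))).
  rewrite (dot_sum N (fun k => dot h (u k))) L2dot_suml//.
  rewrite rmorph_sum; apply: eq_bigr => i _.
  rewrite -[RHS]/((_ * _)^*) -wu (L2dotC mD Lw (Lu i)).
  by apply: complex_ext; rewrite !reim_simpl; ring.
have : dot h w = dot (L h) y by rewrite E in H1; exact: (cvg_unique _ H1 H2).
by rewrite (L2dotC mD Lh Lw) (L2dotC mD (bop_L2 Lh) Ly) => ->.
Qed.

End bounded_operator.

End orthonormal.

Lemma cvg_conj (R : realType) (u : nat -> R[i]) (l : R[i]) :
  u k @[k --> \oo] --> l -> (u k)^* @[k --> \oo] --> l^*.
Proof.
move=> /cvgrPdist_lt ul; apply/cvgrPdist_lt => e /ul; apply: filterS => k.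
by rewrite -rmorphB /= normcJ.
Qed.

(** * Riesz bases, their dual bases and the sections of the Gram matrix *)

Section riesz_basis_theory.
Context {d : measure_display} {T : measurableType d} {R : realType}.
Variables (mu : {measure set T -> \bar R}) (D : set T).
Hypothesis mD : measurable D.
Local Notation L2 := (L2 mu D).
Local Notation sqL2 := (sqL2 mu D).
Local Notation dot := (L2dot mu D).
Variable F : nat -> T -> R[i].
Hypothesis LF : forall k, L2 (F k).

(** The interface between the isomorphism behind a Riesz basis and everything later.
    [dual_interpolation] will give injectivity of the matrix operator on [l2], and [dual_Bessel]
    membership of analysis sequences in [l2]. *)
Record dual_basis (G : nat -> T -> R[i]) : Prop := DualBasis {
  dual_L2 : forall m, L2 (G m);
  dual_biorthogonal : forall k m, dot (F k) (G m) = (k == m)%:R;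
  dual_expansion : forall h, L2 h ->
    (sqL2 (fun x => \sum_(k < N) dot h (G k) * F k x - h x) @[N --> \oo] --> 0);
  dual_interpolation : forall (x : nat -> R[i]) (C : R),
    (forall N, \sum_(k < N) sqrc (x k) <= C) ->
    exists w, L2 w /\ forall n, dot w (F n) = x n;
  dual_Bessel : forall h, L2 h ->
    exists C : R, forall N, \sum_(k < N) sqrc (dot h (F k)) <= C }.

(** With [L u_k = F k] and inverse [L'], the dual vector [G m] is the adjoint of [L'] applied to
    [u_m], so [<h, G m> = <L' h, u_m>] and the expansion is that of [L' h], mapped by [L].
    Interpolation applies the adjoint of [L'], the Bessel bound that of [L]. *)
Lemma riesz_dual : riesz_basis mu D F -> exists G, dual_basis G.
Proof.
move=> [u [ou [L [BL [L' BL' LL']] LuF]]]; have [Lu uu ux] := ou.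
have [G HG] := choice (fun m => bop_adjoint mD BL' ou (Lu m)).
have LG m : L2 (G m) by case: (HG m).
have dG m h : L2 h -> dot h (G m) = dot (L' h) (u m).
  move=> Lh; have [_ E] := HG m.
  rewrite (L2dotC mD (LG m) Lh) E// -(L2dotC mD (Lu m))//.
  exact: bop_L2 BL' _ Lh.
have L'F k : L2eq mu D (L' (F k)) (u k).
  apply: L2eq_trans (LL' _ (Lu k)).1; apply: (bop_L2eq mD BL') => //.
    exact: bop_L2 BL _ (Lu k).
  exact: L2eq_sym.
have L2L'F k : L2 (L' (F k)) by exact: bop_L2 BL' _ (LF k).
exists G; split => //.
- by move=> k m; rewrite dG// (L2eq_dotl mD (L2L'F k) (Lu k) (Lu m) (L'F k)) uu.
- move=> h Lh; have L'h : L2 (L' h) by exact: bop_L2 BL' _ Lh.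
  have hc := (L2cvgP mD (fun N => L2_sum mD (index_enum _)
    (fun k : 'I_N => dot (L' h) (u k)) (fun k : 'I_N => Lu k)) L'h).1 (ux _ L'h).
  have Ls N : L2 (fun x => \sum_(k < N) dot (L' h) (u k) * u k x) by exact: L2_sum.
  suff -> : (fun N => sqL2 (fun x => \sum_(k < N) dot h (G k) * F k x - h x)) =
      (fun N => sqL2 (fun x =>
        L (fun x0 => \sum_(k < N) dot (L' h) (u k) * u k x0) x - L (L' h) x)).
    by apply: (bop_cvg mD BL Ls L'h); exact: hc.
  apply/funext => N; apply/esym.
  apply: (L2eq_sqL2 mD).
  + by apply: L2B => //; apply: (bop_L2 BL).
  + by apply: L2B => //; exact: L2_sum.
  have H1 := bop_sum mD BL (index_enum _) (fun k : 'I_N => dot (L' h) (u k))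
    (fun k : 'I_N => Lu k).
  have H2 := (LL' h Lh).2.
  have H3 : {ae mu, forall x, D x -> forall k, L (u k) x = F k x}.
    by have /ae_foralln := LuF; apply: filterS => x /= H Dx k; exact: H.
  move: H1 H2 H3; apply: filterS3 => x /= H1 H2 H3 Dx.
  rewrite H1// H2//; congr (_ - _); apply: eq_bigr => k _.
  by rewrite H3// dG.
- move=> x C xC; have [y [Ly yu]] := Riesz_Fischer mD Lu uu xC.
  have [w [Lw wE]] := bop_adjoint mD BL' ou Ly.
  exists w; split => // n; rewrite wE// -yu.
  exact: (L2eq_dotr mD (L2L'F n) (Lu n) Ly (L'F n)).
- move=> h Lh; have [w [Lw wE]] := bop_adjoint mD BL ou Lh.
  exists (sqL2 w) => N.
  have := Bessel mD Lu uu (iota_uniq 0 N) Lw.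
  rewrite -{1}(subn0 N) -/(index_iota 0 N) big_mkord; apply: le_trans.
  apply: ler_sum => k _; rewrite wE// (L2eq_dotr mD _ (LF k) Lh (LuF k))//.
  exact: bop_L2 BL _ (Lu k).
Qed.

Section dual.
Variable G : nat -> T -> R[i].
Hypothesis dG : dual_basis G.
Let LG := dual_L2 dG.

Let Lpart (h : T -> R[i]) N : L2 (fun x => \sum_(k < N) dot h (G k) * F k x).
Proof. exact: L2_sum. Qed.

(** The partial sums of the expansion of [v] are orthogonal to [v] and converge to it. *)
Lemma dual_total v : L2 v -> (forall j, dot v (F j) = 0) -> L2eq mu D v (fun=> 0).
Proof.
move=> Lv v0; apply: (sqL2_eq0 mD) => //.
apply: complexI; rewrite -L2dot_self//.
have H := sqL2_dot_cvg mD (Lpart v) Lv Lv (dual_expansion dG Lv).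
suff E : (fun N => dot (fun x => \sum_(k < N) dot v (G k) * F k x) v) = (fun=> 0).
  have H' : (fun _ : nat => 0 : R[i]) @ \oo --> (0 : R[i]) by exact: cvg_cst.
  by rewrite E in H; exact: (cvg_unique _ H H').
apply/funext => N; rewrite L2dot_suml// big1// => i _.
by rewrite (L2dotC mD Lv (LF i)) v0 rmorph0 mulr0.
Qed.

Lemma dual_separates v : L2 v -> (forall j, dot v (G j) = 0) -> L2eq mu D v (fun=> 0).
Proof.
move=> Lv v0; apply: (sqL2_eq0 mD) => //.
have := dual_expansion dG Lv.
rewrite (_ : (fun _ => _) = (fun=> sqL2 v)); last first.
  apply/funext => N; rewrite sqL2BC; apply: eq_sqL2 => x _.
  by rewrite big1 ?subr0// => i _; rewrite v0 mul0r.
move=> H; suff H' : (fun _ : nat => sqL2 v) @ \oo --> sqL2 v by exact: (cvg_unique _ H' H).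
exact: cvg_cst.
Qed.

Lemma dual_dotC j m : dot (G m) (F j) = (j == m)%:R.
Proof.
rewrite (L2dotC mD (LF j) (LG m)) (dual_biorthogonal dG).
by case: eqP => _; rewrite ?rmorph1 ?rmorph0.
Qed.

Let frame_part h N := fun x => \sum_(k < N) dot h (F k) * F k x.

Let Lfp h N : L2 (frame_part h N).
Proof. exact: L2_sum. Qed.

(** By biorthogonality the frame sums of [G m] are equal to [F m] from index [m.+1] on, so [F m] is
    a witness, and uniqueness of limits identifies the chosen value with it. *)
Lemma frame_operator_dual m :
  L2 (frame_operator mu D F (G m)) /\ L2eq mu D (frame_operator mu D F (G m)) (F m).
Proof.
rewrite /frame_operator; set P := [set g | _].
have eventually_F N : (m < N)%N -> frame_part (G m) N = F m.
  move=> mN; apply/funext => x; rewrite /frame_part (bigD1 (Ordinal mN))//=.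
  rewrite dual_dotC eqxx mul1r big1 ?addr0// => i im.
  by rewrite dual_dotC (_ : _ == m = false) ?mul0r//; apply/negbTE.
have cF : sqL2 (fun x => frame_part (G m) N x - F m x) @[N --> \oo] --> 0.
  apply: cvg_near_cst; exists m.+1 => // N /= mN; rewrite eventually_F//.
  rewrite (@eq_sqL2 _ _ _ _ _ _ (fun=> 0)) ?sqL2_0// => x _.
  by rewrite subrr.
have PF : P (F m) by split; [exact: LF|apply/(L2cvgP mD (Lfp (G m)) (LF m))].
have [Lg /(L2cvgP mD (Lfp _) Lg) gc] := xgetPex (fun=> 0) (ex_intro _ _ PF).
split => //; apply: (sqL2_sub_eq0 mD) => //.
set g := xget _ _ in Lg gc *.
suff H' : sqL2 (fun x => frame_part (G m) k x - g x) @[k --> \oo] -->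
    sqL2 (fun x => g x - F m x) by exact: (cvg_unique _ H' gc).
apply: cvg_near_cst.
exists m.+1 => // N /= mN; rewrite -[LHS]/(sqL2 (fun x => frame_part (G m) N x - _)).
by rewrite eventually_F// sqL2BC.
Qed.

(** All that is known of the chosen [g] is [S g = F m]. Pairing the frame sums of [g] with [G j]
    recovers [<g, F j>], and the [F j] are total. *)
Lemma L2inv_frame_operator m :
  let g := L2inv mu D (frame_operator mu D F) (F m) in L2 g /\ L2eq mu D g (G m).
Proof.
rewrite /L2inv; set P := [set g | _].
have PG : P (G m) by split => //; exact: (frame_operator_dual m).2.
have [] := xgetPex (fun=> 0) (ex_intro _ _ PG).
set g := xget _ _ => Lg Sg; split => //.
suff gF j : dot g (F j) = (j == m)%:R.
  apply: (sqL2_sub_eq0 mD) => //; rewrite -(sqL2_0 mu mD).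
  apply: (L2eq_sqL2 mD); [exact: L2B|exact: L2_cst0|].
  by apply: dual_total; [exact: L2B|move=> j; rewrite L2dotBl// gF dual_dotC subrr].
have [Q|nQ] := pselect (exists h, L2 h /\ L2cvg mu D (frame_part g) h).
  have [LS /(L2cvgP mD (Lfp _) LS) Sc] := xgetPex (fun=> 0) Q.
  have H := sqL2_dot_cvg mD (Lfp g) LS (LG j) Sc.
  rewrite (L2eq_dotl mD LS (LF m) (LG j) Sg) (dual_biorthogonal dG) eq_sym in H.
  suff H' : dot (frame_part g N) (G j) @[N --> \oo] --> dot g (F j).
    exact: (cvg_unique _ H' H).
  apply: cvg_near_cst; exists j.+1 => // N /= jN.
  rewrite L2dot_suml// (bigD1 (Ordinal jN))//= (dual_biorthogonal dG) eqxx mulr1.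
  rewrite big1 ?addr0// => i im; rewrite (dual_biorthogonal dG).
  by rewrite (_ : _ == j = false) ?mulr0//; apply/negbTE.
(* If the frame series of [g] had no limit, [frame_operator] would return its default 0, and
   [0 = F m] contradicts [<F m, G m> = 1]. *)
have S0 : frame_operator mu D F g = fun=> 0.
  by rewrite /frame_operator; apply: xgetPN => h Qh; apply: nQ; exists h.
have := dual_biorthogonal dG m m; rewrite eqxx.
rewrite -(L2eq_dotl mD _ (LF m) (LG m) Sg) S0; last exact: L2_cst0.
by rewrite L2dot0l// => /eqP; rewrite eq_sym oner_eq0.
Qed.

Let B := matrix_operator (fun k m => dot (L2inv mu D (frame_operator mu D F) (F m))
  (L2inv mu D (frame_operator mu D F) (F k))).

(** [B] sends the coefficients of [w] against [F] to those against [G]. This is the expansion of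
    [G k] in the [F n], paired with [w]; the conjugations appear because [G k] stands in the second
    slot. *)
Lemma dual_matrix w k : L2 w -> B (fun n => dot w (F n)) k = dot w (G k).
Proof.
move=> Lw; apply: cvg_lim => //.
have H := sqL2_dot_cvg mD (Lpart (G k)) (LG k) Lw (dual_expansion dG (LG k)).
rewrite (L2dotC mD (LG k) Lw).
suff -> : series (fun n => dot (L2inv mu D (frame_operator mu D F) (F n))
    (L2inv mu D (frame_operator mu D F) (F k)) * dot w (F n)) =
  (fun N => (dot (fun x => \sum_(n < N) dot (G k) (G n) * F n x) w)^*).
  exact: cvg_conj.
apply/funext => N; rewrite (L2dot_suml mD _ _ (fun n : 'I_N => LF n) Lw).
rewrite /series [LHS]big_mkord rmorph_sum.
apply: eq_bigr => i _.
have [Lk Ek] := L2inv_frame_operator k; have [Li Ei] := L2inv_frame_operator i.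
rewrite (L2eq_dotl mD Li (LG i) Lk Ei) (L2eq_dotr mD Lk (LG k) (LG i) Ek).
rewrite -[RHS]/((_ * _)^*) (L2dotC mD (LG k) (LG i)) (L2dotC mD (LF i) Lw).
by apply: complex_ext; rewrite !reim_simpl; ring.
Qed.

Lemma l2P (x : nat -> R[i]) : l2 x <-> exists C : R, forall N, \sum_(k < N) sqrc (x k) <= C.
Proof.
have x0 k : (0 <= (Normc.normc (x k) ^+ 2)%:E)%E by rewrite lee_fin sqr_ge0.
have E N : (\sum_(0 <= k < N) (Normc.normc (x k) ^+ 2)%:E)%E =
    (\sum_(k < N) sqrc (x k))%:E.
  by rewrite sumEFin big_mkord; congr _%:E; apply: eq_bigr => k _; rewrite normc_sqr.
split=> [xoo|[C xC]].
  exists (fine (\sum_(0 <= k <oo) (Normc.normc (x k) ^+ 2)%:E)%E) => N.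
  rewrite -lee_fin fineK; last first.
    by rewrite ge0_fin_numE//; apply: nneseries_ge0 => k _ _; exact: x0.
  by rewrite -E; apply: nneseries_lim_ge => k _ _; exact: x0.
apply: (@le_lt_trans _ _ C%:E); last exact: ltry.
apply: lime_le; first by apply: is_cvg_nneseries => k _ _; exact: x0.
by apply: nearW => N; rewrite E lee_fin.
Qed.

(** Uniqueness of the preimage is the point: an arbitrary [x] in [l2] is of the form [<w, F n>] by
    interpolation, and [w] has the same coefficients against [G] as [h], hence equals it. *)
Lemma l2inv_dual_matrix h y : L2 h -> (forall k, y k = dot h (G k)) ->
  l2inv B y = (fun n => dot h (F n)).
Proof.
move=> Lh yE; rewrite /l2inv; set P := [set x | _].
have Ph : P (fun n => dot h (F n)).
  split; first by apply/l2P; exact: dual_Bessel dG _ Lh.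
  by apply/funext => k; rewrite dual_matrix.
have [/l2P[C xC] Bx] := xgetPex (fun=> 0) (ex_intro _ _ Ph).
have [w [Lw wx]] := dual_interpolation dG xC.
have xE : xget (fun=> 0) P = (fun n => dot w (F n)).
  by apply/funext => n; rewrite wx.
rewrite xE; apply/funext => n; apply: (L2eq_dotl mD) => //.
suff : L2eq mu D (fun x => w x - h x) (fun=> 0).
  by apply: filterS => x /= H Dx; apply/eqP; rewrite -subr_eq0 H.
apply: dual_separates; first exact: L2B.
by move=> k; rewrite L2dotBl// -yE -Bx xE dual_matrix// subrr.
Qed.

Lemma projE (l : nat) (x : nat -> R[i]) k :
  Defs.proj l x k = if (k < l)%N then x k else 0.
Proof.
rewrite /Defs.proj /std_basis; case: ifPn => kl.
  rewrite (bigD1 (Ordinal kl))//= eqxx mulr1 big1 ?addr0// => i ik.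
  by rewrite eq_sym (_ : _ == k = false) ?mulr0//; apply/negbTE.
rewrite big1// => i _; rewrite (_ : k == i = false) ?mulr0//.
by apply: contraNF kl => /eqP ->.
Qed.

(** By biorthogonality the basis vector [h_m] is the sequence [<F m, G k>], so [B^-1 h_m] is
    [<F m, F n>]. For [m >= l] the projection annihilates [h_m], and the zero sequence is
    represented by the zero function. *)
Lemma entry_compression_dual (l k m : nat) : entry (compression l (l2inv B)) k m =
  if (k < l)%N && (m < l)%N then dot (F m) (F k) else 0.
Proof.
rewrite /entry /compression projE; case: ifPn => //= kl.
have [ml|ml] := ltnP m l.
  rewrite (l2inv_dual_matrix (LF m))// => j.
  rewrite projE /std_basis (dual_biorthogonal dG) eq_sym.
  by case: eqP => [<-|_]; rewrite ?ml//; case: ifP.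
rewrite (l2inv_dual_matrix (L2_cst0 mu mD)).
  exact: L2dot0l.
move=> j; rewrite L2dot0l// projE /std_basis; case: ifP => // jl.
by rewrite (_ : j == m = false)//; apply/negbTE; rewrite neq_ltn (leq_trans jl ml).
Qed.

Let gram l : 'M[R[i]]_l := corner l (compression l (l2inv B)).

Let gramE l (k m : 'I_l) : gram l k m = dot (F m) (F k).
Proof. by rewrite mxE entry_compression_dual !ltn_ord. Qed.

(** A kernel vector gives a combination of the [F i] of norm 0, and pairing with [G i] isolates each
    coefficient. The transpose enters because entry [(k, m)] is [<F m, F k>]. *)
Lemma gram_unitmx l : gram l \in unitmx.
Proof.
rewrite -unitmx_tr -row_free_unit -kermx_eq0; apply/rowV0P => v /sub_kermxP vG.
pose a (i : 'I_l) := v 0 i.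
have La : L2 (fun x => \sum_(i < l) a i * F i x) by exact: L2_sum.
have a0 : L2eq mu D (fun x => \sum_(i < l) a i * F i x) (fun=> 0).
  apply: (sqL2_eq0 mD) => //; apply: complexI; rewrite -L2dot_self//.
  rewrite L2dot_sumr// big1// => k _; rewrite L2dot_suml//.
  have /rowP/(_ k) := vG; rewrite !mxE => H.
  rewrite -[X in _ * X](_ : \sum_j v 0 j * (gram l)^T j k = _); last first.
    by apply: eq_bigr => j _; rewrite mxE gramE.
  by rewrite H mulr0.
apply/rowP => i; rewrite mxE.
have := L2eq_dotl mD La (L2_cst0 mu mD) (LG i) a0.
rewrite L2dot_suml// (bigD1 i)//= (dual_biorthogonal dG) eqxx mulr1.
rewrite big1 ?addr0; last first.
  move=> j ji; rewrite (dual_biorthogonal dG) (_ : (j : nat) == i = false) ?mulr0//.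
  exact/negbTE.
by rewrite -[v 0 i]/(a i) => ->; exact: L2dot0l.
Qed.

(* The coefficients [gram^-1 <h, F_k>] are those of the orthogonal projection of
   [h] onto the span of [F_0, ..., F_(l-1)].                                    *)
Lemma gram_projection_cvg h : L2 h ->
  let a l : 'cV[R[i]]_l := invmx (gram l) *m \col_k dot h (F k) in
  sqL2 (fun x => \sum_(k < l) a l k 0 * F k x - h x) @[l --> \oo] --> 0.
Proof.
move=> Lh a; pose A l x := \sum_(k < l) a l k 0 * F k x.
have LA l : L2 (A l) by exact: L2_sum.
have AF l (k : 'I_l) : dot (A l) (F k) = dot h (F k).
  have : gram l *m a l = \col_k dot h (F k) by rewrite mulKVmx// gram_unitmx.
  move=> /colP/(_ k); rewrite !mxE => <-; rewrite L2dot_suml//.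
  by apply: eq_bigr => j _; rewrite gramE mulrC.
(* Best approximation: [h - A l] is orthogonal to the span, so by Pythagoras [A l] is at least as
   close to [h] as the partial sum of the dual expansion, which converges. *)
apply: (@squeeze_cvgr _ _ _ _ (fun=> 0) (fun l =>
  sqL2 (fun x => \sum_(k < l) dot h (G k) * F k x - h x))); last first.
- exact: dual_expansion.
- exact: cvg_cst.
apply: nearW => l; rewrite sqL2_ge0/= -/(A l).
rewrite sqL2BC [leRHS]sqL2BC.
have LV := Lpart h l.
rewrite [leRHS](@eq_sqL2 _ _ _ _ _ _ (fun x => (h x - A l x) -
  (\sum_(k < l) dot h (G k) * F k x - A l x))); last first.
  by move=> x _; rewrite opprB addrA subrK.
rewrite (sqL2_sub mD (L2B mD Lh (LA l)) (L2B mD LV (LA l))).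
suff -> : dot (fun x => h x - A l x)
    (fun x => \sum_(k < l) dot h (G k) * F k x - A l x) = 0.
  by rewrite mulr0 subr0 lerDl sqL2_ge0.
have LhA : L2 (fun x => h x - A l x) by exact: L2B.
have hA0 (k : 'I_l) : dot (fun x => h x - A l x) (F k) = 0.
  by rewrite L2dotBl// AF subrr.
by rewrite (L2dotBr mD LV (LA l) LhA) !(L2dot_sumr mD)// !big1 ?subr0// => k _; rewrite hA0 mulr0.
Qed.

End dual.

End riesz_basis_theory.

(** * Image measures and Fubini's theorem for complex functions *)

Lemma integral_pushforward_measurable d1 d2 (X : measurableType d1)
    (Y : measurableType d2) (R : realType) (mu : {measure set X -> \bar R})
    (phi : X -> Y) (mphi : measurable_fun setT phi) (f : Y -> \bar R) : measurable_fun setT f ->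
  (\int[pushforward mu phi]_y f y = \int[mu]_x f (phi x))%E.
Proof.
move=> mf; rewrite [LHS]integralE [RHS]integralE; congr (_ - _)%E.
  rewrite ge0_integral_pushforward//; last exact: measurable_funepos.
  by rewrite preimage_setT; apply: eq_integral => x _; rewrite /= !funeposE.
rewrite ge0_integral_pushforward//; last exact: measurable_funeneg.
  by rewrite preimage_setT; apply: eq_integral => x _; rewrite /= !funenegE.
Qed.

Section complex_fubini.
Context {d1 d2 : measure_display} {T1 : measurableType d1} {T2 : measurableType d2}
  {R : realType}.
Variables (m1 : {sigma_finite_measure set T1 -> \bar R})
  (m2 : {sigma_finite_measure set T2 -> \bar R}).

(** The inner integral is finite only for almost every [x]; where it is infinite [fine] alters it,
    which the outer integral does not see. *)
Lemma Rintegral_fubini_F (f : T1 * T2 -> R) :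
  (m1 \x m2)%E.-integrable setT (EFin \o f) ->
  \int[m1]_x \int[m2]_y f (x, y) = fine (\int[(m1 \x m2)%E]_z (f z)%:E)%E.
Proof.
move=> intf; rewrite -(integral12_prod_meas1 intf) /Rintegral; congr fine.
have iF := integrable_fubini_F intf.
apply: ae_eq_integral => //.
- apply/measurable_EFinP; apply: measurableT_comp; first exact: fine_measurable.
  by case/integrableP : iF.
- by case/integrableP : iF.
- by apply: filterS (integrable_ae measurableT iF) => x /= + _; move/(_ I) => /fineK.
Qed.

Lemma Rintegral_fubini_G (f : T1 * T2 -> R) :
  (m1 \x m2)%E.-integrable setT (EFin \o f) ->
  \int[m2]_y \int[m1]_x f (x, y) = fine (\int[(m1 \x m2)%E]_z (f z)%:E)%E.
Proof.
move=> intf; rewrite -(integral21_prod_meas1 intf) /Rintegral; congr fine.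
apply: ae_eq_integral => //.
- apply/measurable_EFinP; apply: measurableT_comp; first exact: fine_measurable.
  exact: measurable_fubini_G intf.
- exact: measurable_fubini_G intf.
- apply: filterS (ae_integrable2 intf) => y /= H _.
  by rewrite fineK// integrable_fin_num.
Qed.

Lemma cintegral_fubini (k : T1 * T2 -> R[i]) :
  cintegrable (m1 \x m2)%E setT k ->
  cintegral m1 setT (fun x => cintegral m2 setT (fun y => k (x, y))) =
  cintegral m2 setT (fun y => cintegral m1 setT (fun x => k (x, y))).
Proof.
move=> ik; apply: complex_ext => /=.
  rewrite (Rintegral_fubini_F (cintegrable_Re measurableT ik)).
  by rewrite (Rintegral_fubini_G (cintegrable_Re measurableT ik)).
rewrite (Rintegral_fubini_F (cintegrable_Im measurableT ik)).
by rewrite (Rintegral_fubini_G (cintegrable_Im measurableT ik)).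
Qed.

Lemma cmeasurable_fst (u : T1 -> R[i]) : cmeasurable setT u ->
  cmeasurable [set: T1 * T2] (fun p => u p.1).
Proof. by move=> [ur ui]; split; [exact: (measurableT_comp ur)|exact: (measurableT_comp ui)]. Qed.

Lemma cmeasurable_snd (w : T2 -> R[i]) : cmeasurable setT w ->
  cmeasurable [set: T1 * T2] (fun p => w p.2).
Proof. by move=> [ur ui]; split; [exact: (measurableT_comp ur)|exact: (measurableT_comp ui)]. Qed.

Lemma integral_prod_normc (u : T1 -> R[i]) (w : T2 -> R[i]) :
  cintegrable m1 setT u -> cintegrable m2 setT w ->
  (\int[m1]_x \int[m2]_y `|(Normc.normc (u x * w y))%:E| < +oo)%E.
Proof.
move=> [mu nu] [mw nw].
have nwfin := integrable_fin_num measurableT nw.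
have E x : (\int[m2]_y `|(Normc.normc (u x * w y))%:E| =
    (Normc.normc (u x))%:E * \int[m2]_y (Normc.normc (w y))%:E)%E.
  rewrite -ge0_integralZl_EFin//; [|by move=> y _; rewrite lee_fin normc_nneg| |exact: normc_nneg].
    by apply: eq_integral => y _; rewrite /= Normc.normcM ger0_norm ?mulr_ge0 ?normc_nneg.
  by apply/measurable_EFinP; exact: measurable_normc.
under eq_integral do rewrite E.
rewrite ge0_integralZr//=.
- rewrite lte_mul_pinfty//.
  + by apply: integral_ge0 => x _; rewrite lee_fin normc_nneg.
  + exact: integrable_fin_num.
  + by rewrite ltey_eq nwfin.
- by apply/measurable_EFinP; exact: measurable_normc.
- by move=> x _; rewrite lee_fin normc_nneg.
- by apply: integral_ge0 => x _; rewrite lee_fin normc_nneg.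
Qed.

Lemma cintegrable_prod (u : T1 -> R[i]) (w : T2 -> R[i]) :
  cintegrable m1 setT u -> cintegrable m2 setT w ->
  cintegrable (m1 \x m2)%E setT (fun p => u p.1 * w p.2).
Proof.
move=> iu iw; have mk : cmeasurable [set: T1 * T2] (fun p => u p.1 * w p.2).
  by apply: cmeasurableM; [apply: cmeasurable_fst; case: iu|apply: cmeasurable_snd; case: iw].
have mk' : measurable_fun [set: T1 * T2] (fun p => (Normc.normc (u p.1 * w p.2))%:E).
  by apply/measurable_EFinP; exact: (measurable_normc mk).
split; first exact: mk.
exact: (integrable12ltyP m1 m2 mk').2 (integral_prod_normc iu iw).
Qed.

(** [row_product] is built on [\x^] while the Fubini statements above concern [\x]; both product
    integrals equal the same iterated integral. *)
Lemma cintegral_prod (u : T1 -> R[i]) (w : T2 -> R[i]) :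
  cintegrable m1 setT u -> cintegrable m2 setT w ->
  cintegral (m1 \x^ m2)%E setT (fun p => u p.1 * w p.2) =
  cintegral m1 setT u * cintegral m2 setT w.
Proof.
move=> iu iw; have ip := cintegrable_prod iu iw.
transitivity (cintegral m1 setT (fun x => cintegral m2 setT (fun y => u x * w y))).
  apply: complex_ext => /=.
    rewrite (Rintegral_fubini_F (cintegrable_Re measurableT ip)).
    rewrite -(integral12_prod_meas1 (cintegrable_Re measurableT ip)).
    by rewrite (integral12_prod_meas2 (cintegrable_Re measurableT ip)).
  rewrite (Rintegral_fubini_F (cintegrable_Im measurableT ip)).
  rewrite -(integral12_prod_meas1 (cintegrable_Im measurableT ip)).
  by rewrite (integral12_prod_meas2 (cintegrable_Im measurableT ip)).
rewrite [RHS]mulrC -cintegralZl//.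
by apply: eq_cintegral => // x _; rewrite cintegralZl// mulrC.
Qed.

End complex_fubini.

(** * Lebesgue measure on row vectors: iterated integrals and affine substitutions *)

Section lebesgue_row_theory.
Context {R : realType}.

Local Notation leb := (@lebesgue_measure R).
Local Notation mu n := (@lebesgue_row R n).

Lemma integral_lebesgue_row_succ n (f : 'rV[R]_n.+1 -> \bar R) :
  measurable_fun setT f ->
  (\int[mu n.+1]_x f x = \int[(leb \x^ mu n)%E]_p f (row_cons p))%E.
Proof.
move=> mf.
apply: (etrans _ (integral_pushforward_measurable (leb \x^ mu n)%E
  (@measurable_row_cons R n) mf)).
exact: (@eq_measure_integral _ _ _ _
  (measure_function_pushforward__canonical__measure_function_Measure
    (leb \x^ mu n)%E (@measurable_row_cons R n))).
Qed.

Lemma ge0_integral_lebesgue_row_succ n (f : 'rV[R]_n.+1 -> \bar R) :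
  measurable_fun setT f -> (forall x, 0 <= f x)%E ->
  (\int[mu n.+1]_x f x = \int[leb]_a \int[mu n]_v f (row_cons (a, v)))%E.
Proof.
move=> mf f0; rewrite integral_lebesgue_row_succ//.
have mf' : measurable_fun setT (fun p : R * 'rV[R]_n => f (row_cons p)).
  by apply: measurableT_comp => //; exact: measurable_row_cons.
have f0' (p : R * 'rV[R]_n) : (0 <= f (row_cons p))%E by [].
rewrite -[RHS](@fubini_tonelli1 _ _ _ _ R leb (mu n) _ mf' f0').
(* The two product measures agree on rectangles, hence everywhere. *)
apply: eq_measure_integral => A mA _; apply/esym/product_measure_unique => // B C mB mC.
exact: product_measure2E.
Qed.

Lemma cintegral_lebesgue_row_succ n (f : 'rV[R]_n.+1 -> R[i]) : cmeasurable setT f ->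
  cintegral (mu n.+1) setT f = cintegral (leb \x^ mu n)%E setT (fun p => f (row_cons p)).
Proof.
move=> [fr fi]; apply: complex_ext => /=; rewrite /Rintegral integral_lebesgue_row_succ//.
  exact/measurable_EFinP.
exact/measurable_EFinP.
Qed.

Lemma row_cons0 n (p : R * 'rV[R]_n) : row_cons p 0 ord0 = p.1.
Proof.
rewrite /row_cons (_ : ord0 = lshift n (0 : 'I_1)); last exact/val_inj.
by rewrite (row_mxEl (p.1)%:M p.2 0 0) mxE eqxx.
Qed.

Lemma row_consS n (p : R * 'rV[R]_n) i : row_cons p 0 (lift ord0 i) = p.2 0 i.
Proof.
rewrite /row_cons (_ : lift ord0 i = rshift 1 i); last exact/val_inj.
by rewrite (row_mxEr (p.1)%:M p.2 0 i).
Qed.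

Lemma cmeasurable_coord n (u : R -> R[i]) (i : 'I_n) : cmeasurable setT u ->
  cmeasurable setT (fun x : 'rV[R]_n => u (x 0 i)).
Proof.
by move=> [ur ui]; split; [apply: (measurableT_comp ur)|apply: (measurableT_comp ui)];
  exact: measurable_coord.
Qed.

Lemma cmeasurable_prod d (T : measurableType d) (D : set T) (I : Type) (s : seq I)
    (F : I -> T -> R[i]) :
  (forall i, cmeasurable D (F i)) -> cmeasurable D (fun x => \prod_(i <- s) F i x).
Proof.
move=> mF; elim: s => [|i s IH].
  by under eq_fun do rewrite big_nil; exact: cmeasurable_cst.
by under eq_fun do rewrite big_cons; exact: cmeasurableM.
Qed.

(** Integrability and value share one induction, as each step uses integrability of the product over
    the remaining coordinates. In dimension 0 the constant 1 is integrated against a Dirac mass. *)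
Lemma cintegral_lebesgue_row_prod n (u : 'I_n -> R -> R[i]) :
  (forall i, cintegrable leb setT (u i)) ->
  cintegrable (mu n) setT (fun x => \prod_(i < n) u i (x 0 i)) /\
  cintegral (mu n) setT (fun x => \prod_(i < n) u i (x 0 i)) =
  \prod_(i < n) cintegral leb setT (u i).
Proof.
elim: n u => [|n IH] u iu.
  have m0 (A : set 'rV[R]_0) : mu 0 A = \d_(0 : 'rV[R]_0) A by [].
  split.
    split; first by under eq_fun do rewrite big_ord0; exact: cmeasurable_cst.
    apply/integrableP; split.
      apply/measurable_EFinP; apply: measurable_normc.
      by under eq_fun do rewrite big_ord0; exact: cmeasurable_cst.
    rewrite (@eq_measure_integral _ _ _ _ (\d_(0 : 'rV[R]_0))) ?integral_dirac//.
    - by rewrite diracT mul1e ltry.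
    - apply/measurable_EFinP; apply: measurableT_comp => //; apply: measurable_normc.
      by under eq_fun do rewrite big_ord0; exact: cmeasurable_cst.
  under eq_fun do rewrite big_ord0.
  rewrite big_ord0 /cintegral !Rintegral_cst//=.
  by rewrite indicE mem_set// mulr1 mul0r.
have [iw wE] := IH (fun i => u (lift ord0 i)) (fun i => iu _).
have E : (fun x : 'rV[R]_n.+1 => \prod_(i < n.+1) u i (x 0 i)) =
    (fun x => u ord0 (x 0 ord0) * \prod_(i < n) u (lift ord0 i) (x 0 (lift ord0 i))).
  by apply/funext => x; rewrite big_ord_recl.
have Er (p : R * 'rV[R]_n) : \prod_(i < n.+1) u i (row_cons p 0 i) =
    u ord0 p.1 * \prod_(i < n) u (lift ord0 i) (p.2 0 i).
  rewrite big_ord_recl row_cons0; congr (_ * _).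
  by apply: eq_bigr => i _; rewrite row_consS.
have mu1 : cmeasurable setT (fun x : 'rV[R]_n.+1 => \prod_(i < n.+1) u i (x 0 i)).
  by apply: cmeasurable_prod => i; apply: cmeasurable_coord; case: (iu i).
split; last first.
  rewrite cintegral_lebesgue_row_succ// big_ord_recl -wE -cintegral_prod//.
  by apply: eq_cintegral => p _; rewrite Er.
split => //; apply/integrableP; split.
  by apply/measurable_EFinP; exact: measurable_normc.
rewrite ge0_integral_lebesgue_row_succ//; last first.
  by apply/measurable_EFinP; apply: measurableT_comp => //; exact: measurable_normc.
under eq_integral => a _ do under eq_integral => v _ do rewrite Er.
exact: (integral_prod_normc (iu ord0) iw).
Qed.

(** [c] times the image of Lebesgue measure under [x |-> c x + b] agrees with Lebesgue measure on
    half-open intervals, hence is Lebesgue measure. *)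
Lemma ge0_integral_affine1 (c b : R) (f : R -> \bar R) : 0 < c ->
  measurable_fun setT f -> (forall x, 0 <= f x)%E ->
  (\int[leb]_x f (c * x + b)%R = (c^-1)%:E * \int[leb]_x f x)%E.
Proof.
move=> c0 mf f0; pose phi (x : R) : measurableTypeR R := c * x + b.
have mphi : measurable_fun setT phi.
  by apply: measurable_funD => //; exact: measurable_funM.
pose nu := mscale (NngNum (ltW c0)) 
  (measure_function_pushforward__canonical__measure_function_Measure leb mphi).
have leb_nu A : measurable A -> leb A = nu A.
  move=> mA; apply: lebesgue_measure_unique => //= _ [[x y]] _ <-.
  rewrite /nu /mscale /= /pushforward.
  rewrite (_ : phi @^-1` _ = `](x - b) / c, (y - b) / c]%classic).
    rewrite !lebesgue_measure_itv /= !lte_fin ltr_pM2r ?invr_gt0// ltrD2r.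
    case: ifP => _; last by rewrite mule0.
    rewrite -!EFinB -mulrBl -EFinM; congr _%:E.
    by field; rewrite gt_eqF.
  apply/seteqP; split => z /=; rewrite /phi !in_itv/= ltr_pdivrMr// ler_pdivlMr// => /andP[? ?];
    by rewrite mulrC; lra.
transitivity ((c^-1)%:E * (c%:E * \int[leb]_x f (c * x + b)%R))%E.
  by rewrite muleA -EFinM mulVf ?mul1e// gt_eqF.
congr (_ * _)%E.
transitivity (\int[nu]_x f x)%E; last first.
  by apply: eq_measure_integral => A mA _; apply/esym/leb_nu.
rewrite /nu ge0_integral_mscale//=; congr (_ * _)%E.
by rewrite ge0_integral_pushforward// preimage_setT.
Qed.

Lemma measurable_affine n (c : R) (b : 'rV[R]_n) :
  measurable_fun setT (fun x : 'rV[R]_n => c *: x + b).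
Proof.
apply: measurable_fun_coordP => i; under eq_fun do rewrite !mxE.
apply: measurable_funD => //; apply: measurable_funM => //; exact: measurable_coord.
Qed.

(** Tonelli splits off the head coordinate, and [E] says that the affine map acts separately on head
    and tail. Each coordinate contributes one factor [c^-1]. *)
Lemma ge0_integral_affine n (c : R) (b : 'rV[R]_n) (f : 'rV[R]_n -> \bar R) :
  0 < c -> measurable_fun setT f -> (forall x, 0 <= f x)%E ->
  (\int[mu n]_x f (c *: x + b)%R = ((c ^+ n)^-1)%:E * \int[mu n]_x f x)%E.
Proof.
move=> c0; elim: n b f => [|n IH] b f mf f0.
  rewrite expr0 invr1 mul1e; apply: eq_integral => x _.
  by congr f; apply/rowP => -[].
rewrite ge0_integral_lebesgue_row_succ//; last first.
  by apply: measurableT_comp => //; exact: measurable_affine.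
rewrite ge0_integral_lebesgue_row_succ//.
have mf2 : measurable_fun setT (fun p : R * 'rV[R]_n => f (row_cons p)).
  by apply: measurableT_comp => //; exact: measurable_row_cons.
have mf1 a : measurable_fun setT (fun v : 'rV[R]_n => f (row_cons (a, v))).
  by apply: (measurableT_comp mf2); exact: measurable_pair1.
pose b' : 'rV[R]_n := \row_i b 0 (lift ord0 i).
have E a v : c *: row_cons (a, v) + b = row_cons (c * a + b 0 0, c *: v + b').
  have Z (x : 'rV[R]_n.+1) i : (c *: x + b) 0 i = c * x 0 i + b 0 i by rewrite !mxE.
  apply/rowP => i; rewrite Z; case: (unliftP ord0 i) => [j|] ->.
    by rewrite !row_consS /= !mxE.
  by rewrite !row_cons0.
under eq_integral => a _.
  under eq_integral => v _ do rewrite E.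
  rewrite (IH b' (fun v => f (row_cons (c * a + b 0 0, v))))//; over.
pose G (a : R) := (\int[mu n]_v f (row_cons (a, v)))%E.
have mG : measurable_fun setT G.
  exact: (@measurable_fun_fubini_tonelli_F _ _ _ _ R (mu n)
    (fun p : measurableTypeR R * 'rV[R]_n => f (row_cons p)) mf2 (fun p => f0 _)).
have G0 a : (0 <= G a)%E by exact: integral_ge0.
have mGc : measurable_fun setT (fun a : R => G (c * a + b 0 0)).
  by apply: (measurableT_comp mG); apply: measurable_funD => //; exact: measurable_funM.
have cn0 : 0 <= (c ^+ n)^-1 by rewrite invr_ge0 exprn_ge0// ltW.
transitivity ((c ^+ n)^-1%:E * \int[leb]_a G (c * a + b 0%R 0%R)%R)%E.
  exact: (@ge0_integralZl_EFin _ _ _ leb setT measurableT _ (fun a _ => G0 _) mGc _ cn0).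
rewrite (ge0_integral_affine1 _ c0 mG G0) muleA -EFinM; congr (_%:E * _)%E.
by rewrite -invfM exprS mulrC.
Qed.

Lemma integral_affine n (c : R) (b : 'rV[R]_n) (f : 'rV[R]_n -> R) :
  0 < c -> (mu n).-integrable setT (EFin \o f) ->
  \int[mu n]_x f (c *: x + b) = (c ^+ n)^-1 * \int[mu n]_x f x.
Proof.
move=> c0 intf; have /integrableP[mf _] := intf.
have k0 : (0 <= (c ^+ n)^-1)%R by rewrite invr_ge0 exprn_ge0// ltW.
rewrite -RintegralZl// /Rintegral; congr fine.
rewrite [LHS]integralE [RHS]integralE; congr (_ - _)%E.
  have := ge0_integral_affine b c0 (measurable_funepos mf) (funepos_ge0 _).
  rewrite -ge0_integralZl_EFin//; last exact: measurable_funepos.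
  move=> E; transitivity (\int[mu n]_x (EFin \o f)^\+ (c *: x + b)%R)%E.
  by apply: eq_integral => x _; rewrite !funeposE.
  rewrite E; apply: eq_integral => x _.
  by have /(congr1 (fun h => h x)) <- := ge0_funeposM (EFin \o f) k0.
have := ge0_integral_affine b c0 (measurable_funeneg mf) (funeneg_ge0 _).
rewrite -ge0_integralZl_EFin//; last exact: measurable_funeneg.
move=> E; transitivity (\int[mu n]_x (EFin \o f)^\- (c *: x + b)%R)%E.
  by apply: eq_integral => x _; rewrite !funenegE.
rewrite E; apply: eq_integral => x _.
by have /(congr1 (fun h => h x)) <- := ge0_funenegM (EFin \o f) k0.
Qed.

End lebesgue_row_theory.

(** * Exponentials on cubes and their inner products *)

Lemma FTC2_derivable (R : realType) (f F : R -> R) (a b : R) : a < b ->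
  continuous f -> (forall x, is_derive (x : R) 1 F (f x)) ->
  \int[lebesgue_measure]_(x in `[a, b]) f x = F b - F a.
Proof.
move=> ab cf dF.
have cF : continuous F.
  move=> x; apply: differentiable_continuous; apply/derivable1_diffP.
  by have [] := dF x.
rewrite /Rintegral (@continuous_FTC2 _ f F)//.
- exact: continuous_subspaceT.
- split.
  + by move=> x _; have [] := dF x.
  + exact: cvg_at_right_filter (cF a).
  + exact: cvg_at_left_filter (cF b).
- by move=> x _; rewrite derive1E; have [_] := dF x.
Qed.

Section exponentials.
Context {R : realType}.
Implicit Types a b : R.

Lemma expiD a b : expi (a + b) = expi a * expi b :> R[i].
Proof. by apply: complex_ext; rewrite !reim_simpl /= ?cosD ?sinD; ring. Qed.

Lemma expi0 : expi 0 = 1 :> R[i].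
Proof. by rewrite /expi cos0 sin0. Qed.

Lemma expiN a : expi (- a) = (expi a)^* :> R[i].
Proof. by rewrite /expi cosN sinN. Qed.

Lemma sqrc_expi a : sqrc (expi a) = 1.
Proof. exact: cos2Dsin2. Qed.

Lemma normc_expi a : Normc.normc (expi a) = 1.
Proof. by rewrite normc_sqrt sqrc_expi sqrtr1. Qed.

Lemma expi_sum (I : Type) (s : seq I) (F : I -> R) :
  expi (\sum_(i <- s) F i) = \prod_(i <- s) expi (F i).
Proof. exact: (big_morph _ expiD expi0). Qed.

Lemma cmeasurable_expi : cmeasurable setT (@expi R).
Proof.
split; apply: continuous_measurable_fun; [exact: continuous_cos|exact: continuous_sin].
Qed.

Lemma integral_expi a :
  cintegral lebesgue_measure `[(- pi : R), pi] (fun x => expi (a * x)) =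
  (2 * pi * sinc (pi * a))%:C.
Proof.
have pi0 := @pi_gt0 R.
have pp : - pi < pi :> R by lra.
have [->|a0] := eqVneq a 0.
  rewrite /cintegral mulr0 /sinc eqxx mulr1.
  under eq_Rintegral do rewrite mul0r /= cos0.
  under [X in _ +i* X]eq_Rintegral do rewrite mul0r /= sin0.
  rewrite !Rintegral_cst//= lebesgue_measure_itv/= lte_fin pp /= mul0r mul1r.
  by congr (_ +i* _); ring.
have cm : continuous (fun x : R => a * x) by move=> x; exact: mulrl_continuous.
have cosm : continuous (fun x : R => cos (a * x)).
  by move=> x; apply: continuous_comp; [exact: cm|exact: continuous_cos].
have sinm : continuous (fun x : R => sin (a * x)).
  by move=> x; apply: continuous_comp; [exact: cm|exact: continuous_sin].
have dsin (x : R) : is_derive x 1 (fun y : R => sin (a * y) / a) (cos (a * x)).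
  by apply: is_derive_eq; rewrite scaler0 add0r /GRing.scale/=; field.
have dcos (x : R) : is_derive x 1 (fun y : R => - cos (a * y) / a) (sin (a * x)).
  by apply: is_derive_eq; rewrite scaler0 add0r /GRing.scale/=; field.
rewrite /cintegral /= (FTC2_derivable pp cosm dsin) (FTC2_derivable pp sinm dcos).
rewrite mulrN sinN cosN /sinc mulf_eq0 (gt_eqF pi0) (negbTE a0) /= [pi * a]mulrC.
congr (_ +i* _); last by rewrite subrr.
have piN0 : pi != 0 :> R by rewrite gt_eqF.
have key (S P : R) : P != 0 -> S / a - - S / a = 2 * P * (S / (a * P)).
  by move=> PN0; field; rewrite PN0 a0.
exact: key.
Qed.

End exponentials.

Section cube_integrals.
Context {R : realType} {n : nat}.
Local Notation mu := (@lebesgue_row R n).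

Lemma measurable_cube (a : R) : measurable (@cube R n a).
Proof.
rewrite (_ : cube a = [set x | forall i : 'I_n, `[- a, a]%classic (x 0 i)]).
  by apply: (@measurable_box R n (fun=> `[- a, a]%classic)) => i.
by apply/seteqP; split => x /= H i; have := H i; rewrite /= in_itv.
Qed.

Lemma lebesgue_row_cube (a : R) : 0 <= a -> mu (cube a) = ((2 * a) ^+ n)%:E.
Proof.
move=> a0; rewrite (_ : cube a = [set x | forall i : 'I_n, `[- a, a]%classic (x 0 i)]).
  rewrite (@lebesgue_rowE R n (fun=> `[- a, a]%classic))//.
  under eq_bigr do rewrite lebesgue_measure_itv /= lte_fin.
  rewrite (_ : (if _ then _ else _) = (2 * a)%:E).
    by elim: (n) => [|m IH]; rewrite ?big_ord0 ?expr0// big_ord_recl IH exprS EFinM.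
  case: ifPn => [_|]; first by rewrite -EFinD; congr _%:E; ring.
  by rewrite -leNgt => ?; congr _%:E; lra.
by apply/seteqP; split => x /= H i; have := H i; rewrite /= in_itv.
Qed.

Lemma measurable_dotr (s : 'rV[R]_n) : measurable_fun setT (dotr s).
Proof.
rewrite /dotr; apply: measurable_sum => i; apply: measurable_funM => //.
exact: measurable_coord.
Qed.

Lemma cmeasurable_expi_dotr (s : 'rV[R]_n) : cmeasurable setT (fun x => expi (dotr s x)).
Proof.
have [mc ms] := @cmeasurable_expi R.
by split; [apply: (measurableT_comp mc)|apply: (measurableT_comp ms)]; exact: measurable_dotr.
Qed.

Lemma cmeasurable_exponential (s : 'rV[R]_n) : cmeasurable setT (exponential s).
Proof. by apply: cmeasurableM; [exact: cmeasurable_cst|exact: cmeasurable_expi_dotr]. Qed.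

Lemma integrable_cube_cst (a c : R) : 0 <= a -> mu.-integrable (cube a) (fun=> c%:E).
Proof.
move=> a0; apply/integrableP; split; first exact: measurable_cst.
rewrite integral_cst//; last exact: measurable_cube.
by rewrite [X in (_ * X)%E]lebesgue_row_cube// -EFinM ltry.
Qed.

Lemma L2_cube_bounded (a M : R) (f : 'rV[R]_n -> R[i]) : 0 <= a ->
  cmeasurable (cube a) f -> (forall x, cube a x -> sqrc (f x) <= M) -> L2 mu (cube a) f.
Proof.
move=> a0 mf fM; apply: (@L2_le _ _ _ _ _ (@measurable_cube a) _ (fun=> M)) => //.
exact: integrable_cube_cst.
Qed.

Lemma cintegral_mkcond (D : set 'rV[R]_n) (f : 'rV[R]_n -> R[i]) :
  cintegral mu D f = cintegral mu setT (fun x => f x * (\1_D x)%:C).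
Proof.
rewrite /cintegral; congr (_ +i* _); rewrite Rintegral_mkcond;
  apply: eq_Rintegral => x _; rewrite patchE indicE ?Re_mul ?Im_mul;
  by case: (x \in D) => /=; rewrite ?mulr1 ?mulr0 ?subr0 ?add0r.
Qed.

Lemma indic_cube (a : R) (x : 'rV[R]_n) :
  (\1_(cube a) x)%:C = \prod_(i < n) (\1_(`[- a, a]%classic) (x 0 i))%:C :> R[i].
Proof.
rewrite indicE; case: (boolP (x \in cube a)) => [/set_mem xa|xa].
  rewrite big1// => i _; rewrite indicE mem_set//= in_itv/=; exact: xa.
have [i /negP xi] : exists i, ~ (- a <= x 0 i <= a).
  by apply/existsNP => H; move/negP : xa; apply; apply/mem_set.
rewrite (bigD1 i)//= indicE memNset ?mul0r//= in_itv/=; exact/negP.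
Qed.

End cube_integrals.

Section exponential_dot.
Context {R : realType} {n : nat}.
Local Notation mu := (@lebesgue_row R n).
Local Notation Q := (@cube R n pi).
Implicit Types s t : 'rV[R]_n.

Lemma pi_nneg : 0 <= pi :> R.
Proof. by rewrite pi_ge0. Qed.

Lemma exponential_const_sqr :
  (((2 * pi) `^ (n%:R / 2))^-1) ^+ 2 = ((2 * pi) ^+ n)^-1 :> R.
Proof.
rewrite exprVn; congr (_^-1).
rewrite -[LHS]powR_mulrn ?powR_ge0// -powRrM divfK ?pnatr_eq0//.
by rewrite powR_mulrn// mulr_ge0// pi_nneg.
Qed.

Lemma sqrc_exponential s x : sqrc (exponential s x) = ((2 * pi) ^+ n)^-1.
Proof. by rewrite sqrcM sqrc_expi mulr1 sqrcC exponential_const_sqr. Qed.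

Lemma L2_exponential s : L2 mu Q (exponential s).
Proof.
apply: (@L2_cube_bounded _ _ _ ((2 * pi) ^+ n)^-1); first exact: pi_nneg.
  by apply: cmeasurableS (cmeasurable_exponential s) => //.
by move=> x _; rewrite sqrc_exponential.
Qed.

Lemma cintegral_expi_dotr s :
  cintegral mu Q (fun x => expi (dotr s x)) =
  ((2 * pi) ^+ n * \prod_(j < n) sinc (pi * s 0 j))%:C.
Proof.
rewrite cintegral_mkcond.
pose u (j : 'I_n) (x : R) : R[i] := expi (s 0 j * x) * (\1_(`[- pi, pi]%classic) x)%:C.
have mu_u j : cmeasurable setT (u j).
  apply: cmeasurableM.
    have [mc ms] := @cmeasurable_expi R.
    by split; [apply: (measurableT_comp mc)|apply: (measurableT_comp ms)]; exact: measurable_funM.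
  by split; [exact: measurable_indic|exact: measurable_cst].
have iu j : cintegrable lebesgue_measure setT (u j).
  apply: (@cintegrable_le _ _ _ lebesgue_measure setT measurableT _
      (\1_(`[- pi, pi]%classic))); first exact: mu_u.
    exact: integrable_indic_itv.
  move=> x _; rewrite Normc.normcM normc_expi mul1r normc_sqrt sqrcC sqrtr_sqr.
  by rewrite indicE ger0_norm.
rewrite (@eq_cintegral _ _ _ _ _ _ 
  (fun x : 'rV[R]_n => \prod_(j < n) u j (x 0 j))); last first.
  by move=> x _; rewrite indic_cube /dotr expi_sum -big_split.
rewrite (cintegral_lebesgue_row_prod iu).2 rmorphM rmorph_prod /= rmorphXn /=.
rewrite -[X in _ = X ^+ _ * _]/((2 * pi)%:C).
rewrite -[X in _ = _ ^+ X * _]card_ord -prodr_const -big_split /=.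
apply: eq_bigr => j _; transitivity (2 * pi * sinc (pi * s 0 j))%:C; last by rewrite rmorphM.
rewrite -integral_expi.
rewrite /cintegral; congr (_ +i* _); rewrite [RHS]Rintegral_mkcond;
  by apply: eq_Rintegral => x _; rewrite patchE /u indicE ?Re_mul ?Im_mul;
  case: (x \in _) => /=; rewrite ?mulr1 ?mulr0 ?subr0 ?add0r.
Qed.

Lemma dotr_subl s t x : dotr (s - t) x = dotr s x - dotr t x.
Proof. by rewrite /dotr -sumrB; apply: eq_bigr => i _; rewrite !mxE mulrBl. Qed.

Lemma dot_exponential s t :
  L2dot mu Q (exponential s) (exponential t) =
  (\prod_(j < n) sinc (pi * (s 0 j - t 0 j)))%:C.
Proof.
rewrite /L2dot; under eq_cintegral => x _.
  rewrite (_ : _ * _ = ((2 * pi) ^+ n)^-1%:C * expi (dotr (s - t) x)); last first.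
    rewrite /exponential dotr_subl expiD expiN -exponential_const_sqr.
    by apply: complex_ext; rewrite !reim_simpl /=; ring.
  over.
rewrite cintegralZl//; last 2 first.
- exact: measurable_cube.
- apply: (@cintegrable_le _ _ _ _ _ (@measurable_cube _ _ _) _ (fun=> 1)).
  + by apply: cmeasurableS (cmeasurable_expi_dotr _) => //.
  + by apply: integrable_cube_cst; exact: pi_nneg.
  + by move=> x _; rewrite normc_expi.
rewrite cintegral_expi_dotr -rmorphM mulrA mulVf ?mul1r; last first.
  by rewrite expf_neq0// mulf_neq0// gt_eqF// pi_gt0.
by congr (_%:C); apply: eq_bigr => j _; rewrite !mxE.
Qed.

End exponential_dot.

(** * The identity [sum_m sinc^2 (pi (y + m)) = 1] *)

Section sinc_series.
Context {R : realType}.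
Implicit Types (x y z : R) (s : seq int) (m k : int).

Lemma sin_pi_int m : sin (pi * m%:~R) = 0 :> R.
Proof.
have nat_case (j : nat) : sin (pi * j%:R) = 0 :> R.
  elim: j => [|j IH]; first by rewrite mulr0 sin0.
  by rewrite -natr1 mulrDr mulr1 sinDpi IH oppr0.
case: m => j; first by rewrite -pmulrn nat_case.
by rewrite NegzE mulrNz -pmulrn mulrN sinN nat_case oppr0.
Qed.

Lemma cos_pi_int m : cos (pi * m%:~R) ^+ 2 = 1 :> R.
Proof. by rewrite cos2sin2 sin_pi_int expr0n subr0. Qed.

Lemma sinc_pi_int m k : sinc (pi * (m%:~R - k%:~R)) = (m == k)%:R :> R.
Proof.
rewrite -intrB /sinc mulf_eq0 (gt_eqF (pi_gt0 _)) /= intr_eq0 subr_eq0.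
by case: eqP => // _; rewrite sin_pi_int mul0r.
Qed.

Lemma cosB_pi_int x k : cos (x - pi * k%:~R) ^+ 2 = cos x ^+ 2.
Proof.
by rewrite cosB sin_pi_int mulr0 addr0 exprMn cos_pi_int mulr1.
Qed.

Lemma sinc_halve z : sinc z ^+ 2 = cos (z / 2) ^+ 2 * sinc (z / 2) ^+ 2.
Proof.
rewrite /sinc mulf_eq0 invr_eq0 pnatr_eq0 orbF.
case: eqVneq => [->|z0]; first by rewrite mul0r cos0 expr1n mulr1.
rewrite -exprMn; congr (_ ^+ 2); rewrite {1}(_ : z = (z / 2) *+ 2); last by field.
by rewrite sin_mulr2n; field.
Qed.

Lemma sinc_near0 (e : R) : 0 < e ->
  exists2 r : R, 0 < r & forall z, `|z| < r -> 1 - sinc z ^+ 2 <= e.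
Proof.
move=> e0.
have H : (fun h : R => h^-1 * sin h) @ (0 : R)^' --> (1 : R).
  have [dd dv] := is_derive_sin (0 : R).
  have /cvg_ex[/= l Hl] := dd.
  have lE : 'D_1 (@sin R) 0 = l by apply: cvg_lim Hl.
  move: Hl; rewrite -lE dv cos0.
  by under eq_fun do rewrite /= sin0 subr0 /shift /= addr0 /GRing.scale /= mulr1.
have H2 : (fun h : R => (h^-1 * sin h) * (h^-1 * sin h)) @ (0 : R)^' --> (1 : R).
  by rewrite -[X in _ --> X]mul1r; exact: cvgM.
move/cvgrPdist_le : H2 => /(_ _ e0) /nbhs_ballP[r /= r0 Hr].
exists r => // z zr; rewrite /sinc; case: eqVneq => [_|z0].
  by rewrite expr1n subrr ltW.
have := Hr z; rewrite /ball/= sub0r normrN => /(_ zr z0).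
move=> /(le_trans (ler_norm _)).
by rewrite expr2 [sin z / z]mulrC.
Qed.

Definition sinc_sum s y : R := \sum_(m <- s) sinc (pi * (y - m%:~R)) ^+ 2.

(** Bessel's inequality in dimension 1: the exponentials of integer frequency are orthonormal, and
    the sinc values are the coefficients of the unit vector of frequency [y]. *)
Lemma sinc_sum_le1 s y : uniq s -> sinc_sum s y <= 1.
Proof.
move=> us; pose u m : 'rV[R]_1 -> R[i] := exponential (const_mx m%:~R).
have uu k m : L2dot (@lebesgue_row R 1) (cube pi) (u k) (u m) = (k == m)%:R.
  by rewrite dot_exponential big_ord1 !mxE sinc_pi_int; case: eqP.
have := @Bessel _ _ _ _ _ (measurable_cube pi) _ u (fun m => L2_exponential _) uu s
  (exponential (const_mx y)) us (L2_exponential _).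
have -> : sqL2 (@lebesgue_row R 1) (cube pi) (exponential (const_mx y)) = 1.
  apply: complexI; rewrite -L2dot_self; [|exact: measurable_cube|exact: L2_exponential].
  by rewrite dot_exponential big_ord1 subrr mulr0 /sinc eqxx.
apply: le_trans; apply: ler_sum => m _.
by rewrite dot_exponential sqrcC big_ord1 !mxE.
Qed.

(** The sum of the series over all integers, as a supremum over finite sets: translations and the
    splitting by parity become reindexings of finite sets. *)
Definition sinc_sup y : R := sup [set sinc_sum s y | s in [set s | uniq s]].

Let has_sup_sinc y : has_sup [set sinc_sum s y | s in [set s | uniq s]].
Proof.
split; first by exists (sinc_sum [::] y); exists [::].
by exists 1 => _ [s us <-]; exact: sinc_sum_le1.
Qed.

Lemma sinc_sum_le_sup s y : uniq s -> sinc_sum s y <= sinc_sup y.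
Proof. by move=> us; apply: (sup_upper_bound (has_sup_sinc y)); exists s. Qed.

Lemma sinc_sup_le y (C : R) : (forall s, uniq s -> sinc_sum s y <= C) -> sinc_sup y <= C.
Proof.
move=> H; apply: sup_le_ub; first by exists (sinc_sum [::] y); exists [::].
by move=> _ [s us <-]; exact: H.
Qed.

Lemma sinc_sup_le1 y : sinc_sup y <= 1.
Proof. by apply: sinc_sup_le => s; exact: sinc_sum_le1. Qed.

Lemma sinc_sup_ge0 y : 0 <= sinc_sup y.
Proof. by have := @sinc_sum_le_sup [::] y isT; rewrite /sinc_sum big_nil. Qed.

Lemma sinc_sup_ge y : sinc (pi * y) ^+ 2 <= sinc_sup y.
Proof. by have := @sinc_sum_le_sup [:: 0] y isT; rewrite /sinc_sum big_seq1 subr0. Qed.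

Lemma sinc_sup_shift y m : sinc_sup (y + m%:~R) = sinc_sup y.
Proof.
have shift_le z k : sinc_sup z <= sinc_sup (z + k%:~R).
  apply: sinc_sup_le => s us.
  apply: le_trans (sinc_sum_le_sup (s := map (+%R k) s) _ _); last first.
    by rewrite map_inj_uniq//; exact: addrI.
  rewrite /sinc_sum big_map; apply: ler_sum => j _.
  by rewrite (_ : z + k%:~R - (k + j)%:~R = z - j%:~R)//; rewrite intrD; ring.
apply/eqP; rewrite eq_le shift_le andbT.
by have := shift_le (y + m%:~R) (- m); rewrite intrN addrK.
Qed.

(* Splitting the integers by parity makes [sinc_sup y] a convex combination of
   its values at the two halves of [y] modulo 1.                              *)
Lemma sinc_sup_halve y :
  cos (pi * y / 2) ^+ 2 * sinc_sup (y / 2) +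
  sin (pi * y / 2) ^+ 2 * sinc_sup ((y + 1) / 2) <= sinc_sup y.
Proof.
have key s1 s2 : uniq s1 -> uniq s2 ->
    cos (pi * y / 2) ^+ 2 * sinc_sum s1 (y / 2) +
    sin (pi * y / 2) ^+ 2 * sinc_sum s2 ((y + 1) / 2) <= sinc_sup y.
  move=> us1 us2.
  (* The even integers carry the sum at [y / 2], the odd ones the sum at [(y + 1) / 2], where a
     shift by [pi / 2] turns the weight [cos] into [sin]. *)
  pose s := [seq 2 * k | k <- s1] ++ [seq 2 * k - 1 | k <- s2].
  have us : uniq s.
    rewrite cat_uniq !map_inj_uniq ?us1 ?us2 /=; last 2 first.
    - by move=> a b; lia.
    - by move=> a b; lia.
    by rewrite andbT; apply/hasPn => _ /mapP[k _ ->]; apply/negP => /mapP[j _]; lia.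
  apply: le_trans (sinc_sum_le_sup _ us).
  rewrite /sinc_sum big_cat !big_map /= !mulr_sumr; apply: lerD.
    apply: ler_sum => k _; rewrite [leRHS]sinc_halve.
    rewrite (_ : pi * (y - (2 * k)%:~R) / 2 = pi * y / 2 - pi * k%:~R); last first.
      by rewrite intrM; field.
    rewrite cosB_pi_int (_ : pi * y / 2 - pi * k%:~R = pi * (y / 2 - k%:~R))//.
    by field.
  apply: ler_sum => k _; rewrite [leRHS]sinc_halve.
  rewrite (_ : pi * (y - (2 * k - 1)%:~R) / 2 = pi * y / 2 + pi / 2 - pi * k%:~R); last first.
    by rewrite intrB intrM; field.
  rewrite cosB_pi_int cosDpihalf sqrrN.
  rewrite (_ : pi * y / 2 + pi / 2 - pi * k%:~R = pi * ((y + 1) / 2 - k%:~R))//.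
  by field.
have c0 := sqr_ge0 (cos (pi * y / 2)); have s0 := sqr_ge0 (sin (pi * y / 2)).
have cs := cos2Dsin2 (pi * y / 2).
apply/ler_addgt0Pr => e e0.
have [_ [s1 us1 <-] H1] := sup_adherent e0 (has_sup_sinc (y / 2)).
have [_ [s2 us2 <-] H2] := sup_adherent e0 (has_sup_sinc ((y + 1) / 2)).
have := key s1 s2 us1 us2.
rewrite -/(sinc_sup _) in H1; rewrite -/(sinc_sup _) in H2.
by nra.
Qed.

(** Suppose the defect [D] has supremum [S > 0]. For [|z| <= 1/2] the weight of [z / 2] in
    [sinc_sup_halve] is at least 1/2, so [D z <= (D (z / 2) + S) / 2]. After [j] halvings the
    argument is so near 0 that [D <= S / 2] there, which leaves [D z] below [S] by [2^-j S / 2]. As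
    [j] does not depend on [z] and [D] has period 1, this contradicts the choice of [S]. *)
Lemma sinc_sup1 y : sinc_sup y = 1.
Proof.
pose D z := 1 - sinc_sup z.
have D1 z : D z <= 1 by rewrite /D; have := sinc_sup_ge0 z; lra.
have D0 z : 0 <= D z by rewrite /D; have := sinc_sup_le1 z; lra.
have hD : has_sup (range D).
  by split; [exists (D 0); exists 0|exists 1 => _ [z _ <-]; exact: D1].
set S := sup (range D).
have DS z : D z <= S by apply: (sup_upper_bound hD); exists z.
suff S0 : S <= 0 by apply/eqP; rewrite eq_le sinc_sup_le1; have := DS y; rewrite /D; lra.
rewrite leNgt; apply/negP => S0.
(* Near 0 the single term [m = 0] already brings [D] below [S / 2]. *)
have [r r0 Hr] := @sinc_near0 (S / 2) (divr_gt0 S0 (ltr0n _ 2)).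
have Dr z : `|pi * z| < r -> D z <= S / 2.
  by move=> /Hr; have := sinc_sup_ge z; rewrite /D; lra.
have Dhalf z : `|z| <= 2^-1 -> D z <= (D (z / 2) + S) / 2.
  move=> zh; have := sinc_sup_halve z; rewrite /D.
  have := DS (z / 2); have := DS ((z + 1) / 2); rewrite /D.
  have cs := cos2Dsin2 (pi * z / 2).
  have : 2^-1 <= cos (pi * z / 2) ^+ 2.
    have : 0 <= cos (pi * z).
      apply: cos_ge0_pihalf; have := @pi_gt0 R; move: zh; rewrite ler_norml => /andP[].
      by move=> ? ? ?; apply/andP; split; nra.
    rewrite [X in 0 <= cos X](_ : pi * z = pi * z / 2 + pi * z / 2); last by field.
    by rewrite cosD -!expr2; lra.
  have := sqr_ge0 (sin (pi * z / 2)).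
  move: (cos _ ^+ 2) (sin _ ^+ 2) cs => c s cs; nra.
have Diter j z : `|z| <= 2^-1 -> D z <= S - 2^-1 ^+ j * (S - D (z / 2 ^+ j)).
  elim: j z => [|j IH] z zh; first by rewrite expr0 divr1; lra.
  have zh2 : `|z / 2| <= 2^-1.
    by rewrite normrM (@ger0_norm _ 2^-1)//; have := normr_ge0 z; lra.
  have := IH _ zh2; rewrite -mulrA -invfM -exprS => H.
  have := Dhalf z zh; rewrite exprS; have : 0 <= (2^-1 : R) ^+ j by rewrite exprn_ge0.
  by nra.
(* This [j] makes [|pi z / 2 ^ j| < r] for every [|z| <= 1/2]. *)
have [j Hj] : exists j, pi / r < 2 ^+ j.
  exists (Num.truncn (pi / r)).+1.
  rewrite (lt_le_trans (truncnS_gt _))// -natrX ler_nat ltnW// ltn_expl//.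
have Dj z : `|z| <= 2^-1 -> D z <= S - 2^-1 ^+ j * (S / 2).
  move=> zh; apply: (le_trans (Diter j z zh)); rewrite lerD2l lerN2 ler_wpM2l ?exprn_ge0//.
  suff : D (z / 2 ^+ j) <= S / 2 by lra.
  apply: Dr; rewrite normrM normrM (ger0_norm (pi_ge0 _)).
  rewrite (@ger0_norm _ (2 ^+ j)^-1) ?invr_ge0 ?exprn_ge0//.
  move: Hj; rewrite ltr_pdivrMr// mulrA ltr_pdivrMr ?exprn_gt0// => Hj.
  have := @pi_gt0 R; nra.
(* Subtracting the nearest integer, [floor (z + 1/2)], moves [z] into [[-1/2, 1/2]]. *)
have DSj z : D z <= S - 2^-1 ^+ j * (S / 2).
  have -> : D z = D (z - (Num.floor (z + 2^-1))%:~R).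
    by rewrite /D -[in RHS](sinc_sup_shift _ (Num.floor (z + 2^-1))) subrK.
  apply: Dj; have := floor_itv (z + 2^-1); rewrite ler_norml.
  by rewrite intrD => /andP[? ?]; apply/andP; split; lra.
have : S <= S - 2^-1 ^+ j * (S / 2).
  by apply: sup_le_ub => [|_ [z _ <-]]; [exact: hD.1|exact: DSj].
have : 0 < (2^-1 : R) ^+ j by rewrite exprn_gt0.
by nra.
Qed.

End sinc_series.

(** * Closed span of an orthonormal sequence *)

Lemma ler_sum_uniq_sub (R : realDomainType) (I : eqType) (s1 s2 : seq I) (F : I -> R) :
  (forall i, 0 <= F i) -> uniq s1 -> uniq s2 -> {subset s1 <= s2} ->
  \sum_(i <- s1) F i <= \sum_(i <- s2) F i.
Proof.
move=> F0 u1 u2 s12; rewrite [leRHS](bigID (mem s1))/= -[X in X + _]big_filter.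
have pe : perm_eq [seq i <- s2 | i \in s1] s1.
  apply: uniq_perm; rewrite ?filter_uniq// => i; rewrite mem_filter.
  by case: (boolP (i \in s1)) => //= /s12.
by rewrite (perm_big _ pe)/= lerDl sumr_ge0.
Qed.

Section complete_orthonormal.
Context {d : measure_display} {T : measurableType d} {R : realType}.
Variables (mu : {measure set T -> \bar R}) (D : set T).
Hypothesis mD : measurable D.
Local Notation L2 := (L2 mu D).
Local Notation sqL2 := (sqL2 mu D).
Local Notation dot := (L2dot mu D).
Variable e : nat -> T -> R[i].
Hypothesis Le : forall k, L2 (e k).
Hypothesis ee : forall k m, dot (e k) (e m) = (k == m)%:R.

(** By Pythagoras, the squared distance from [w] to the span of the first [K] vectors; in this form
    monotonicity in [K] is immediate. *)
Definition proj_defect K w : R := sqL2 w - \sum_(k < K) sqrc (dot w (e k)).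

Lemma proj_defectE K w : L2 w ->
  proj_defect K w = sqL2 (fun x => w x - \sum_(k <- iota 0 K) dot w (e k) * e k x).
Proof.
move=> Lw; rewrite (sqL2_sub_orthonormal_proj mD Le ee (iota_uniq _ _) Lw).
by rewrite /proj_defect -(big_mkord xpredT (fun k => sqrc (dot w (e k)))) /index_iota subn0.
Qed.

Lemma proj_defect_ge0 K w : L2 w -> 0 <= proj_defect K w.
Proof. by move=> Lw; rewrite proj_defectE// sqL2_ge0. Qed.

Lemma proj_defect_le K w : proj_defect K w <= sqL2 w.
Proof. by rewrite /proj_defect gerBl sumr_ge0// => k _; exact: sqrc_ge0. Qed.

Lemma proj_defect_nonincreasing K K' w : (K <= K')%N -> proj_defect K' w <= proj_defect K w.
Proof.
move=> KK'; rewrite lerD2l lerN2 -!(big_mkord xpredT (fun k => sqrc (dot w (e k)))).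
rewrite [leRHS](@big_cat_nat _ _ _ K)//= lerDl sumr_ge0// => k _; exact: sqrc_ge0.
Qed.

Lemma proj_defectD K v w : L2 v -> L2 w ->
  proj_defect K (fun x => v x + w x) <= 2 * proj_defect K v + 2 * proj_defect K w.
Proof.
move=> Lv Lw; rewrite !proj_defectE//; last exact: L2D.
have Lp u : L2 (fun x => \sum_(k <- iota 0 K) dot u (e k) * e k x) by exact: L2_sum.
apply: le_trans (sqL2D_le mD (L2B mD Lv (Lp v)) (L2B mD Lw (Lp w))).
rewrite le_eqVlt; apply/orP; left; apply/eqP; apply: eq_sqL2 => x _.
rewrite addrACA -opprD -big_split /=; congr (_ - _); apply: eq_bigr => k _.
by rewrite L2dotDl// mulrDl.
Qed.

Lemma proj_defectZ K a w : L2 w ->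
  proj_defect K (fun x => a * w x) = sqrc a * proj_defect K w.
Proof.
move=> Lw; rewrite /proj_defect sqL2Z// mulrBr mulr_sumr; congr (_ - _).
by apply: eq_bigr => k _; rewrite L2dotZl// sqrcM.
Qed.

Definition in_closed_span w := forall r : R, 0 < r -> exists K, proj_defect K w <= r.

Lemma in_closed_span_sum (I : Type) (s : seq I) (a : I -> R[i]) (F : I -> T -> R[i]) :
  (forall i, L2 (F i)) -> (forall i, in_closed_span (F i)) ->
  in_closed_span (fun x => \sum_(i <- s) a i * F i x).
Proof.
move=> LF cF; elim: s => [|i s IH] r r0.
  exists 0%N; apply: le_trans (ltW r0); under eq_fun do rewrite big_nil.
  by rewrite (le_trans (proj_defect_le _ _))// sqL2_0.
(* Each of the two summands may use up [r / 2]; the factor 2 of [proj_defectD] turns this into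
   [r / 4]. The [+ 1] covers [a i = 0]. *)
have sa : 0 < sqrc (a i) + 1 by have := sqrc_ge0 (a i); lra.
have [K1 H1] := cF i _ (divr_gt0 r0 (mulr_gt0 (ltr0n _ 4) sa)).
have [K2 H2] := IH _ (divr_gt0 r0 (ltr0n _ 4)).
exists (maxn K1 K2); under eq_fun do rewrite big_cons.
have Ls : L2 (fun x => \sum_(i <- s) a i * F i x) by exact: L2_sum.
apply: le_trans (proj_defectD _ (L2Z mD (a i) (LF i)) Ls) _.
rewrite proj_defectZ//.
have G1 := le_trans (proj_defect_nonincreasing (F i) (leq_maxl K1 K2)) H1.
have G2 := le_trans (proj_defect_nonincreasing _ (leq_maxr K1 K2)) H2.
move: G1; rewrite ler_pdivlMr ?mulr_gt0//.
have := sqrc_ge0 (a i); have := proj_defect_ge0 (maxn K1 K2) (LF i).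
move: G2; set p := proj_defect _ _; set q := proj_defect _ _; nra.
Qed.

Lemma in_closed_span_lim (v : nat -> T -> R[i]) w : (forall N, L2 (v N)) -> L2 w ->
  (forall N, in_closed_span (v N)) ->
  (sqL2 (fun x => v N x - w x) @[N --> \oo] --> 0) -> in_closed_span w.
Proof.
move=> Lv Lw cv vw r r0.
have r4 : 0 < r / 4 by rewrite divr_gt0.
move/cvgrPdist_lt : vw => /(_ _ r4)[N _ /(_ N (leqnn N))].
rewrite sub0r normrN ger0_norm ?sqL2_ge0// sqL2BC => HN.
have [K HK] := cv N _ r4; exists K.
have -> : proj_defect K w = proj_defect K (fun x => v N x + (w x - v N x)).
  by congr proj_defect; apply/funext => x; rewrite addrC subrK.
apply: le_trans (proj_defectD _ (Lv N) (L2B mD Lw (Lv N))) _.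
have := proj_defect_le K (fun x => w x - v N x).
by move: HN HK; lra.
Qed.

Lemma Parseval_closed_span w : L2 w -> in_closed_span w ->
  \sum_(k < K) sqrc (dot w (e k)) @[K --> \oo] --> sqL2 w.
Proof.
move=> Lw cw; apply/cvgrPdist_le => r r0; have [K HK] := cw r r0.
exists K => // K' /= KK'; rewrite -/(proj_defect K' w) ger0_norm ?proj_defect_ge0//.
exact: le_trans (proj_defect_nonincreasing _ KK') HK.
Qed.

End complete_orthonormal.

(** * Completeness of the lattice exponentials *)

Section lattice_exponentials.
Context {R : realType} {d : nat}.
Local Notation mu := (@lebesgue_row R d).
Local Notation Q := (@cube R d pi).
Variable n : nat -> 'rV[int]_d.
Hypothesis n_enum : bijective n.

Definition lattice_exp k : 'rV[R]_d -> R[i] := exponential (map_mx intr (n k)).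

Lemma dot_exponential_lattice y k : sqrc (L2dot mu Q (exponential y) (lattice_exp k)) =
  \prod_(j < d) sinc (pi * (y 0 j - (n k 0 j)%:~R)) ^+ 2.
Proof.
rewrite dot_exponential sqrcC -prodrXl; apply: eq_bigr => j _.
by rewrite mxE.
Qed.

Lemma lattice_exp_orthonormal k m : L2dot mu Q (lattice_exp k) (lattice_exp m) = (k == m)%:R.
Proof.
rewrite dot_exponential; under eq_bigr do rewrite !mxE sinc_pi_int.
case: eqVneq => [->|km]; first by rewrite big1// => j _; rewrite eqxx.
have [j /negP nj] : exists j, ~ (n k 0 j == n m 0 j).
  apply/existsNP => H; move/negP : km; apply; apply/eqP/(bij_inj n_enum)/rowP => j.
  exact/eqP.
by rewrite (bigD1 j)//= (negbTE nj) mul0r.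
Qed.

Lemma L2_lattice_exp k : L2 mu Q (lattice_exp k).
Proof. exact: L2_exponential. Qed.

Lemma sqL2_exponential y : sqL2 mu Q (exponential y) = 1.
Proof.
apply: complexI; rewrite -L2dot_self; [|exact: measurable_cube|exact: L2_exponential].
by rewrite dot_exponential big1// => j _; rewrite subrr mulr0 /sinc eqxx.
Qed.

(** Over a box [s^d] of lattice points the squared coefficients sum to the product of the
    [sinc_sum s (y_j)], each close to 1, while the vector has norm 1. The box is contained in an
    initial segment of the enumeration, which provides [K]. *)
Lemma exponential_in_closed_span y : in_closed_span mu Q lattice_exp (exponential y).
Proof.
(* By Bernoulli's inequality [d] factors at least [1 - q] have product at least [1 - d q >= 1 - r];
   the cap [q <= 1] keeps the factors nonnegative. *)
move=> r r0; pose q : R := Num.min (r / d.+1%:R) 1.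
have q0 : 0 < q by rewrite lt_min ltr01 divr_gt0.
have q1 : q <= 1 by rewrite ge_min lexx orbT.
have qr : d%:R * q <= r.
  have : q <= r / d.+1%:R by rewrite ge_min lexx.
  by rewrite ler_pdivlMr// -natr1; nra.
have /choice[sj Hsj] (j : 'I_d) : exists s, uniq s /\ 1 - q <= sinc_sum s (y 0 j).
  have hs : has_sup [set sinc_sum s (y 0 j) | s in [set s | uniq s]].
    split; first by exists (sinc_sum [::] (y 0 j)); exists [::].
    by exists 1 => _ [s us <-]; exact: sinc_sum_le1.
  have [_ [s us <-] H] := sup_adherent q0 hs.
  by exists s; split => //; move: H; rewrite -/(sinc_sup _) sinc_sup1 => /ltW.
(* The union of the finite sets found for the coordinates serves all of them, the terms being
   nonnegative. *)
pose s := undup (flatten [seq sj j | j <- enum 'I_d]).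
have us : uniq s by exact: undup_uniq.
have Hs j : 1 - q <= sinc_sum s (y 0 j).
  have [uj Hj] := Hsj j; apply: (le_trans Hj); apply: ler_sum_uniq_sub => //.
    by move=> m; exact: sqr_ge0.
  move=> m mj; rewrite mem_undup; apply/flatten_mapP; exists j => //.
  by rewrite mem_enum.
have Bernoulli (j : nat) : 1 - j%:R * q <= (1 - q) ^+ j.
  elim: j => [|j IH]; first by rewrite mul0r subr0 expr0.
  rewrite exprS -natr1; have q2 : 0 <= 1 - q by lra.
  have j0 : (0 : R) <= j%:R by [].
  apply: le_trans (ler_wpM2l q2 IH); nra.
pose v (f : {ffun 'I_d -> 'I_(size s)}) : 'rV[int]_d := \row_j tnth (in_tuple s) (f j).
have v_inj : injective v.
  move=> f g /rowP fg; apply/ffunP => j; have := fg j; rewrite !mxE => /eqP.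
  by rewrite !(tnth_nth 0) nth_uniq// => /eqP/val_inj.
have [ni nK niK] := n_enum.
pose kf f := ni (v f).
have kf_inj : injective kf by move=> f g /(congr1 n); rewrite !niK => /v_inj.
pose b k := sqrc (L2dot mu Q (exponential y) (lattice_exp k)).
have H1 : 1 - r <= \sum_(k <- [seq kf f | f <- enum {ffun 'I_d -> 'I_(size s)}]) b k.
  rewrite big_map big_enum /=.
  apply: (@le_trans _ _ (\prod_(j < d) sinc_sum s (y 0 j))).
    apply: (@le_trans _ _ ((1 - q) ^+ d)).
      by apply: le_trans (Bernoulli d); lra.
    rewrite -[X in _ ^+ X]card_ord -prodr_const.
    by apply: ler_prod => j _; rewrite Hs andbT; lra.
  have E j : sinc_sum s (y 0 j) =
      \sum_(i < size s) sinc (pi * (y 0 j - (tnth (in_tuple s) i)%:~R)) ^+ 2.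
    by rewrite /sinc_sum big_tnth.
  rewrite (eq_bigr _ (fun j _ => E j)).
  (* Expanding the product of sums gives one term for each lattice point of the box. *)
  rewrite bigA_distr_bigA; apply: ler_sum => f _.
  rewrite /b dot_exponential_lattice niK; apply: ler_prod => j _.
  by rewrite !mxE lexx andbT sqr_ge0.
set l := [seq kf f | f <- _] in H1.
exists (\max_(k <- l) k).+1; rewrite /proj_defect sqL2_exponential.
rewrite lerBlDr addrC -lerBlDr; apply: (le_trans H1).
rewrite -(big_mkord xpredT b); apply: ler_sum_uniq_sub.
- by move=> k; exact: sqrc_ge0.
- by rewrite map_inj_uniq// enum_uniq.
- exact: iota_uniq.
- by move=> k kl; rewrite mem_index_iota ltnS leq_bigmax_seq.
Qed.

Lemma lattice_Parseval (F : nat -> 'rV[R]_d -> R[i]) (t : nat -> 'rV[R]_d) w :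
  (forall k, F k = exponential (t k)) -> riesz_basis mu Q F -> L2 mu Q w ->
  \sum_(k < K) sqrc (L2dot mu Q w (lattice_exp k)) @[K --> \oo] --> sqL2 mu Q w.
Proof.
move=> FE rF Lw; have mQ := @measurable_cube R d pi.
have LF k : L2 mu Q (F k) by rewrite FE; exact: L2_exponential.
have [G dG] := riesz_dual mQ LF rF.
apply: (Parseval_closed_span mQ L2_lattice_exp lattice_exp_orthonormal Lw).
apply: (in_closed_span_lim mQ L2_lattice_exp lattice_exp_orthonormal _ Lw _
  (dual_expansion dG Lw)).
  by move=> N; exact: L2_sum.
move=> N; apply: (in_closed_span_sum mQ L2_lattice_exp lattice_exp_orthonormal) => i //.
by rewrite FE; exact: exponential_in_closed_span.
Qed.

End lattice_exponentials.

(** * Open sets of row vectors: a countable base of boxes *)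

Section row_topology.
Context {R : realType} {n : nat}.
Implicit Types (x y : 'rV[R]_n) (U : set 'rV[R]_n).
Local Notation mu := (@lebesgue_row R n).

Lemma coord_le_norm x i : `|x 0 i| <= `|x|.
Proof.
rewrite /Num.norm/= mx_normrE.
exact: (le_bigmax _ (fun ij => `|x ij.1 ij.2|) (0, i)).
Qed.

Lemma row_norm_lt x (e : R) : 0 < e -> (forall i, `|x 0 i| < e) -> `|x| < e.
Proof.
move=> e0 xe; rewrite /Num.norm/= mx_normrE.
by apply/bigmax_ltP; split => // -[i j] _ /=; rewrite ord1.
Qed.

(* The boxes with rational centres and radii [1 / (m + 1)], listed through the
   encoding of the countable type of their parameters.                        *)
Definition rat_box (k : nat) : set 'rV[R]_n :=
  if unpickle k is Some p then
    [set y : 'rV[R]_n | forall i, `]ratr ((p : 'rV[rat]_n * nat).1 0 i) - (p.2.+1%:R)^-1 : R,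
                           ratr (p.1 0 i) + (p.2.+1%:R)^-1[%classic (y 0 i)]
  else set0.

Lemma measurable_rat_box k : measurable (rat_box k).
Proof.
rewrite /rat_box; case: unpickle => [p|]; last exact: measurable0.
by apply: (@measurable_box R n (fun i => `](_ : R), _[%classic)) => i; exact: measurable_itv.
Qed.

Lemma rat_box_gt0 k x : rat_box k x -> (0 < mu (rat_box k))%E.
Proof.
rewrite /rat_box; case: unpickle => [p _|//].
rewrite (@lebesgue_rowE R n (fun i => `](_ : R), _[%classic))//.
have m0 : 0 < (p.2.+1%:R)^-1 :> R by rewrite invr_gt0.
under eq_bigr do rewrite lebesgue_measure_itv/= lte_fin ltrD2l gtrN// -EFinB.
elim/big_ind : _ => //= [a b a0 b0|i _]; first exact: mule_gt0.
by rewrite lte_fin; move: m0; set r := (_%:R)^-1 => m0; lra.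
Qed.

Lemma rat_box_base U x : open U -> U x -> exists k, rat_box k x /\ rat_box k `<=` U.
Proof.
move=> oU Ux; have : nbhs x U by exact: open_nbhs_nbhs.
move=> /nbhs_normP[e /= e0 eU].
pose m := Num.truncn (2 / e).
have me : 2 * (m.+1%:R)^-1 < e.
  by rewrite ltr_pdivrMr// mulrC -ltr_pdivrMr//; exact: truncnS_gt.
have m0 : 0 < (m.+1%:R)^-1 :> R by rewrite invr_gt0.
set r : R := (m.+1%:R)^-1 in me m0.
have /choice[q Hq] (i : 'I_n) : exists q : rat,
    ratr q \in `](x 0 i - r), (x 0 i + r)[%R.
  by apply: rat_in_itvoo; lra.
exists (pickle ((\row_i q i, m) : 'rV[rat]_n * nat)); rewrite /rat_box pickleK /= -/r.
split=> [i|y yb].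
  by have := Hq i; rewrite /= !mxE !in_itv/= => /andP[? ?]; apply/andP; split; lra.
apply: eU => /=; apply: row_norm_lt => // i; rewrite !mxE.
have := yb i; have := Hq i; rewrite /= !mxE !in_itv/= => /andP[? ?] /andP[? ?].
by rewrite ltr_norml; apply/andP; split; lra.
Qed.

(** The sigma-algebra on rows is generated by the coordinates and has no built-in link to the
    topology; the countable base writes an open set as a countable union of measurable boxes. *)
Lemma open_measurable_row U : open U -> measurable U.
Proof.
move=> oU; rewrite (_ : U = \bigcup_k (if `[< rat_box k `<=` U >] then rat_box k else set0)).
  apply: bigcupT_measurable => k; case: asboolP => _; last exact: measurable0.
  exact: measurable_rat_box.
apply/seteqP; split => x.
  move=> Ux; have [k [kx kU]] := rat_box_base oU Ux.
  by exists k => //; case: asboolP.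
by move=> [k _]; case: asboolP => // kU; exact: kU.
Qed.

Lemma continuous_measurable_row (f : 'rV[R]_n -> R) : continuous f -> measurable_fun setT f.
Proof.
move=> /continuousP cf; apply: (measurability _ (RGenOpens.measurableE R)).
move=> /= _ [_ [a [b ->]] <-]; apply: measurableI => //; apply: open_measurable_row.
by apply: cf; exact: interval_open.
Qed.

End row_topology.

(** * Limits and continuity of complex-valued functions *)

Section complex_continuity.
Context {R : realType}.

Lemma cvg_sqrcP (T : Type) (F : set_system T) {FF : Filter F} (f : T -> R[i]) (l : R[i]) :
  f @ F --> l <-> (sqrc (f x - l) @[x --> F] --> 0).
Proof.
split=> [/cvgrPdist_lt fl|/cvgrPdist_lt fl]; apply/cvgrPdist_lt => e e0.
  have es : (0 : R[i]) < (Num.sqrt e)%:C by rewrite ltcR sqrtr_gt0.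
  apply: filterS (fl _ es) => x; rewrite norm_normc ltcR sub0r normrN.
  rewrite ger0_norm ?sqrc_ge0// sqrcB -normc_sqr => H.
  by rewrite -[ltRHS](sqr_sqrtr (ltW e0)) ltr_pXn2r ?nnegrE ?normc_nneg ?sqrtr_ge0.
have [e1 eE] : 0 < complex.Re e /\ e = (complex.Re e)%:C.
  by move: e0; rewrite ltcE => /andP[/eqP/esym i0 ?]; split => //; exact: complex_ext.
have e2 : 0 < complex.Re e ^+ 2 by rewrite exprn_gt0.
apply: filterS (fl _ e2) => x; rewrite sub0r normrN ger0_norm ?sqrc_ge0// sqrcB.
rewrite -normc_sqr ltr_pXn2r ?nnegrE ?normc_nneg ?(ltW e1)// => H.
by rewrite norm_normc eE ltcR.
Qed.

Lemma cvg_ReIm (T : Type) (F : set_system T) {FF : Filter F} (f : T -> R[i]) (l : R[i]) :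
  f @ F --> l ->
  (complex.Re (f x) @[x --> F] --> complex.Re l) /\
  (complex.Im (f x) @[x --> F] --> complex.Im l).
Proof.
move=> /cvgrPdist_lt fl; split; apply/cvgrPdist_lt => e e0;
    have ec : (0 : R[i]) < e%:C by rewrite ltcR.
  apply: filterS (fl _ ec) => x; rewrite norm_normc ltcR; apply: le_lt_trans.
  by rewrite -Re_opp -Re_add Re_le_normc.
apply: filterS (fl _ ec) => x; rewrite norm_normc ltcR; apply: le_lt_trans.
by rewrite -Im_opp -Im_add Im_le_normc.
Qed.

Lemma continuous_cmeasurable n (f : 'rV[R]_n -> R[i]) :
  continuous f -> cmeasurable setT f.
Proof.
by move=> cf; split; apply: continuous_measurable_row => x; [have [] := cvg_ReIm (cf x)|
  have [_] := cvg_ReIm (cf x)].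
Qed.

(** The chord has squared length [4 sin^2 ((a - b) / 2)], and [sin^2 z <= z^2] is the one-term case
    of [sinc_sum_le1]. *)
Lemma sqrc_expi_sub (a b : R) : sqrc (expi a - expi b) <= (a - b) ^+ 2.
Proof.
have -> : sqrc (expi a - expi b) = 4 * sin ((a - b) / 2) ^+ 2.
  have := cosB a b; rewrite {1}(_ : a - b = (a - b) / 2 + (a - b) / 2); last by field.
  have := cos2Dsin2 ((a - b) / 2); rewrite cosD -!expr2.
  have := cos2Dsin2 a; have := cos2Dsin2 b.
  by rewrite /sqrc !reim_simpl /=; lra.
have : sin ((a - b) / 2) ^+ 2 <= ((a - b) / 2) ^+ 2.
  set z := (a - b) / 2; have pi0 : pi != 0 :> R by rewrite gt_eqF// pi_gt0.
  have := @sinc_sum_le1 R [:: 0] (z / pi) isT.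
  rewrite /sinc_sum big_seq1 subr0 mulrC divfK// /sinc; case: eqVneq => [->|z0 H].
    by rewrite sin0.
  have -> : sin z ^+ 2 = (sin z / z) ^+ 2 * z ^+ 2 by rewrite -exprMn divfK.
  by rewrite ler_piMl// sqr_ge0.
by rewrite exprMn exprVn; lra.
Qed.

End complex_continuity.

(** * Fourier integrals over cubes *)

Section fourier.
Context {R : realType} {n : nat}.
Local Notation mu := (@lebesgue_row R n).
Implicit Types (x y b : 'rV[R]_n) (w : 'rV[R]_n -> R[i]).

Definition fourier (D : set 'rV[R]_n) w x : R[i] :=
  cintegral mu D (fun xi => w xi * expi (- dotr x xi)).

Lemma cmeasurable_expiN_dotr x : cmeasurable setT (fun xi => expi (- dotr x xi)).
Proof. by under eq_fun do rewrite expiN; apply: cmeasurableJ; exact: cmeasurable_expi_dotr. Qed.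

Section fourier_cube.
Variable a : R.
Hypothesis a0 : 0 <= a.
Let D := @cube R n a.
Let mD : measurable D := @measurable_cube R n a.

Lemma Rintegral_cst_cube (c : R) : \int[mu]_(x in D) c = c * (2 * a) ^+ n.
Proof. by rewrite Rintegral_cst// [X in fine X]lebesgue_row_cube. Qed.

Lemma L2_expi_dotr x : L2 mu D (fun xi => expi (dotr x xi)).
Proof.
apply: (@L2_cube_bounded _ _ _ 1) => //; last by move=> xi _; rewrite sqrc_expi.
exact: cmeasurableS (cmeasurable_expi_dotr x).
Qed.

Lemma fourier_dot w x : fourier D w x = L2dot mu D w (fun xi => expi (dotr x xi)).
Proof. by apply: eq_cintegral => xi _; rewrite expiN. Qed.

Lemma L2_cube_cintegrable w : L2 mu D w -> cintegrable mu D w.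
Proof.
move=> Lw; have L1 : L2 mu D (fun=> 1).
  apply: (@L2_cube_bounded _ _ _ 1); [exact: a0|exact: cmeasurable_cst|].
  by move=> xi _; rewrite /sqrc /= expr1n expr0n addr0.
by apply: (eq_cintegrable mD _ (L2_cintegrableM mD Lw L1)) => xi _; rewrite mulr1.
Qed.

Lemma L2_mul_unimodular w (u : 'rV[R]_n -> R[i]) : L2 mu D w -> cmeasurable D u ->
  (forall xi, sqrc (u xi) = 1) -> L2 mu D (fun xi => w xi * u xi).
Proof.
move=> Lw mu' u1; apply: (L2_le mD _ (L2_sqrc Lw)).
  by apply: cmeasurableM => //; exact: L2_cmeas Lw.
by move=> xi _; rewrite sqrcM u1 mulr1.
Qed.

Lemma normr_dotr_le x xi : D xi -> `|dotr x xi| <= n%:R * a * `|x|.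
Proof.
move=> Dxi; rewrite /dotr; apply: le_trans (ler_norm_sum _ _ _) _.
have -> : n%:R * a * `|x| = \sum_(i < n) a * `|x|.
  by rewrite sumr_const card_ord -mulrA mulr_natl.
apply: ler_sum => i _; rewrite normrM mulrC ler_pM// ?coord_le_norm//.
by rewrite ler_norml; exact: Dxi.
Qed.

(** Cauchy-Schwarz against an exponential, of squared norm [(2 a) ^+ n] on the cube. The bound does
    not depend on [x], which is what yields uniform convergence. *)
Lemma sqrc_fourier_le w x : L2 mu D w ->
  sqrc (fourier D w x) <= 2 * ((2 * a) ^+ n * sqL2 mu D w).
Proof.
move=> Lw; rewrite fourier_dot.
apply: (le_trans (CauchySchwarz mD Lw (L2_expi_dotr x))).
rewrite [X in _ <= 2 * X]mulrC /sqL2.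
rewrite [X in 2 * (_ * X) <= _](@eq_Rintegral _ _ _ _ _ (fun=> 1)); last first.
  by move=> xi _; rewrite sqrc_expi.
by rewrite Rintegral_cst_cube mul1r.
Qed.

(** Cauchy-Schwarz against the difference of two exponentials, whose modulus on the cube is at most
    [n a |y - x|]. The constant [C] gathers the factors, with 1 added to make it positive. *)
Lemma continuous_fourier w : L2 mu D w -> continuous (fourier D w).
Proof.
have fin (A B N' e' : R) : 0 <= N' -> A <= B * N' -> N' * (2 * B + 1) <= e' -> 2 * A <= e'.
  by move=> *; nra.
move=> Lw.
suff H (x : 'rV[R]_n) : fourier D w y @[y --> x] --> fourier D w x by move=> x; exact: H.
have FF : Filter (nbhs x) := nbhs_filter x.
suff : sqrc (fourier D w y - fourier D w x) @[y --> x] --> (0 : R) by move/cvg_sqrcP.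
apply/cvgrPdist_le => e e0.
pose C := 2 * (sqL2 mu D w * ((n%:R * a) ^+ 2 * (2 * a) ^+ n)) + 1.
have C0 : 0 < C.
  by rewrite ltr_wpDl// !mulr_ge0 ?sqL2_ge0 ?exprn_ge0 ?mulr_ge0.
have eC : 0 < Num.sqrt (e / C) by rewrite sqrtr_gt0 divr_gt0.
have nx : nbhs_ball_ (ball_ Num.norm) x (fun y => `|y - x| <= Num.sqrt (e / C)).
  by exists (Num.sqrt (e / C)) => //= z; rewrite distrC => /ltW.
move/nbhs_normP : nx => nx.
apply: filterS nx => y yx1.
rewrite sub0r normrN ger0_norm ?sqrc_ge0// !fourier_dot -L2dotBr//; [|exact: L2_expi_dotr..].
have Lyx := L2B mD (L2_expi_dotr y) (L2_expi_dotr x).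
apply: (le_trans (CauchySchwarz mD Lw Lyx)).
have yx : `|y - x| ^+ 2 <= e / C.
  rewrite -[leRHS]sqr_sqrtr; last by rewrite divr_ge0 ?ltW.
  by rewrite ler_pXn2r ?nnegrE ?normr_ge0 ?sqrtr_ge0.
have Hs : sqL2 mu D (fun xi => expi (dotr y xi) - expi (dotr x xi)) <=
    (n%:R * a) ^+ 2 * (2 * a) ^+ n * `|y - x| ^+ 2.
  apply: le_trans (sqL2_le mD (G := fun=> (n%:R * a * `|y - x|) ^+ 2) Lyx _ _) _.
  - exact: integrable_cube_cst.
  - move=> xi Dxi; apply: (le_trans (sqrc_expi_sub _ _)).
    rewrite -dotr_subl -real_normK ?num_real// ler_pXn2r ?nnegrE ?mulr_ge0//.
    exact: normr_dotr_le.
  rewrite Rintegral_cst_cube exprMn.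
  by rewrite mulrAC.
move: yx; rewrite ler_pdivlMr//.
move: Hs; set S := sqL2 mu D _; set N := `|y - x| ^+ 2; set P := _ * (2 * a) ^+ n.
have P0 : 0 <= P by rewrite mulr_ge0 ?exprn_ge0 ?mulr_ge0.
have N0 : 0 <= N by exact: sqr_ge0.
have w0 := sqL2_ge0 mu D w; rewrite /C -/P => HS HN.
apply: (fin _ (sqL2 mu D w * P) N) => //.
by rewrite -mulrA ler_wpM2l.
Qed.

End fourier_cube.

End fourier.

(** * Dilations of cubes *)

Section scaling.
Context {R : realType} {n : nat}.
Local Notation mu := (@lebesgue_row R n).
Variables (c a : R).
Hypothesis c0 : 0 < c.
Let D := @cube R n (c * a).
Let D' := @cube R n a.
Let mD : measurable D := @measurable_cube R n (c * a).
Let mD' : measurable D' := @measurable_cube R n a.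

Lemma cube_scale (x : 'rV[R]_n) : D (c *: x) <-> D' x.
Proof.
by split=> H i; have := H i; rewrite mxE -mulrN !ler_pM2l.
Qed.

Let measurable_scale : measurable_fun setT (fun x : 'rV[R]_n => c *: x).
Proof.
have := @measurable_affine R n c 0; congr measurable_fun.
by apply/funext => x; rewrite addr0.
Qed.

Let restrict_scale (f : 'rV[R]_n -> \bar R) x :
  (f \_ D) (c *: x + 0) = ((fun y => f (c *: y)) \_ D') x.
Proof.
rewrite addr0 !patchE; case: (boolP (x \in D')) => xD.
  by rewrite mem_set//; apply/cube_scale; exact: set_mem.
by rewrite memNset// => /cube_scale xD'; move/negP : xD; apply; exact: mem_set.
Qed.

Lemma measurable_cube_scale (f : 'rV[R]_n -> R) :
  measurable_fun D f -> measurable_fun D' (fun x => f (c *: x)).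
Proof.
move=> mf; apply: (measurable_comp mD _ mf); last exact: measurable_funTS.
by move=> _ [x /cube_scale ? <-].
Qed.

Lemma ge0_integral_cube_scale (f : 'rV[R]_n -> R) : measurable_fun D f ->
  (forall x, 0 <= f x) ->
  (\int[mu]_(x in D') (f (c *: x))%:E = ((c ^+ n)^-1)%:E * \int[mu]_(x in D) (f x)%:E)%E.
Proof.
move=> mf f0; rewrite integral_mkcond [in RHS]integral_mkcond.
rewrite -(ge0_integral_affine 0 c0).
- by apply: eq_integral => x _; rewrite restrict_scale.
- by apply/(measurable_restrictT _ mD); exact/measurable_EFinP.
- by move=> x; rewrite patchE; case: ifP => _ //; rewrite lee_fin.
Qed.

Lemma integrable_cube_scale (f : 'rV[R]_n -> R) : mu.-integrable D (EFin \o f) ->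
  mu.-integrable D' (EFin \o (fun x => f (c *: x))).
Proof.
move=> /integrableP[/measurable_EFinP mf fi]; apply/integrableP; split.
  by apply/measurable_EFinP; exact: measurable_cube_scale.
rewrite (_ : (fun x => _) = (fun x => (`|f (c *: x)|)%:E))//.
rewrite (ge0_integral_cube_scale (f := fun x => `|f x|))//.
- by apply: lte_mul_pinfty => //; rewrite lee_fin invr_ge0 exprn_ge0// ltW.
- exact: measurableT_comp.
Qed.

Lemma Rintegral_cube_scale (f : 'rV[R]_n -> R) : mu.-integrable D (EFin \o f) ->
  \int[mu]_(x in D) f x = c ^+ n * \int[mu]_(x in D') f (c *: x).
Proof.
move=> intf; have cn : c ^+ n != 0 by rewrite expf_neq0// gt_eqF.
have intf' : mu.-integrable setT (EFin \o (f \_ D)).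
  by rewrite -restrict_EFin; apply/integrable_restrict => //; rewrite setTI.
rewrite Rintegral_mkcond [in RHS]Rintegral_mkcond.
have H := integral_affine 0 c0 intf'.
apply: (mulfI (invr_neq0 cn)); rewrite -H mulrA mulVf// mul1r.
apply: eq_Rintegral => x _; have := restrict_scale (EFin \o f) x.
by rewrite !patchE; case: ifP => _; case: ifP => _ // -[].
Qed.

Lemma cintegral_cube_scale (f : 'rV[R]_n -> R[i]) : cintegrable mu D f ->
  cintegral mu D f = (c ^+ n)%:C * cintegral mu D' (fun x => f (c *: x)).
Proof.
move=> intf; apply: complex_ext; rewrite ?Re_mulC ?Im_mulC /=; apply: Rintegral_cube_scale.
  exact: cintegrable_Re.
exact: cintegrable_Im.
Qed.

Lemma L2_cube_scale (w : 'rV[R]_n -> R[i]) : L2 mu D w ->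
  L2 mu D' (fun x => w (c *: x)) /\ sqL2 mu D w = c ^+ n * sqL2 mu D' (fun x => w (c *: x)).
Proof.
move=> /L2P[[wr wi] nw]; split; last exact: (Rintegral_cube_scale (f := fun x => sqrc (w x))).
apply/L2P; split.
  by split; [exact: (measurable_cube_scale wr)|exact: (measurable_cube_scale wi)].
exact: (integrable_cube_scale (f := fun x => sqrc (w x))).
Qed.

Lemma dotrZ (x y : 'rV[R]_n) : dotr x (c *: y) = dotr (c *: x) y.
Proof. by apply: eq_bigr => i _; rewrite !mxE mulrCA mulrA. Qed.

End scaling.

Lemma fourier_cube_scale (R : realType) n (c a : R) (w : 'rV[R]_n -> R[i]) x :
  0 < c -> 0 <= a -> L2 (@lebesgue_row R n) (cube (c * a)) w ->
  fourier (cube (c * a)) w x =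
  (c ^+ n)%:C * fourier (cube a) (fun y => w (c *: y)) (c *: x).
Proof.
move=> c0 a0 Lw; rewrite /fourier cintegral_cube_scale//.
  by congr (_ * _); apply: eq_cintegral => y _; rewrite dotrZ.
apply: L2_cube_cintegrable; first by rewrite mulr_ge0// ltW.
apply: L2_mul_unimodular => //; last by move=> xi; rewrite sqrc_expi.
by apply: cmeasurableS (cmeasurable_expiN_dotr x).
Qed.

(** * Plancherel's formula for functions on a cube *)

Section Plancherel.
Context {R : realType} {d : nat}.
Local Notation mu := (@lebesgue_row R d).
Local Notation Q := (@cube R d pi).
Variable n : nat -> 'rV[int]_d.
Hypothesis n_enum : bijective n.
Hypothesis Parseval : forall w, L2 mu Q w ->
  \sum_(k < K) sqrc (L2dot mu Q w (lattice_exp n k)) @[K --> \oo] --> sqL2 mu Q w.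

Let shift k : 'rV[R]_d := map_mx intr (n k).
(** Half open, so that its lattice translates partition the space; the tile of a point is read off
    the floors of its coordinates. *)
Let unit_cube : set 'rV[R]_d := [set x | forall i, `[0, 1[%classic (x 0 i)].
Let tile k : set 'rV[R]_d := [set x | unit_cube (x - shift k)].

Let measurable_unit_cube : measurable unit_cube.
Proof. by apply: (@measurable_box R d (fun=> `[0, 1[%classic)) => i; exact: measurable_itv. Qed.

Let unit_cube1 : mu unit_cube = 1%E.
Proof.
rewrite (@lebesgue_rowE R d (fun=> `[0, 1[%classic))// big1// => i _.
by rewrite lebesgue_measure_itv/= lte_fin ltr01 -EFinB subr0.
Qed.

Let measurable_tile k : measurable (tile k).
Proof.
have := @measurable_affine R d 1 (- shift k) measurableT _ measurable_unit_cube.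
by rewrite setTI; congr measurable; apply/seteqP; split => x /=; rewrite scale1r.
Qed.

Let tile_floor k x : tile k x -> forall i, n k 0 i = Num.floor (x 0 i).
Proof.
move=> H i; have := H i; rewrite /= !mxE in_itv/= => /andP[? ?].
by apply/esym/floor_def; rewrite intrD; apply/andP; split; lra.
Qed.

Let tile_cover : \bigcup_k tile k = setT.
Proof.
have [ni nK niK] := n_enum.
apply/seteqP; split => // x _; exists (ni (\row_i Num.floor (x 0 i))) => // i.
rewrite /= !mxE niK mxE in_itv/=.
by have := floor_itv (x 0 i); rewrite intrD => /andP[? ?]; apply/andP; split; lra.
Qed.

Let trivIset_tile : trivIset setT tile.
Proof.
apply/trivIsetP => k m _ _ /eqP km; apply/seteqP; split => // x [xk xm].
apply: km; apply: (bij_inj n_enum); apply/rowP => i.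
by rewrite (tile_floor xk) (tile_floor xm).
Qed.

(** A lattice shift of the argument multiplies the spectrum by a lattice exponential, so the values
    on [x + Z^d] are lattice coefficients of one modulated function, up to normalization. *)
Let sqrc_fourier_shift w x k : L2 mu Q w ->
  sqrc (fourier Q w (x + shift k)) =
  (2 * pi) ^+ d * sqrc (L2dot mu Q (fun xi => w xi * expi (- dotr x xi)) (lattice_exp n k)).
Proof.
move=> Lw; pose c : R := ((2 * pi) `^ (d%:R / 2))^-1.
have cN0 : ((2 * pi) ^+ d : R) != 0 by rewrite expf_neq0// mulf_neq0// gt_eqF// pi_gt0.
rewrite (_ : L2dot _ _ _ _ = c%:C * fourier Q w (x + shift k)).
  by rewrite sqrcM sqrcC exponential_const_sqr mulrA mulfV// mul1r.
rewrite -cintegralZl//; last 2 first.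
- exact: measurable_cube.
- apply: L2_cube_cintegrable; first exact: pi_nneg.
  apply: L2_mul_unimodular => //; last by move=> xi; rewrite sqrc_expi.
  by apply: cmeasurableS (cmeasurable_expiN_dotr _).
apply: eq_cintegral => xi _.
have -> : - dotr (x + shift k) xi = - dotr x xi + - dotr (shift k) xi.
  rewrite -opprD; congr (- _); rewrite /dotr -big_split.
  by apply: eq_bigr => i _; rewrite mxE mulrDl.
rewrite expiD /lattice_exp /exponential -/c !expiN.
by apply: complex_ext; rewrite !reim_simpl /=; ring.
Qed.

Lemma plancherel_Q w : L2 mu Q w ->
  (\int[mu]_x (sqrc (fourier Q w x))%:E = ((2 * pi) ^+ d * sqL2 mu Q w)%:E)%E.
Proof.
move=> Lw; pose G (x : 'rV[R]_d) := (sqrc (fourier Q w x))%:E.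
have mG : measurable_fun setT G.
  apply/measurable_EFinP; apply: measurable_sqrc; apply: continuous_cmeasurable.
  by apply: continuous_fourier => //; exact: pi_nneg.
have G0 x : (0 <= G x)%E by rewrite lee_fin sqrc_ge0.
pose Gk k (x : 'rV[R]_d) := G (x + shift k).
have mGk k : measurable_fun setT (Gk k).
  apply: (measurableT_comp mG); have := @measurable_affine R d 1 (shift k).
  by congr measurable_fun; apply/funext => x; rewrite scale1r.
rewrite -{1}tile_cover ge0_integral_bigcup//; last 2 first.
- exact: measurable_funTS mG.
- by move=> x _; exact: G0.
transitivity (\sum_(0 <= k <oo) \int[mu]_(x in unit_cube) Gk k x)%E.
  apply: eq_eseriesr => k _.
  rewrite integral_mkcond [RHS]integral_mkcond.
  have := @ge0_integral_affine R d 1 (shift k) (G \_ (tile k)) ltr01.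
  rewrite expr1n invr1 mul1e => <-.
  - apply: eq_integral => x _; rewrite scale1r !patchE.
    suff -> : (x + shift k \in tile k) = (x \in unit_cube) by [].
    by apply/idP/idP => /set_mem H; apply: mem_set; move: H; rewrite /tile/= addrK.
  - by apply/(measurable_restrictT _ (measurable_tile k)); exact: measurable_funTS.
  - by move=> x; rewrite patchE; case: ifP.
rewrite -integral_nneseries//; last 2 first.
- by move=> k; exact: measurable_funTS (mGk k).
- by move=> k x _; exact: G0.
(* The periodized integrand is constant: Parseval gives the squared norm of [w] modulated by [x],
   which is that of [w]. *)
rewrite (eq_integral (fun=> ((2 * pi) ^+ d * sqL2 mu Q w)%:E)).
  by rewrite integral_cst// [X in (_ * X)%E]unit_cube1 mule1.
move=> x _; apply: cvg_lim => //.
pose wx xi := w xi * expi (- dotr x xi).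
have Lwx : L2 mu Q wx.
  apply: L2_mul_unimodular => //; last by move=> xi; rewrite sqrc_expi.
  by apply: cmeasurableS (cmeasurable_expiN_dotr _).
have wxE : sqL2 mu Q w = sqL2 mu Q wx.
  by apply: eq_Rintegral => xi _; rewrite sqrcM sqrc_expi mulr1.
rewrite wxE (_ : (fun K => _) =
    (fun K => ((2 * pi) ^+ d * \sum_(k < K) sqrc (L2dot mu Q wx (lattice_exp n k)))%:E)).
  apply: cvg_EFin; first exact: nearW.
  by apply: cvgM; [exact: cvg_cst|exact: Parseval].
apply/funext => K; rewrite /G sumEFin big_mkord mulr_sumr; congr _%:E.
by apply: eq_bigr => k _; rewrite sqrc_fourier_shift.
Qed.

(** Dilation by [c] puts the square of [c ^+ d] in front of the transform; one factor is cancelled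
    by the substitution in [x], the other is absorbed in rescaling [w]. *)
Lemma plancherel_cube (a : R) w : 0 < a -> L2 mu (cube a) w ->
  (\int[mu]_x (sqrc (fourier (cube a) w x))%:E =
    ((2 * pi) ^+ d * sqL2 mu (cube a) w)%:E)%E.
Proof.
move=> a0; have pi0 := @pi_gt0 R.
have -> : a = (a / pi) * pi by rewrite divfK// gt_eqF.
have c0 : 0 < a / pi by rewrite divr_gt0.
move: (a / pi) c0 => c c0 Lw; have [Lwc ->] := L2_cube_scale c0 Lw.
have E x : (sqrc (fourier (cube (c * pi)) w x))%:E =
    (((c ^+ d) ^+ 2)%:E * (sqrc (fourier Q (fun y => w (c *: y)) (c *: x)))%:E)%E.
  by rewrite (fourier_cube_scale _ c0 pi_nneg)// sqrcM sqrcC EFinM.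
rewrite (eq_integral _ _ (fun x _ => E x)).
have mG : measurable_fun setT (fun x => (sqrc (fourier Q (fun y => w (c *: y)) x))%:E).
  apply/measurable_EFinP; apply: measurable_sqrc; apply: continuous_cmeasurable.
  by apply: continuous_fourier => //; exact: pi_nneg.
have cn : 0 < c ^+ d by rewrite exprn_gt0.
have mGc : measurable_fun setT
    (fun x : 'rV[R]_d => (sqrc (fourier Q (fun y => w (c *: y)) (c *: x)))%:E).
  apply: (measurableT_comp mG); have := @measurable_affine R d c 0.
  by congr measurable_fun; apply/funext => x; rewrite addr0.
rewrite ge0_integralZl_EFin//; [|by move=> x _; rewrite lee_fin sqrc_ge0|exact: sqr_ge0].
have := ge0_integral_affine 0 c0 mG (fun x => _).
rewrite plancherel_Q// => /(_ (fun x => sqrc_ge0 _)).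
have E0 x : (sqrc (fourier Q (fun y => w (c *: y)) (c *: x + 0)))%:E =
    (sqrc (fourier Q (fun y => w (c *: y)) (c *: x)))%:E by rewrite addr0.
rewrite (eq_integral _ _ (fun x _ => E0 x)).
by move=> ->; rewrite -!EFinM; congr _%:E; field; rewrite gt_eqF.
Qed.

End Plancherel.

(** * Restriction to subsets and extension by zero *)

Section restriction.
Context {d : measure_display} {T : measurableType d} {R : realType}.
Variables (mu : {measure set T -> \bar R}) (E : set T).
Hypothesis mE : measurable E.
Implicit Types (f g w : T -> R[i]).

Lemma L2S w : L2 mu setT w -> L2 mu E w.
Proof.
move=> /L2P[mw iw]; apply/L2P; split; first exact: cmeasurableS mw.
exact: integrableS iw.
Qed.

Lemma sqL2S (F : set T) w : measurable F -> E `<=` F -> L2 mu F w -> sqL2 mu E w <= sqL2 mu F w.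
Proof.
move=> mF EF Lw; have Lw' : L2 mu E w.
  move: Lw => /L2P[mw iw]; apply/L2P; split; first exact: cmeasurableS mw.
  exact: integrableS iw.
rewrite -lee_fin !EFin_sqL2//; apply: ge0_subset_integral => //.
  by apply/measurable_EFinP; apply: measurable_sqrc; exact: L2_cmeas Lw.
by move=> x _; rewrite lee_fin sqrc_ge0.
Qed.

Lemma cmeasurable_indic w : cmeasurable E w ->
  cmeasurable setT (fun x => w x * (\1_E x)%:C).
Proof.
have re x : complex.Re (w x * (\1_E x)%:C) = ((fun x => complex.Re (w x)) \_ E) x.
  by rewrite patchE indicE Re_mul; case: ifP => _ /=; rewrite ?mulr1 !mulr0 subr0.
have im x : complex.Im (w x * (\1_E x)%:C) = ((fun x => complex.Im (w x)) \_ E) x.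
  by rewrite patchE indicE Im_mul; case: ifP => _ /=; rewrite ?mulr1 !mulr0 add0r.
by move=> [wr wi]; split; [under eq_fun do rewrite re|under eq_fun do rewrite im];
  exact/(measurable_restrictT _ mE).
Qed.

Lemma L2_indic w : L2 mu E w -> L2 mu setT (fun x => w x * (\1_E x)%:C).
Proof.
move=> /L2P[mw iw]; apply/L2P; split; first exact: cmeasurable_indic.
move: iw => /(integrable_mkcond _ mE).
rewrite (_ : _ \_ E = (fun x => (sqrc (w x * (\1_E x)%:C))%:E))//.
apply/funext => x; rewrite patchE indicE sqrcM sqrcC; case: (x \in E).
  by rewrite expr1n mulr1.
by rewrite expr0n mulr0.
Qed.

Lemma cintegrable_indic w : cintegrable mu E w ->
  cintegrable mu setT (fun x => w x * (\1_E x)%:C).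
Proof.
move=> [mw iw]; split; first exact: cmeasurable_indic.
move: iw => /(integrable_mkcond _ mE).
rewrite (_ : _ \_ E = (fun x => (Normc.normc (w x * (\1_E x)%:C))%:E))//.
apply/funext => x; rewrite patchE indicE; case: (x \in E); rewrite ?mulr1 ?mulr0//.
by rewrite Normc.normc0.
Qed.

Lemma sqL2_indic w : sqL2 mu setT (fun x => w x * (\1_E x)%:C) = sqL2 mu E w.
Proof.
rewrite /sqL2 [RHS]Rintegral_mkcond; apply: eq_Rintegral => x _.
rewrite patchE indicE sqrcM sqrcC; case: (x \in E); first by rewrite expr1n mulr1.
by rewrite expr0n mulr0.
Qed.

End restriction.

(** Where the functions differ there is a whole box of positive measure on which they differ. *)
Lemma L2eq_continuous (R : realType) n (f g : 'rV[R]_n -> R[i]) :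
  continuous f -> continuous g -> L2eq (@lebesgue_row R n) setT f g -> f =1 g.
Proof.
move=> cf cg fg x; apply/eqP; apply: contrapT => /negP fgx.
pose u y := sqrc (f y - g y).
have uE : u = (fun y => (complex.Re (f y) - complex.Re (g y)) ^+ 2 +
    (complex.Im (f y) - complex.Im (g y)) ^+ 2).
  by apply/funext => y; rewrite /u /sqrc !Re_add !Im_add !Re_opp !Im_opp.
have cu : continuous u.
  rewrite uE => y; have [fr fi] := cvg_ReIm (cf y); have [gr gi] := cvg_ReIm (cg y).
  have r := cvgB fr gr; have i := cvgB fi gi.
  have FF : Filter (nbhs y) := nbhs_filter y.
  exact: (cvgD (cvgM (r FF) (r FF)) (cvgM (i FF) (i FF))).
have oU : open [set y | 0 < u y].
  by move/continuousP : cu => /(_ `]0, +oo[%classic (@interval_open _ _ _ _ _));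
    rewrite preimage_itvoy; apply.
have Ux : [set y | 0 < u y] x.
  rewrite /= /u lt_def sqrc_ge0 andbT.
  by apply: contra fgx => /eqP/sqrc_eq0/eqP; rewrite subr_eq0.
have [k [kx kU]] := rat_box_base oU Ux.
have := rat_box_gt0 kx; have [A [mA A0 AfgA]] := fg.
suff -> : @lebesgue_row R n (rat_box k) = 0%E by rewrite ltxx.
apply: (subset_measure0 _ mA _ A0); first exact: measurable_rat_box.
move=> y /kU uy; apply: AfgA => /= /(_ I) fgy.
by move: uy; rewrite /= /u fgy subrr sqrc0 ltxx.
Qed.

Lemma cintegrable_fourier (R : realType) n (a : R) (w : 'rV[R]_n -> R[i]) x : 0 <= a ->
  L2 (@lebesgue_row R n) (cube a) w ->
  cintegrable (@lebesgue_row R n) (cube a) (fun y => w y * expi (- dotr x y)).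
Proof.
move=> a0 Lw; apply: (L2_cube_cintegrable a0); apply: L2_mul_unimodular Lw _ _.
  exact: cmeasurableS measurableT (@subsetT _ _) (cmeasurable_expiN_dotr x).
by move=> xi; rewrite sqrc_expi.
Qed.

Lemma dotrC (R : realType) n (x y : 'rV[R]_n) : dotr x y = dotr y x.
Proof. by apply: eq_bigr => i _; rewrite mulrC. Qed.

(** * Moving the Fourier integral across the inner product *)

Section duality.
Context {R : realType} {n : nat}.
Local Notation mu := (@lebesgue_row R n).
Variables a b : R.
Hypotheses (a0 : 0 <= a) (b0 : 0 <= b).
Let Da := @cube R n a.
Let Db := @cube R n b.
Let mDa : measurable Da := @measurable_cube R n a.
Let mDb : measurable Db := @measurable_cube R n b.

Lemma cmeasurable_expi_dotr2 :
  cmeasurable setT (fun p : 'rV[R]_n * 'rV[R]_n => expi (dotr p.1 p.2)).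
Proof.
have mdot : measurable_fun setT (fun p : 'rV[R]_n * 'rV[R]_n => dotr p.1 p.2).
  apply: measurable_sum => i; apply: measurable_funM.
    by apply: (measurableT_comp (@measurable_coord _ R n i)); exact: measurable_fst.
  by apply: (measurableT_comp (@measurable_coord _ R n i)); exact: measurable_snd.
have [mc ms] := @cmeasurable_expi R.
by split; [exact: (measurableT_comp mc)|exact: (measurableT_comp ms)].
Qed.

(** Fubini for the kernel [f(x) conj(h(y)) e^(i <x, y>)]. Both functions are extended by zero; on a
    cube square integrable functions are integrable, so the kernel is dominated by an integrable
    product. *)
Lemma fourier_duality f h : L2 mu Da f -> L2 mu Db h ->
  L2dot mu Da f (fourier Db h) =
  L2dot mu Db (fun xi => cintegral mu Da (fun x => f x * expi (dotr xi x))) h.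
Proof.
move=> Lf Lh.
pose F x := f x * (\1_Da x)%:C; pose H x := (h x)^* * (\1_Db x)%:C.
have iF : cintegrable mu setT F.
  by apply: cintegrable_indic => //; exact: L2_cube_cintegrable.
have iH : cintegrable mu setT H.
  have iJ : cintegrable mu Db (fun x => (h x)^*) by exact: cintegrableJ (L2_cube_cintegrable b0 Lh).
  exact: (cintegrable_indic mDb iJ).
have iK : cintegrable (mu \x mu)%E setT (fun p => F p.1 * H p.2 * expi (dotr p.1 p.2)).
  have [mFH nFH] := cintegrable_prod iF iH.
  apply: (cintegrable_le measurableT _ nFH).
    by apply: cmeasurableM => //; exact: cmeasurable_expi_dotr2.
  by move=> p _; rewrite Normc.normcM normc_expi mulr1.
have iexp w x : cintegrable mu setT w -> cintegrable mu setT (fun y => w y * expi (dotr x y)).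
  move=> [mw nw]; apply: (cintegrable_le measurableT _ nw).
    by apply: cmeasurableM => //; exact: cmeasurable_expi_dotr.
  by move=> p _; rewrite Normc.normcM normc_expi mulr1.
have E := cintegral_fubini iK.
transitivity (cintegral mu setT
  (fun x => cintegral mu setT (fun y => F x * H y * expi (dotr x y)))).
  rewrite /L2dot [LHS]cintegral_mkcond; apply: eq_cintegral => x _.
  have -> : cintegral mu setT (fun y => F x * H y * expi (dotr x y)) =
      F x * cintegral mu setT (fun y => H y * expi (dotr x y)).
    rewrite -(cintegralZl measurableT _ (iexp H x iH)).
    by apply: eq_cintegral => y _; rewrite mulrA.
  have iq : cintegrable mu Db (fun y => h y * expi (- dotr x y)).
    exact: (cintegrable_fourier x b0 Lh).
  rewrite mulrAC; congr (_ * _).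
  apply: (etrans (esym (cintegralJ mDb iq))); rewrite [LHS]cintegral_mkcond.
  apply: eq_cintegral => y _; rewrite /H expiN.
  by apply: complex_ext; rewrite !reim_simpl /=; ring.
apply: (etrans E); rewrite /L2dot [RHS]cintegral_mkcond; apply: eq_cintegral => y _.
have -> : cintegral mu setT (fun x => F x * H y * expi (dotr x y)) =
    H y * cintegral mu setT (fun x => F x * expi (dotr y x)).
  rewrite -(cintegralZl measurableT _ (iexp F y iF)).
  by apply: eq_cintegral => x _; rewrite (dotrC x y) (mulrC (F x)) -mulrA.
rewrite [cintegral mu Da _]cintegral_mkcond.
rewrite (_ : cintegral mu setT (fun x => F x * expi (dotr y x)) =
  cintegral mu setT (fun x => f x * expi (dotr y x) * (\1_Da x)%:C)).
  by rewrite /H mulrC mulrA.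
by apply: eq_cintegral => x _; rewrite mulrAC.
Qed.

End duality.

(** * A continuous function is the Fourier integral of its inverse transform *)

Section inversion.
Context {R : realType} {d : nat}.
Local Notation mu := (@lebesgue_row R d).
Variable n : nat -> 'rV[int]_d.
Hypothesis n_enum : bijective n.
Hypothesis Parseval : forall w, L2 mu (cube pi) w ->
  \sum_(k < K) sqrc (L2dot mu (cube pi) w (lattice_exp n k)) @[K --> \oo] -->
  sqL2 mu (cube pi) w.

Let twopi_gt0 : 0 < (2 * pi) ^+ d :> R.
Proof. by rewrite exprn_gt0// mulr_gt0// pi_gt0. Qed.

Lemma L2_fourier (a : R) w : 0 < a -> L2 mu (cube a) w ->
  L2 mu setT (fourier (cube a) w) /\
  sqL2 mu setT (fourier (cube a) w) = (2 * pi) ^+ d * sqL2 mu (cube a) w.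
Proof.
move=> a0 Lw; have P := plancherel_cube n_enum Parseval a0 Lw.
have mF : cmeasurable setT (fourier (cube a) w).
  by apply: continuous_cmeasurable; apply: continuous_fourier => //; exact: ltW.
have LF : L2 mu setT (fourier (cube a) w).
  apply/L2P; split => //; apply/integrableP; split.
    by apply/measurable_EFinP; exact: measurable_sqrc.
  under eq_integral do rewrite gee0_abs ?lee_fin ?sqrc_ge0//.
  by rewrite P ltry.
by split => //; apply: EFin_inj; rewrite EFin_sqL2.
Qed.

(** Conjugation turns the inverse transform into the forward one, so Plancherel's formula covers
    both. *)
Lemma truncated_ifourierE f (a : R) x : 0 <= a -> L2 mu (cube a) f ->
  truncated_ifourier f a x =
  (((2 * pi) ^+ d)^-1)%:C * (fourier (cube a) (fun y => (f y)^*) x)^*.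
Proof.
move=> a0 Lf; rewrite /truncated_ifourier; congr (_ * _).
have mD := @measurable_cube R d a.
have iq : cintegrable mu (cube a) (fun y => (f y)^* * expi (- dotr x y)).
  exact: (cintegrable_fourier x a0 (L2J mD Lf)).
apply: (etrans _ (cintegralJ mD iq)); apply: eq_cintegral => y _; rewrite expiN.
by apply: complex_ext; rewrite !reim_simpl /=; ring.
Qed.

Section inverse_transform.
Variables (f h : 'rV[R]_d -> R[i]) (a : R).
Hypotheses (a0 : 0 < a) (f_h : is_ifourier f h) (cf : continuous f).
Hypothesis h0 : L2eq mu setT h (fun x => h x * (\1_(cube a) x)%:C).
Let h' x := h x * (\1_(cube a) x)%:C.
Let g := fourier (cube a) h.
Let mD k := @measurable_cube R d k.

Let Lf : L2 mu setT f. Proof. by case: f_h. Qed.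
Let Lh : L2 mu setT h. Proof. by case: f_h. Qed.
Let Lha : L2 mu (cube a) h. Proof. exact: L2S. Qed.
Let Lh' : L2 mu setT h'. Proof. exact: L2_indic. Qed.
Let Lg : L2 mu setT g. Proof. by case: (L2_fourier a0 Lha). Qed.

Let T (k : R) := truncated_ifourier f k.

Let LT k : 0 < k -> L2 mu setT (T k) /\
  sqL2 mu setT (T k) = ((2 * pi) ^+ d)^-1 * sqL2 mu (cube k) f.
Proof.
move=> k0; have LfJ : L2 mu (cube k) (fun y => (f y)^*) by apply: L2J => //; exact: L2S.
have [LF FE] := L2_fourier k0 LfJ.
have -> : T k = (fun x => (((2 * pi) ^+ d)^-1)%:C * (fourier (cube k) (fun y => (f y)^*) x)^*).
  by apply/funext => x; apply: truncated_ifourierE; [exact: ltW|exact: L2S].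
have LFJ := L2J measurableT LF.
split; first exact: L2Z.
rewrite sqL2Z// sqrcC (_ : sqL2 mu setT (fun x => (fourier (cube k) (fun y => (f y)^*) x)^*) =
    sqL2 mu setT (fourier (cube k) (fun y => (f y)^*))).
  rewrite FE mulrA; congr (_ * _).
    by move: twopi_gt0; move: ((2 * pi) ^+ d : R) => Z Z0; field; rewrite gt_eqF.
  by apply: eq_Rintegral => x _; rewrite sqrcJ.
by apply: eq_Rintegral => x _; rewrite sqrcJ.
Qed.

(** Duality moves the transform from [h] to [f], where the inner integral is [T k] without its
    prefactor. *)
Let dot_fg k : 0 < k -> L2dot mu (cube k) f g = ((2 * pi) ^+ d)%:C * L2dot mu setT (T k) h'.
Proof.
move=> k0; have Lfk : L2 mu (cube k) f by exact: L2S.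
rewrite (fourier_duality (ltW k0) (ltW a0) Lfk Lha).
have LTa : L2 mu (cube a) (T k) by apply: L2S => //; case: (LT k0).
rewrite /L2dot.
have -> : cintegral mu setT (fun x => T k x * (h' x)^*) = L2dot mu (cube a) (T k) h.
  rewrite /L2dot [RHS]cintegral_mkcond; apply: eq_cintegral => x _; rewrite /h'.
  by apply: complex_ext; rewrite !reim_simpl /=; ring.
rewrite /L2dot -(cintegralZl (mD a) _ (L2dot_integrable (mD a) LTa Lha)).
apply: eq_cintegral => x _; rewrite /T /truncated_ifourier.
rewrite !mulrA -rmorphM/= mulfV ?mul1r//.
by rewrite gt_eqF.
Qed.

(** Expand both squares. Plancherel matches the terms in [f], duality the cross terms, and for the
    last ones [|g|^2] over the cube is at most its value over the whole space, [(2 pi)^d |h|^2]. *)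
Let sqL2_sub_le k : 0 < k ->
  sqL2 mu (cube k) (fun x => f x - g x) <= (2 * pi) ^+ d * sqL2 mu setT (fun x => T k x - h x).
Proof.
move=> k0; have [LTk TE] := LT k0.
have Lfk : L2 mu (cube k) f by exact: L2S.
have Lgk : L2 mu (cube k) g by exact: L2S.
have -> : sqL2 mu setT (fun x => T k x - h x) = sqL2 mu setT (fun x => T k x - h' x).
  apply: L2eq_sqL2 => //; [exact: L2B|exact: L2B|].
  by apply: filterS h0 => x /[apply] hx; rewrite {1}hx.
rewrite !sqL2_sub// dot_fg// TE Re_mulC sqL2_indic//.
have [_ gE] := L2_fourier a0 Lha.
have := sqL2S (mD k) measurableT (@subsetT _ _) Lg; rewrite gE.
set Z := (2 * pi) ^+ d; have Z0 : 0 < Z by [].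
have -> (u v w : R) : Z * (Z^-1 * u - 2 * v + w) = u - 2 * (Z * v) + Z * w.
  by field; rewrite gt_eqF.
by lra.
Qed.

(** By hypothesis [T k --> h], so the preceding inequality forces [f = g] almost everywhere on each
    cube; continuity of both removes the exceptional set. *)
Lemma ifourier_inversion : f =1 fourier (cube a) h.
Proof.
have cg : continuous (fourier (cube a) h) := continuous_fourier (ltW a0) Lha.
suff : L2eq mu setT f (fourier (cube a) h) by exact: L2eq_continuous.
have cT : sqL2 mu setT (fun x => T k.+1%:R x - h x) @[k --> \oo] --> (0 : R).
  apply/(L2cvgP measurableT) => //; first by move=> k; case: (@LT k.+1%:R).
  case: f_h => _ _; rewrite /L2cvg => H.
  have : (fun k : nat => k.+1%:R : R) @ \oo --> +oo.
    by rewrite (cvg_shiftS (fun k => k%:R : R)); exact: cvgr_idn.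
  by move=> k1; exact: (cvg_comp _ _ k1 H).
have E0 (j : nat) : sqL2 mu (cube j.+1%:R) (fun x => f x - g x) = 0.
  apply/eqP; rewrite eq_le sqL2_ge0 andbT.
  have Hc : (2 * pi) ^+ d * sqL2 mu setT (fun x => T k.+1%:R x - h x) @[k --> \oo] --> (0 : R).
    by rewrite -(mulr0 ((2 * pi) ^+ d)); apply: cvgM => //; exact: cvg_cst.
  rewrite -(cvg_lim _ Hc)//; apply: limr_ge; first by apply/cvg_ex; eexists; exact: Hc.
  (* The cube of index [j] stays fixed; for [k >= j] it lies inside the one on which the inequality
     is available. *)
  near=> k; apply: le_trans (@sqL2_sub_le k.+1%:R _) => //.
  apply: sqL2S => //.
    move=> x xj i; have /andP[x1 x2] := xj i.
    have jk : j.+1%:R <= k.+1%:R :> R by rewrite ler_nat ltnS; near: k; exact: nbhs_infty_ge.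
    by apply/andP; split; lra.
  by apply: L2B => //; exact: L2S.
have Ej (j : nat) : L2eq mu (cube j.+1%:R) f g.
  by apply: sqL2_sub_eq0 => //; exact: L2S.
pose N j := [set x : 'rV[R]_d | ~ (cube j.+1%:R x -> f x = g x)].
have : mu.-negligible (\bigcup_j N j) by apply: negligible_bigcup => j; exact: Ej.
apply: negligibleS => x /= fgx.
exists (Num.truncn `|x|) => //= xE; apply: fgx => _; apply: xE => i.
have := coord_le_norm x i; have := truncnS_gt `|x|.
by move=> H1 H2; rewrite -ler_norml; lra.
Unshelve. all: by end_near. Qed.

End inverse_transform.
End inversion.

(** The complement of the support is a union of open sets on which [h] vanishes almost everywhere.
    The countable base reduces it to countably many boxes, with [N k] the exceptional set of the
    [k]-th. *)
Lemma essential_support_ae (R : realType) n (h : 'rV[R]_n -> R[i]) (E : set 'rV[R]_n) :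
  essential_support h `<=` E ->
  {ae @lebesgue_row R n, forall x, ~ E x -> h x = 0}.
Proof.
move=> hE; pose N k := [set x | ~ (L2eq (@lebesgue_row R n) (rat_box k) h (fun=> 0) ->
  rat_box k x -> h x = 0)].
have : (@lebesgue_row R n).-negligible (\bigcup_k N k).
  apply: negligible_bigcup => k.
  have [hk|hk] := pselect (L2eq (@lebesgue_row R n) (rat_box k) h (fun=> 0)).
    by apply: negligibleS hk => x /= Nx; apply: contra_not Nx => Nx _.
  suff -> : N k = set0 by exact: negligible_set0.
  by apply/seteqP; split => x //=; apply => /hk.
apply: negligibleS => x /= hx; apply: contrapT => Nx; apply: hx => Ex.
have /existsNP[U /not_implyP[oU /not_implyP[Ux /contrapT hU]]] :
    ~ essential_support h x by move=> /hE.
have [k [kx kU]] := rat_box_base oU Ux.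
apply: contrapT => hx; apply: Nx; exists k => // H; apply: hx; apply: H kx.
by apply: filterS hU => y hy /kU; exact: hy.
Qed.

Lemma continuous_bounded_supp (R : realType) n (phi : 'rV[R]_n -> R) (a : R) :
  continuous phi -> (forall x, ~ cube a x -> phi x = 0) ->
  exists M : R, forall x, `|phi x| <= M.
Proof.
move=> cphi phi0.
have cK : compact (@cube R n a).
  rewrite (_ : cube a = [set v : 'rV[R]_n | forall i, `[(- a), a]%classic (v ord0 i)]).
    by apply: (@rV_compact _ _ (fun=> `[(- a), a]%classic)) => i; exact: segment_compact.
  by apply/seteqP; split => x xa i; have := xa i; rewrite /= in_itv.
have := continuous_compact (continuous_subspaceT cphi) cK.
move=> /compact_bounded[M [_ HM]].
exists (Num.max (M + 1) 0) => x; rewrite le_max; have [xa|xa] := pselect (cube a x).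
  by apply/orP; left; apply: (HM (M + 1)); [rewrite ltrDl|exists x].
by rewrite phi0// normr0 lexx orbT.
Qed.

Lemma uniform_sqrc_le (R : realType) (T : choiceType) (s : nat -> T -> R[i]) f (b : nat -> R) :
  (forall l x, sqrc (s l x - f x) <= b l) -> (b l @[l --> \oo] --> 0) ->
  {uniform, s @ \oo --> f}.
Proof.
move=> sb /cvgrPdist_lt b0 A /uniform_nbhs[E [+ EA]].
rewrite -entourage_ballE => -[e /= e0 eE].
have [e1 eC] : 0 < complex.Re e /\ e = (complex.Re e)%:C.
  by move: e0; rewrite ltcE => /andP[/eqP/esym i0 ?]; split => //; exact: complex_ext.
have e2 : 0 < complex.Re e ^+ 2 by rewrite exprn_gt0.
apply: filterS (b0 _ e2) => l; rewrite sub0r normrN => bl; apply: EA => x _.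
apply: eE => /=; rewrite -ball_normE /= norm_normc eC ltcR.
rewrite -(ltr_pXn2r (ltn0Sn 1)) ?nnegrE ?normc_nneg ?(ltW e1)// normc_sqr -sqrcB.
by apply: le_lt_trans (sb l x) _; apply: le_lt_trans bl; exact: ler_norm.
Qed.

Lemma sincN (R : realType) (x : R) : sinc (- x) = sinc x.
Proof. by rewrite /sinc oppr_eq0 sinN invrN mulrNN. Qed.

Lemma L2_mul_bounded d (T : measurableType d) (R : realType)
    (mu : {measure set T -> \bar R}) (D : set T) (p w : T -> R[i]) (M : R) :
  measurable D -> cmeasurable D p -> (forall x, D x -> sqrc (p x) <= M) -> L2 mu D w ->
  L2 mu D (fun x => p x * w x) /\ sqL2 mu D (fun x => p x * w x) <= M * sqL2 mu D w.
Proof.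
move=> mD mp pM Lw; have iw := L2_sqrc Lw.
have iG : mu.-integrable D (fun x => (M * sqrc (w x))%:E).
  by have := integrableZl mD M iw; congr (integrable _ _ _).
have pwM x : D x -> sqrc (p x * w x) <= M * sqrc (w x).
  by move=> Dx; rewrite sqrcM ler_wpM2r ?sqrc_ge0//; exact: pM.
have mpw : cmeasurable D (fun x => p x * w x) := cmeasurableM mp (L2_cmeas Lw).
have Lpw : L2 mu D (fun x => p x * w x) := L2_le mD mpw iG pwM.
by split => //; rewrite /sqL2 -RintegralZl//; exact: sqL2_le iG pwM.
Qed.

(** * Oversampled series as Fourier integrals *)

Section oversampling.
Context {R : realType} {d : nat}.
Local Notation mu := (@lebesgue_row R d).
Local Notation Q := (@cube R d pi).
Let c0 : R := ((2 * pi) `^ (d%:R / 2))^-1.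
Let c0_neq0 : c0 != 0.
Proof. by rewrite invr_eq0 gt_eqF// powR_gt0// mulr_gt0// pi_gt0. Qed.
Variables (lambda : R) (lambda_gt0 : 0 < lambda).
Let b : R := lambda * pi.
Let D := @cube R d b.
Let b_gt0 : 0 < b. Proof. by rewrite mulr_gt0// pi_gt0. Qed.
Let b_ge0 : 0 <= b. Proof. exact: ltW. Qed.
Let mD : measurable D := @measurable_cube R d b.
Let mQ : measurable Q := @measurable_cube R d pi.

Lemma fourierB (w1 w2 : 'rV[R]_d -> R[i]) x : L2 mu D w1 -> L2 mu D w2 ->
  fourier D (fun xi => w1 xi - w2 xi) x = fourier D w1 x - fourier D w2 x.
Proof.
move=> L1 L2; rewrite /fourier -(cintegralB mD (cintegrable_fourier x b_ge0 L1)
  (cintegrable_fourier x b_ge0 L2)).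
by apply: eq_cintegral => xi _; rewrite mulrBl.
Qed.

(** Multiplying the spectrum by an exponential of frequency [t k / lambda] translates the transform
    by [t k / lambda]; translates of one kernel thus correspond to [phi] times a trigonometric
    sum. *)
Lemma fourier_modulated_sum l (a : 'I_l -> R[i]) (t : 'I_l -> 'rV[R]_d) phi x : L2 mu D phi ->
  fourier D (fun xi => phi xi * \sum_(k < l) a k * exponential (t k) (lambda^-1 *: xi)) x =
  c0%:C * \sum_(k < l) a k * fourier D phi (x - lambda^-1 *: t k).
Proof.
move=> Lphi; have ik k := cintegrable_fourier (x - lambda^-1 *: t k) b_ge0 Lphi.
rewrite mulr_sumr.
have -> : \sum_(k < l) c0%:C * (a k * fourier D phi (x - lambda^-1 *: t k)) =
    \sum_(k < l) cintegral mu D (fun xi => c0%:C * a k *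
      (phi xi * expi (- dotr (x - lambda^-1 *: t k) xi))).
  by apply: eq_bigr => k _; rewrite (cintegralZl mD _ (ik k)) mulrA.
rewrite -(cintegral_sum mD _ (fun k => cintegrableZl mD (c0%:C * a k) (ik k))).
apply: eq_cintegral => xi _; rewrite mulr_sumr mulr_suml; apply: eq_bigr => k _.
have -> : - dotr (x - lambda^-1 *: t k) xi = dotr (t k) (lambda^-1 *: xi) + - dotr x xi.
  by rewrite dotr_subl opprB dotrZ.
by rewrite expiD /exponential -/c0; ring.
Qed.

(** [lambda ^+ d] is the Jacobian of the substitution [xi = lambda y], and [c0^-1] undoes the
    normalization of [exponential]. *)
Lemma fourier_sample h s : L2 mu D h ->
  fourier D h (lambda^-1 *: s) =
  (lambda ^+ d * c0^-1)%:C * L2dot mu Q (fun y => h (lambda *: y)) (exponential s).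
Proof.
move=> Lh; rewrite (fourier_cube_scale _ lambda_gt0 pi_nneg Lh).
have [LH _] := L2_cube_scale lambda_gt0 Lh.
rewrite scalerA mulfV ?gt_eqF// scale1r.
have -> : L2dot mu Q (fun y => h (lambda *: y)) (exponential s) =
    c0%:C * fourier Q (fun y => h (lambda *: y)) s.
  rewrite /fourier -(cintegralZl mQ _ (cintegrable_fourier s pi_nneg LH)).
  apply: eq_cintegral => y _; rewrite /exponential -/c0 expiN.
  by apply: complex_ext; rewrite !reim_simpl /=; ring.
by rewrite mulrA; congr (_ * _); rewrite -rmorphM/= mulfVK.
Qed.

Variable n : nat -> 'rV[int]_d.
Hypothesis n_enum : bijective n.
Hypothesis Parseval : forall w, L2 mu Q w ->
  \sum_(k < K) sqrc (L2dot mu Q w (lattice_exp n k)) @[K --> \oo] --> sqL2 mu Q w.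

Variables (f g h : 'rV[R]_d -> R[i]) (phi : 'rV[R]_d -> R) (M : R) (t : nat -> 'rV[R]_d)
  (a : forall l, 'I_l -> R[i]).
Arguments a : clear implicits.
Hypotheses (Lh : L2 mu setT h) (Lf : L2 mu setT f) (h0 : {ae mu, forall x, ~ Q x -> h x = 0})
  (phi_cont : continuous phi) (phiM : forall x, `|phi x| <= M)
  (phi1 : forall x : 'rV[R]_d, Q x -> phi x = 1)
  (fE : f =1 fourier D h) (gE : g =1 fourier D (fun xi => (phi xi)%:C)).
Let A l x := \sum_(k < l) a l k * exponential (t k) x.
Let H x := h (lambda *: x).
Hypothesis A_H : sqL2 mu Q (fun x => A l x - H x) @[l --> \oo] --> 0.
Let s l (x : 'rV[R]_d) := c0%:C * \sum_(k < l) a l k * g (x - lambda^-1 *: t k).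

Let mphi : cmeasurable D (fun xi => (phi xi)%:C).
Proof.
have m := continuous_measurable_row phi_cont.
by split; [exact: measurable_funTS m|exact: measurable_cst].
Qed.

Let sqrc_phi x : D x -> sqrc (phi x)%:C <= M ^+ 2.
Proof.
move=> _; rewrite sqrcC -real_normK ?num_real// ler_pXn2r ?nnegrE//.
by apply: le_trans (phiM 0).
Qed.

Let Lphi : L2 mu D (fun xi => (phi xi)%:C).
Proof. exact: L2_cube_bounded b_ge0 mphi sqrc_phi. Qed.

Let LhD : L2 mu D h. Proof. exact: L2S. Qed.
Let LA l : L2 mu Q (A l).
Proof. by apply: L2_sum => // k; exact: L2_exponential. Qed.
Let LE l : L2 mu Q (fun x => A l x - H x).
Proof. by apply: L2B => //; case: (L2_cube_scale lambda_gt0 LhD). Qed.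

Let b_inv : pi = lambda^-1 * b.
Proof. by rewrite mulKf// gt_eqF. Qed.

Let scaled w : L2 mu Q w -> L2 mu D (fun x => w (lambda^-1 *: x)) /\
  sqL2 mu D (fun x => w (lambda^-1 *: x)) = lambda ^+ d * sqL2 mu Q w.
Proof.
have li : 0 < lambda^-1 by rewrite invr_gt0.
rewrite [in L2 mu Q w]b_inv => /(L2_cube_scale li)[Lw]; rewrite -b_inv => ->; split => //.
by rewrite mulrA -exprMn mulfV ?expr1n ?mul1r// gt_eqF.
Qed.

Let W l xi := (phi xi)%:C * (A l (lambda^-1 *: xi) - H (lambda^-1 *: xi)).

Let LW l : L2 mu D (W l) /\
  sqL2 mu D (W l) <= M ^+ 2 * (lambda ^+ d * sqL2 mu Q (fun x => A l x - H x)).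
Proof.
have [LEs <-] := scaled (LE l).
exact: (L2_mul_bounded mD mphi sqrc_phi LEs).
Qed.

Let s_f l x : s l x - f x = fourier D (W l) x.
Proof.
have [LAs _] := scaled (LA l).
have [LphiA _] := L2_mul_bounded mD mphi sqrc_phi LAs.
have [Lphih _] := L2_mul_bounded mD mphi sqrc_phi LhD.
have -> : s l x = fourier D (fun xi => (phi xi)%:C * A l (lambda^-1 *: xi)) x.
  rewrite fourier_modulated_sum// /s; congr (_ * _).
  by apply: eq_bigr => k _; rewrite gE.
have -> : f x = fourier D (fun xi => (phi xi)%:C * h xi) x.
  rewrite fE; apply: ae_eq_cintegral => //.
  - by case: (cintegrable_fourier x b_ge0 LhD).
  - by case: (cintegrable_fourier x b_ge0 Lphih).
  - apply: filterS h0 => xi hxi _; have [Qxi|/hxi ->] := pselect (Q xi).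
      by rewrite phi1// mul1r.
    by rewrite mulr0.
rewrite -fourierB//; apply: eq_cintegral => xi _; congr (_ * _).
by rewrite /W /H scalerA mulfV ?gt_eqF// scale1r mulrBr.
Qed.

Let W0 : sqL2 mu D (W l) @[l --> \oo] --> 0.
Proof.
apply: (@squeeze_cvgr _ _ _ _ (fun=> 0)
  (fun l => M ^+ 2 * (lambda ^+ d * sqL2 mu Q (fun x => A l x - H x)))).
- by apply: nearW => l; rewrite sqL2_ge0/=; case: (LW l).
- exact: cvg_cst.
- rewrite -(mulr0 (M ^+ 2)) -(mulr0 (lambda ^+ d)).
  by apply: cvgM; [exact: cvg_cst|apply: cvgM => //; exact: cvg_cst].
Qed.

Lemma oversampled_series_cvg : L2cvg mu setT s f /\ {uniform, s @ \oo --> f}.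
Proof.
have sE l : s l = (fun x => fourier D (W l) x + f x).
  by apply/funext => x; rewrite -s_f subrK.
have LFW l := L2_fourier n_enum Parseval b_gt0 (LW l).1.
split.
  apply/(L2cvgP measurableT) => //.
    by move=> l; rewrite sE; apply: L2D => //; case: (LFW l).
  rewrite (_ : (fun l => _) = (fun l => (2 * pi) ^+ d * sqL2 mu D (W l))).
    by rewrite -(mulr0 ((2 * pi) ^+ d)); apply: cvgM => //; exact: cvg_cst.
  apply/funext => l; have [_ <-] := LFW l.
  by apply: eq_Rintegral => x _; rewrite s_f.
apply: (@uniform_sqrc_le _ _ _ _ (fun l => 2 * ((2 * b) ^+ d * sqL2 mu D (W l)))).
  by move=> l x; rewrite s_f; apply: sqrc_fourier_le => //; case: (LW l).
rewrite [X in _ --> X](_ : _ = 2 * ((2 * b) ^+ d * 0)); last by rewrite !mulr0.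
by apply: cvgM; [exact: cvg_cst|apply: cvgM => //; exact: cvg_cst].
Qed.

End oversampling.

(** * Recovery of Paley-Wiener functions from their samples *)

Theorem theorem5p1 (R : realType) (d : nat) (d_gt0 : (0 < d)%N)
    (n : nat -> 'rV[int]_d) (n_enum : bijective n)
    (t : nat -> 'rV[R]_d)
    (n_t : `|map_mx intr (n k) - t k| @[k --> \oo] --> (0 : R))
    (lambda0 lambda : R) (lambda0_gt1 : 1 < lambda0)
    (g : 'rV[R]_d -> R[i]) (g_cont : continuous g)
    (phi : 'rV[R]_d -> R) (g_phi : is_ifourier g (fun x => (phi x)%:C))
    (phi_smooth : smooth phi)
    (phi1 : forall x : 'rV[R]_d, cube pi x -> phi x = 1)
    (phi0 : forall x : 'rV[R]_d, ~ [set lambda0 *: y | y in cube pi] x -> phi x = 0)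
    (lambda_ge : lambda0 <= lambda) :
  let mu : {measure set 'rV[R]_d -> \bar R} := @lebesgue_row R d in
  let Q : set 'rV[R]_d := cube pi in
  let F k : 'rV[R]_d -> R[i] := exponential (t k) in
  let Sinv := L2inv mu Q (frame_operator mu Q F) in
  let B := matrix_operator
    (fun k m => L2dot mu Q (Sinv (F m)) (Sinv (F k))) in
  let PBP l := compression l (l2inv B) in
  riesz_basis mu Q F ->
  (forall l, corner l (PBP l) \in unitmx) /\
  (forall f : 'rV[R]_d -> R[i], paley_wiener Q f ->
    let c l : 'cV[R[i]]_l :=
      invmx (corner l (PBP l)) *m \col_(k < l) f (lambda^-1 *: t k) in
    let s l (x : 'rV[R]_d) : R[i] :=
      (((2 * pi) ^+ d)^-1)%:C * ((lambda ^+ d)^-1)%:C *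
      \sum_(k < l) c l k 0 * g (x - lambda^-1 *: t k) in
    L2cvg mu setT s f /\ {uniform, s @ \oo --> f}) /\
  (forall l k m : nat, entry (PBP l) k m =
    if (k < l)%N && (m < l)%N
    then (\prod_(j < d) sinc (pi * (t k 0 j - t m 0 j)))%:C else 0).
Proof.
move=> mu Q F Sinv B PBP rF.
have mQ : measurable Q := @measurable_cube R d pi.
have LF k : L2 mu Q (F k) := L2_exponential (t k).
have [G dG] := riesz_dual mQ LF rF.
have entryE l k m : entry (PBP l) k m =
    if (k < l)%N && (m < l)%N
    then (\prod_(j < d) sinc (pi * (t k 0 j - t m 0 j)))%:C else 0.
  (* The entry is [<F m, F k>], which produces the differences [t m - t k]; sinc is even. *)
  rewrite [LHS](entry_compression_dual mQ LF dG) dot_exponential; case: ifP => // _.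
  by congr _%:C; apply: eq_bigr => j _; rewrite -sincN -mulrN opprB.
split; first by move=> l; exact: (gram_unitmx mQ LF dG l).
split; last exact: entryE.
move=> f [cf [h f_h hQ]] c s.
have lambda0_gt0 : 0 < lambda0 by exact: lt_trans lambda0_gt1.
have lambda_gt0 : 0 < lambda by exact: lt_le_trans lambda_ge.
have lambda_ge1 : 1 <= lambda by exact: le_trans (ltW lambda0_gt1) lambda_ge.
have pi0 := @pi_gt0 R.
have b_gt0 : 0 < lambda * pi by rewrite mulr_gt0.
have Parseval w := lattice_Parseval n_enum (fun k => erefl (F k)) rF (w := w).
have h0 := essential_support_ae hQ.
(* Since [lambda0 <= lambda], the support of [phi] fits in the cube of half-side [lambda pi], over
   which both [f] and [g] are written as Fourier integrals. *)
have phi0' x : ~ cube (lambda * pi) x -> phi x = 0.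
  move=> xD; apply: phi0 => -[y yQ yx]; apply: xD => i; rewrite -yx mxE.
  have := yQ i; rewrite -!ler_norml => yi.
  by rewrite normrM gtr0_norm// ler_pM// ltW.
(* The empty list of partial derivatives gives [phi] itself. *)
have [phi_cont _] := phi_smooth [::].
have [M phiM] := continuous_bounded_supp phi_cont phi0'.
have fE : f =1 fourier (cube (lambda * pi)) h.
  apply: (ifourier_inversion n_enum Parseval) => //.
  apply: filterS h0 => x hx _; rewrite indicE; have [xD|xD] := boolP (x \in _).
    by rewrite mulr1.
  rewrite mulr0; apply: hx => xQ; move/negP : xD; apply; apply: mem_set => i.
  have := xQ i; rewrite -!ler_norml => xi; apply: le_trans xi _.
  by rewrite ler_peMl// ltW.
have gE : g =1 fourier (cube (lambda * pi)) (fun x => (phi x)%:C).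
  apply: (ifourier_inversion n_enum Parseval) => //.
  apply: aeW => x _; rewrite indicE; have [xD|xD] := boolP (x \in _).
    by rewrite mulr1.
  by rewrite mulr0 phi0'// => xD'; move/negP : xD; apply; exact: mem_set.
have [Lf Lh _] := f_h.
have LhD : L2 mu (cube (lambda * pi)) h by apply: L2S => //; exact: measurable_cube.
have [LH _] := L2_cube_scale lambda_gt0 LhD.
have A_H := gram_projection_cvg mQ LF dG LH.
pose c0 : R := ((2 * pi) `^ (d%:R / 2))^-1.
have c0_neq0 : c0 != 0 by rewrite invr_eq0 gt_eqF// powR_gt0// mulr_gt0.
pose a l : 'cV[R[i]]_l := invmx (corner l (PBP l)) *m
  \col_(k < l) L2dot mu Q (fun x => h (lambda *: x)) (F k).
have cE l : c l = (lambda ^+ d * c0^-1)%:C *: a l.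
  rewrite /c /a scalemxAr; congr (_ *m _); apply/colP => k; rewrite !mxE fE.
  exact: fourier_sample.
(* The constants combine as [(2 pi)^-d lambda^-d (lambda^d / c0) = c0], because
   [c0^2 = (2 pi)^-d]. *)
have sE l x : s l x = c0%:C * \sum_(k < l) a l k 0 * g (x - lambda^-1 *: t k).
  rewrite /s cE; under eq_bigr do rewrite mxE -mulrA.
  rewrite -mulr_sumr mulrA -!rmorphM/=; congr (_%:C * _).
  rewrite -exponential_const_sqr -/c0 expr2.
  by field; rewrite c0_neq0/= expf_neq0// gt_eqF.
have -> : s = (fun l x => c0%:C * \sum_(k < l) a l k 0 * g (x - lambda^-1 *: t k)).
  by apply/funext => l; apply/funext => x; exact: sE.
exact: (oversampled_series_cvg lambda_gt0 n_enum Parseval (a := fun l k => a l k 0)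
  Lh Lf h0 phi_cont phiM phi1 fE gE A_H).
Qed.
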